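(* Let $(M,g)$ be a connected closed oriented Riemannian $4$-manifold. For any $h\in\Omega^0_+(\operatorname{Sym}^2(\Lambda^+))$, any point $x\in M$ and any non-zero cotangent vector $\xi\in T_x^*M$, the principal symbol of $D_h\Phi$ is the linear map $$\sigma_\xi(D_h\Phi)\colon\operatorname{Sym}^2(\Lambda_x^+)\rightarrow\operatorname{Sym}^2(\Lambda_x^+)$$ given by $$\sigma_\xi(D_h\Phi)(\eta)=(\xi\wedge\operatorname{ad}_{h_x}^{-1}(\xi\wedge B_\eta))^+h_x^{-1}$$ for every self-adjoint endomorphism $\eta\in\operatorname{Sym}^2(\Lambda_x^+)$ of the fibre $\Lambda_x^+$. The symbol $\sigma_\xi(D_h\Phi)$ is an automorphism. Moreover, at the identity endomorphism field $h=\operatorname{Id}$, $$\sigma_\xi(D_{\operatorname{Id}}\Phi)(\eta)=\frac{|\xi|^2(\eta_1-2\eta_0)}{2\sqrt{2}},$$ where $\eta=\eta_0+\eta_1$ is the decomposition of $\eta$ into its trace-free part $\eta_0$ and its scalar part $\eta_1$, i.e. $\operatorname{tr}(\eta_0)=0$ and $3\eta_1=\operatorname{tr}(\eta)\operatorname{Id}$.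
   Context: Everything is smooth. $\Lambda^k=\bigwedge^kT^*M$; $\Omega^k(\mathcal{E})$ is the space of smooth $\mathcal{E}$-valued $k$-forms; $\star$ is the Hodge star of $g$, acting on the ordinary form factor of bundle-valued forms; $T^\pm=\frac12(T\pm\star T)$ for a bundle-valued $2$-form $T$; $|\xi|$ is the norm induced by $g$. The bundle $\Lambda^+\subset\Lambda^2$ of self-dual $2$-forms ($\star\sigma=\sigma$) has rank three and carries the Euclidean metric induced by $g$ (for an orthonormal co-frame, the $\theta_a\wedge\theta_b$, $a<b$, are orthonormal in $\Lambda^2$). It is oriented by declaring positive the local orthonormal frame $\Sigma_i=-(\theta_0\wedge\theta_i+\theta_j\wedge\theta_k)/\sqrt2$, $(i,j,k)$ a cyclic permutation of $(1,2,3)$, where $(\theta_0,\theta_1,\theta_2,\theta_3)$ is a local oriented orthonormal co-frame. $[-,-]$ denotes the fibrewise cross product on $\Lambda^+$ ($[\Sigma_i,\Sigma_j]=\sum_k\epsilon_{ijk}\Sigma_k$), and $\mathfrak{so}(\Lambda^+)$ is identified with $\Lambda^+$ by letting $f$ correspond to $v\mapsto[f,v]$. For $\Lambda^+$-valued forms, $[\sum\alpha_i\otimes\Sigma_i,\sum\beta_j\otimes\Sigma_j]=\sum_{i,j}\alpha_i\wedge\beta_j\otimes[\Sigma_i,\Sigma_j]$. An $\operatorname{SO}(3)$ connection $A$ on $\Lambda^+$ is a metric connection, with exterior covariant derivative $d_A$ and curvature $F_A\in\Omega^2(\Lambda^+)$ (via $\mathfrak{so}(\Lambda^+)\cong\Lambda^+$),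 so $d_A^2\alpha=[F_A,\alpha]$; for $a\in\Omega^1(\Lambda^+)$, $\nabla^{A+a}v=\nabla^Av+[a,v]$. A $\Lambda^+$-valued self-dual $2$-form (or an element of $\Lambda^+_x\otimes\Lambda^+_x$) $T=\sum_{i,j}T_{ji}\Sigma_j\otimes\Sigma_i$ (first factor: ordinary form; second: coefficient) is regarded as the endomorphism $v\mapsto\sum_{i,j}T_{ji}\langle\Sigma_i,v\rangle\Sigma_j$ of $\Lambda^+$ (or $\Lambda_x^+$). $\operatorname{Sym}^2(\Lambda^+)$ is the bundle of self-adjoint endomorphisms of $\Lambda^+$, and $\Omega^0_+(\operatorname{Sym}^2(\Lambda^+))$ is the set of its smooth sections $h$ with $h>0$ (positive definite at every point). For an endomorphism field $h$ of $\Lambda^+$, $B_h\in\Omega^2(\Lambda^+)$ is given locally by $B_h=\sum_ih(\Sigma_i)\otimes\Sigma_i$ (first factor: ordinary $2$-form; second: coefficient), for any local oriented orthonormal frame; for $\eta\in\operatorname{Sym}^2(\Lambda_x^+)$, likewise $B_\eta=\sum_i\eta(\Sigma_i)\otimes\Sigma_i\in\Lambda^+_x\otimes\Lambda_x^+$. For $h\in\Omega^0_+(\operatorname{Sym}^2(\Lambda^+))$, $\operatorname{ad}_h(a)=[a,B_h]$ defines an invertible bundle map $\Lambda^1\otimes\Lambda^+\to\Lambda^3\otimes\Lambda^+$, with restriction $\operatorname{ad}_{h_x}\colon T_x^*M\otimes\Lambda_x^+\to\Lambda_x^3\otimes\Lambda_x^+$ to the fibre at $x$, and $A(h):=\Gamma-\operatorname{ad}_h^{-1}(d_\Gamma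 B_h)$, where $\Gamma$ is the connection on $\Lambda^+$ induced by the Levi--Civita connection of $g$. Then $\Phi(h)=\Phi_g(h):=F_{A(h)}^+h^{-1}-\operatorname{Id}$ (composition of endomorphisms), a section of $\operatorname{Sym}^2(\Lambda^+)$, and $D_h\Phi(\eta)=\frac{d}{dt}|_{t=0}\Phi(h+t\eta)$, a second order linear differential operator on $\Omega^0(\operatorname{Sym}^2(\Lambda^+))$. In the symbol formula, $\xi\wedge$ and the projection $(\cdot)^+$ act on the ordinary form factor, and the resulting self-dual tensor is regarded as an endomorphism of $\Lambda_x^+$ before composing with $h_x^{-1}$. Symbol convention: each derivative $\partial_j$ is replaced by $\sqrt{-1}\,\xi_j$ in the top-order part. *)

(* Defs.v *)
From HB Require Import structures.
From mathcomp Require Import all_boot all_order all_algebra.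
From mathcomp Require Import all_classical all_reals all_analysis.
Set Implicit Arguments.
Unset Strict Implicit.
Unset Printing Implicit Defensive.
Import Order.TTheory GRing.Theory Num.Theory.
Import numFieldNormedType.Exports.
Local Open Scope classical_set_scope.
Local Open Scope ring_scope.

(* Tensors at a point are arrays of components with respect to the coordinate *)
(* coframe dx^0, .., dx^3.  Covectors and points of R^4 are row vectors.  A   *)
(* 2-form is the antisymmetric matrix w of w = 1/2 sum_ij w_ij dx^i /\ dx^j   *)
(* (and likewise in degrees 1 and 3); a form with coefficients in Lambda^+ is *)
(* an array of such matrices, indexed by the indices of the ordinary form     *)
(* factor.                                                                    *)

Section Calculus.
Context {R : realType} {W : normedModType R}.

Definition pd (i : 'I_4) (f : 'rV[R]_4 -> W) (y : 'rV[R]_4) : W :=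
  'D_(delta_mx 0 i) f y.

Fixpoint Ck (n : nat) (V : set 'rV[R]_4) (f : 'rV[R]_4 -> W) : Prop :=
  (forall y, V y -> {for y, continuous f}) /\
  (if n is m.+1 then
     forall i, (forall y, V y -> derivable f y (delta_mx 0 i)) /\ Ck m V (pd i f)
   else True).

(* V is meant to be open. *)
Definition smooth_on (V : set 'rV[R]_4) (f : 'rV[R]_4 -> W) : Prop :=
  forall n, Ck n V f.

End Calculus.

Section Manifold.
Context (R : realType) (M : topologicalType).

Record chart := Chart {
  dom : set M;
  coord : M -> 'rV[R]_4;
  param : 'rV[R]_4 -> M;
  dom_open : open dom;
  image_open : open (coord @` dom);
  coord_continuous : forall x, dom x -> {for x, continuous coord};
  param_continuous : forall y, (coord @` dom) y -> {for y, continuous param};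
  coordK : forall x, dom x -> param (coord x) = x }.

(* Jacobian matrix at y of the change of coordinates from c to c'; its entry  *)
(* (i, j) is the i-th partial derivative of the j-th coordinate of c'.        *)
Definition jac (c c' : chart) (y : 'rV[R]_4) : 'M[R]_4 :=
  \matrix_(i, j) pd i (coord c' \o param c) y 0 j.

(* A smooth oriented 4-manifold structure, presented by an oriented atlas in  *)
(* which every point x has a preferred chart [chart_at x].  The fibre at x of *)
(* a tensor bundle is the space of components in that preferred chart, and    *)
(* [jac] passes to the other charts of the atlas.                             *)
Record oriented_atlas := OrientedAtlas {
  chart_at : M -> chart;
  chart_at_dom : forall x, dom (chart_at x) x;
  transition_smooth : forall p q,
    smooth_on (coord (chart_at p) @` (dom (chart_at p) `&` dom (chart_at q)))
      (coord (chart_at q) \o param (chart_at p));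
  transition_oriented : forall p q x,
    dom (chart_at p) x -> dom (chart_at q) x ->
    0 < \det (jac (chart_at p) (chart_at q) (coord (chart_at p) x)) }.

Definition chart_image (c : chart) : set 'rV[R]_4 := coord c @` dom c.

End Manifold.

Section PointwiseAlgebra.
Context {R : realType}.

Definition levi_civita (n : nat) (s : n.-tuple 'I_n) : R :=
  \det (\matrix_(i, j) (tnth s i == j)%:R).

Definition epsilon3 (i j k : 'I_3) : R := levi_civita [tuple i; j; k].
Definition epsilon4 (i j k l : 'I_4) : R := levi_civita [tuple i; j; k; l].

Context (g : 'M[R]_4).

Definition norm2_cov (xi : 'rV[R]_4) : R := (xi *m invmx g *m xi^T) 0 0.

(* [1/2] accounts for the sum over ordered instead of increasing pairs. *)
Definition ip2 (w v : 'M[R]_4) : R :=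
  2^-1 * \sum_i \sum_j \sum_k \sum_l invmx g i k * invmx g j l * w i j * v k l.

(* Hodge star on 2-forms with values in a vector space, the coordinates being *)
(* positively oriented.                                                       *)
Definition hodge2 {W : lmodType R} (T : 'I_4 -> 'I_4 -> W) (i j : 'I_4) : W :=
  (2^-1 * Num.sqrt (\det g)) *: \sum_k \sum_l \sum_p \sum_q
    (epsilon4 i j k l * invmx g k p * invmx g l q) *: T p q.

Definition selfdual_part {W : lmodType R} (T : 'I_4 -> 'I_4 -> W)
    (i j : 'I_4) : W :=
  2^-1 *: (T i j + hodge2 T i j).

Definition hodge_mx (w : 'M[R]_4) : 'M[R]_4 :=
  \matrix_(i, j) hodge2 (w : 'I_4 -> 'I_4 -> R^o) i j.

Definition LambdaPlus : {vspace 'M[R]_4} :=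
  (lker (linfun (fun w : 'M[R]_4 => w + w^T)%R) :&:
   lker (linfun (fun w : 'M[R]_4 => hodge_mx w - w)%R))%VS.

Definition End_plus : vectType R := 'End(subvs_of LambdaPlus).

(* The rows of th are the covectors theta_0, .., theta_3. *)
Definition oriented_orthonormal_coframe (th : 'M[R]_4) : Prop :=
  th *m invmx g *m th^T = 1%:M /\ 0 < \det th.

(* Some oriented orthonormal coframe; the notions built from it below do not  *)
(* depend on the choice.                                                      *)
Definition coframe : 'M[R]_4 := xget 0 [set th | oriented_orthonormal_coframe th].

Definition wedge_cov (al be : 'rV[R]_4) : 'M[R]_4 := al^T *m be - be^T *m al.

Definition Sigma (i : 'I_3) : 'M[R]_4 :=
  let th (a : 'I_4) := row a coframe in
  let sp (b : 'I_3) := th (lift ord0 b) in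
  let j := ordS i in let k := ordS j in
  - ((Num.sqrt 2)^-1 *: (wedge_cov (th ord0) (sp i) + wedge_cov (sp j) (sp k))).

Definition cross (v w : 'M[R]_4) : 'M[R]_4 :=
  \sum_i \sum_j \sum_k
    (ip2 v (Sigma i) * ip2 w (Sigma j) * epsilon3 i j k) *: Sigma k.

Definition inplus (w : 'M[R]_4) : subvs_of LambdaPlus := vsproj LambdaPlus w.

Definition ip_plus (v w : subvs_of LambdaPlus) : R := ip2 (vsval v) (vsval w).

Definition selfadjoint (f : End_plus) : Prop :=
  forall v w, ip_plus (f v) w = ip_plus v (f w).

Definition posdef (f : End_plus) : Prop :=
  forall v, v != 0 -> 0 < ip_plus (f v) v.

Definition trace_plus (f : End_plus) : R :=
  \sum_i ip_plus (f (inplus (Sigma i))) (inplus (Sigma i)).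

(* B_h = sum_m h(Sigma_m) (x) Sigma_m *)
Definition Btensor (h : End_plus) (i j : 'I_4) : 'M[R]_4 :=
  \sum_m (vsval (h (inplus (Sigma m))) i j) *: Sigma m.

(* The endomorphism sum_ij T_ji <Sigma_i, -> Sigma_j of a self-dual T =       *)
(* sum_ij T_ji Sigma_j (x) Sigma_i: the coefficient factor is contracted with *)
(* the argument.                                                              *)
Definition endo_of (T : 'I_4 -> 'I_4 -> 'M[R]_4) : End_plus :=
  linfun (fun v : subvs_of LambdaPlus =>
    inplus (\matrix_(i, j) ip2 (T i j) (vsval v))).

Definition bracket12 (a : 'I_4 -> 'M[R]_4) (T : 'I_4 -> 'I_4 -> 'M[R]_4)
    (i j k : 'I_4) : 'M[R]_4 :=
  cross (a i) (T j k) + cross (a j) (T k i) + cross (a k) (T i j).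

(* ad_h^-1, as a function of B = B_h: ad_h(a) = [a, B_h]. *)
Definition ad_inv (B : 'I_4 -> 'I_4 -> 'M[R]_4)
    (b : 'I_4 -> 'I_4 -> 'I_4 -> 'M[R]_4) : 'I_4 -> 'M[R]_4 :=
  xget (fun=> 0)
    [set a | (forall i, a i \in LambdaPlus) /\
             (forall i j k, bracket12 a B i j k = b i j k)].

Definition cov_wedge1 (xi : 'rV[R]_4) (a : 'I_4 -> 'M[R]_4) (i j : 'I_4) :
    'M[R]_4 :=
  xi 0 i *: a j - xi 0 j *: a i.

Definition cov_wedge2 (xi : 'rV[R]_4) (T : 'I_4 -> 'I_4 -> 'M[R]_4)
    (i j k : 'I_4) : 'M[R]_4 :=
  xi 0 i *: T j k + xi 0 j *: T k i + xi 0 k *: T i j.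

Definition endo_id : End_plus := \1%VF.
Definition endo_comp (f f' : End_plus) : End_plus := (f \o f')%VF.
Definition endo_inv (f : End_plus) : End_plus := (f^-1)%VF.

Definition symbol_formula (h : End_plus) (xi : 'rV[R]_4) (eta : End_plus) :
    End_plus :=
  endo_comp
    (endo_of (selfdual_part
       (cov_wedge1 xi (ad_inv (Btensor h) (cov_wedge2 xi (Btensor eta))))))
    (endo_inv h).

End PointwiseAlgebra.

(* Connections on Lambda^+ over a chart, given by their covariant derivatives *)
(* nabla i in the coordinate directions.                                      *)
Section LocalConnections.
Context {R : realType}.

Definition connection := 'I_4 -> ('rV[R]_4 -> 'M[R]_4) -> 'rV[R]_4 -> 'M[R]_4.

Definition dcov0 (nabla : connection) (s : 'rV[R]_4 -> 'M[R]_4)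
    (y : 'rV[R]_4) (i : 'I_4) : 'M[R]_4 :=
  nabla i s y.

Definition dcov1 (nabla : connection) (a : 'rV[R]_4 -> 'I_4 -> 'M[R]_4)
    (y : 'rV[R]_4) (i j : 'I_4) : 'M[R]_4 :=
  nabla i (fun z => a z j) y - nabla j (fun z => a z i) y.

Definition dcov2 (nabla : connection)
    (T : 'rV[R]_4 -> 'I_4 -> 'I_4 -> 'M[R]_4)
    (y : 'rV[R]_4) (i j k : 'I_4) : 'M[R]_4 :=
  nabla i (fun z => T z j k) y + nabla j (fun z => T z k i) y
  + nabla k (fun z => T z i j) y.

(* V is the open set of coordinates, G the metric in these coordinates. *)
Context (V : set 'rV[R]_4) (G : 'rV[R]_4 -> 'M[R]_4).

Definition christoffel (y : 'rV[R]_4) (i k m : 'I_4) : R :=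
  2^-1 * \sum_l invmx (G y) m l *
    (pd i G y k l + pd k G y i l - pd l G y i k).

Definition levi_civita_connection : connection := fun i s y =>
  let C := \matrix_(k, m) christoffel y i k m in
  pd i s y - C *m s y - s y *m C^T.

Definition shift_connection (nabla : connection)
    (a : 'rV[R]_4 -> 'I_4 -> 'M[R]_4) : connection := fun i s y =>
  nabla i s y + cross (G y) (a y i) (s y).

Definition local_section (s : 'rV[R]_4 -> 'M[R]_4) : Prop :=
  smooth_on V s /\ forall y, V y -> s y \in LambdaPlus (G y).

(* F_A is determined by d_A (d_A s) = [F_A, s] for all sections s. *)
Definition curvature (nabla : connection) (y : 'rV[R]_4) :
    'I_4 -> 'I_4 -> 'M[R]_4 :=
  xget (fun _ _ => 0)
    [set F | (forall i j, F i j \in LambdaPlus (G y)) /\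
             (forall s, local_section s -> forall i j,
                dcov1 nabla (dcov0 nabla s) y i j = cross (G y) (F i j) (s y))].

End LocalConnections.

Section Riemannian.
Context {R : realType} {M : topologicalType} (X : oriented_atlas R M).

Definition jac_at (c : chart R M) (y : 'rV[R]_4) : 'M[R]_4 :=
  jac c (chart_at X (param c y)) y.

Definition in_chart2 (c : chart R M) (w : M -> 'M[R]_4) (y : 'rV[R]_4) :
    'M[R]_4 :=
  jac_at c y *m w (param c y) *m (jac_at c y)^T.

Definition riemannian (g : M -> 'M[R]_4) : Prop :=
  [/\ forall x, (g x)^T = g x,
      forall x (v : 'rV[R]_4), v != 0 -> 0 < (v *m g x *m v^T) 0 0 &
      forall p, smooth_on (chart_image (chart_at X p))
                  (in_chart2 (chart_at X p) g)].

Context (g : M -> 'M[R]_4).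

Definition endo_field := forall x : M, End_plus (g x).

(* The 2-form indices and the coefficient indices both transform. *)
Definition Bchart (c : chart R M) (h : endo_field) (y : 'rV[R]_4)
    (i j : 'I_4) : 'M[R]_4 :=
  let J := jac_at c y in
  \sum_p \sum_q (J i p * J j q) *:
    (J *m Btensor (h (param c y)) p q *m J^T).

(* h is smooth when the tensor B_h, which is h with one index lowered, is. *)
Definition sym_section (h : endo_field) : Prop :=
  (forall p i j, smooth_on (chart_image (chart_at X p))
                   (fun y => Bchart (chart_at X p) h y i j)) /\
  (forall x, selfadjoint (h x)).

Definition pos_sym_section (h : endo_field) : Prop :=
  sym_section h /\ forall x, posdef (h x).

Definition id_field : endo_field := fun x => endo_id (g x).

(* A(h) in the chart c. *)
Definition A_of (c : chart R M) (h : endo_field) : connection :=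
  let G := in_chart2 c g in
  let Gam := levi_civita_connection G in
  shift_connection G Gam (fun y i =>
    - ad_inv (G y) (Bchart c h y) (dcov2 Gam (Bchart c h) y) i).

Definition Phi (h : endo_field) : endo_field := fun x =>
  let c := chart_at X x in
  let F := curvature (chart_image c) (in_chart2 c g) (A_of c h) (coord c x) in
  endo_comp (endo_of (g x) (selfdual_part (g x) F)) (endo_inv (h x))
  - endo_id (g x).

Definition is_linearization_at (h eta : endo_field) (x : M)
    (L : End_plus (g x)) : Prop :=
  forall v, is_derive (0 : R) (1 : R)
    (fun t : R => vsval (Phi (fun z => h z + t *: eta z) x v)) (vsval (L v)).

Definition DPhi (h eta : endo_field) : endo_field := fun x =>
  xget 0 [set L | is_linearization_at h eta L].

(* [coeff4 a t] applies the linear map of coefficients a to the array t. *)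
Definition coeff4 {W : lmodType R} (a : 'I_4 -> 'I_4 -> 'I_4 -> 'I_4 -> W)
    (t : 'I_4 -> 'I_4 -> 'M[R]_4) : W :=
  \sum_p \sum_q \sum_r \sum_s t p q r s *: a p q r s.

(* In the chart at x, P is at x a second order linear operator               *)
(*   P eta = sum_jk a_jk (d_j d_k eta) + sum_j b_j (d_j eta) + c (eta),       *)
(* the section eta being given by its components, i.e. those of B_eta, and    *)
(* sigma is obtained from the top-order part by replacing d_j by sqrt(-1)xi_j *)
(* whence the sign, as (sqrt(-1) xi_j) (sqrt(-1) xi_k) = - xi_j xi_k.         *)
Definition has_principal_symbol (P : endo_field -> endo_field) (x : M)
    (xi : 'rV[R]_4) (sigma : End_plus (g x) -> End_plus (g x)) : Prop :=
  let c := chart_at X x in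
  let y := coord c x in
  exists (a : 'I_4 -> 'I_4 -> 'I_4 -> 'I_4 -> 'I_4 -> 'I_4 -> End_plus (g x))
         (b : 'I_4 -> 'I_4 -> 'I_4 -> 'I_4 -> 'I_4 -> End_plus (g x))
         (e : 'I_4 -> 'I_4 -> 'I_4 -> 'I_4 -> End_plus (g x)),
    (forall eta, sym_section eta ->
       P eta x =
         \sum_j \sum_k coeff4 (a j k)
           (fun p q => pd j (pd k (fun z => Bchart c eta z p q)) y)
         + \sum_j coeff4 (b j) (fun p q => pd j (fun z => Bchart c eta z p q) y)
         + coeff4 e (Bchart c eta y)) /\
    (forall eta, selfadjoint eta ->
       sigma eta =
         \sum_j \sum_k (- (xi 0 j * xi 0 k)) *: coeff4 (a j k) (Btensor eta)).

End Riemannian.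

Arguments is_linearization_at {R M} X {g} h eta x L.
Arguments has_principal_symbol {R M} X {g} P x xi sigma.

(* Main.v *)
From HB Require Import structures.
Require Import Defs.
From mathcomp Require Import all_boot all_order all_algebra.
From mathcomp Require Import all_classical all_reals all_analysis.
From mathcomp Require Import fingroup perm ring lra.
Set Implicit Arguments.
Unset Strict Implicit.
Unset Printing Implicit Defensive.
Import Order.TTheory GRing.Theory Num.Theory.
Import numFieldNormedType.Exports.
Local Open Scope classical_set_scope.
Local Open Scope ring_scope.

(** The symbol is computed in an orthonormal frame, from an explicit formula
    for the inverse of ad_h; the analysis serves to show that only this inverse
    contributes second derivatives.

    Algebra.  Fix an oriented orthonormal coframe th of g at a point.  The forms
    [SigF th m] are an orthonormal frame of Lambda^+, so an endomorphism h of
    Lambda^+ becomes a 3 x 3 matrix H; and sections of T^*M (x) Lambda^+, as well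
    as of Lambda^3 (x) Lambda^+ after contraction with the volume form, become
    triples of vectors of R^4.  In the standard coframe the [Sig0 m] multiply
    like imaginary quaternions ([Sig0_mul]), and ad_h becomes the operator
    [ad_mx H] on triples.  For H = 1 its square is 1 minus a multiple of itself
    ([ad_mx1_sqr]), so that its inverse is affine in it; and since the
    permutation symbol is invariant under H up to the factor det H, the general
    case reduces to this one ([ad_mx_coef_mul], [ad_mxK]).  The symbol of the
    theorem is then, for self-adjoint eta of matrix N,
      |xi|^2 / (2 sqrt 2 det H) (tr (N H) 1 - H N - N H)
    ([symbol_mat], [symbol_lyap]), which is visibly linear and self-adjoint, and
    for H = 1 is the announced multiple of eta_1 - 2 eta_0.  It is injective: if
    it vanishes, its trace gives tr (N H) = 0, hence H N = - N H, and the traces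
    of N H N^T and of N^T H N, which are nonnegative, are opposite, so that
    N = 0 ([lyap_inj]).

    Analysis.  Over the preferred chart of a point, the Gram-Schmidt process
    gives a smooth coframe ([smooth_cholesky]).  In it the Levi-Civita connection
    and A(h) have components [conn_vec] and [conn_A]; the curvature, which is
    characterized by its action on sections, is given by the usual formula
    because mixed partial derivatives agree ([curvature_frame], [schwarz]).
    This expresses Phi (h) through the 2-jet of H ([Phi_mat]).  Differentiating
    along h + t eta, where the derivative of ad_h^-1 (c) is found by
    differentiating the equation ad_h (a) = c ([is_derive_ad_mx_inv]), gives the
    linearization [var_Phi].  Every term in it is of order at most one in eta,
    except the derivatives of ad_h^-1 (d_Gamma B_eta), whose second order part is
    read off by the product rule ([order0], [order1], [order2]); replacing
    derivatives by covectors gives the stated formula. *)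

(** * Indices and permutation symbols *)

Section Finite_indices.
Context {V : Type} {idx : V} (op : Monoid.law idx).

Lemma big3 (F : 'I_3 -> V) :
  \big[op/idx]_i F i = op (F (inord 0)) (op (F (inord 1)) (F (inord 2))).
Proof.
rewrite !big_ord_recl big_ord0 Monoid.mulm1.
by congr (op (F _) (op (F _) (F _))); apply: val_inj; rewrite /= inordK.
Qed.

Lemma big4 (F : 'I_4 -> V) :
  \big[op/idx]_i F i
  = op (F (inord 0)) (op (F (inord 1)) (op (F (inord 2)) (F (inord 3)))).
Proof.
rewrite !big_ord_recl big_ord0 Monoid.mulm1.
by congr (op (F _) (op (F _) (op (F _) (F _)))); apply: val_inj; rewrite /= inordK.
Qed.

End Finite_indices.

Lemma ord3P (P : 'I_3 -> Prop) :
  P (inord 0) -> P (inord 1) -> P (inord 2) -> forall i, P i.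
Proof.
move=> P0 P1 P2 [[|[|[|//]]] hi].
- by have <- : inord 0 = Ordinal hi by apply: val_inj; rewrite /= inordK.
- by have <- : inord 1 = Ordinal hi by apply: val_inj; rewrite /= inordK.
- by have <- : inord 2 = Ordinal hi by apply: val_inj; rewrite /= inordK.
Qed.

Lemma ord4P (P : 'I_4 -> Prop) :
  P (inord 0) -> P (inord 1) -> P (inord 2) -> P (inord 3) -> forall i, P i.
Proof.
move=> P0 P1 P2 P3 [[|[|[|[|//]]]] hi].
- by have <- : inord 0 = Ordinal hi by apply: val_inj; rewrite /= inordK.
- by have <- : inord 1 = Ordinal hi by apply: val_inj; rewrite /= inordK.
- by have <- : inord 2 = Ordinal hi by apply: val_inj; rewrite /= inordK.
- by have <- : inord 3 = Ordinal hi by apply: val_inj; rewrite /= inordK.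
Qed.

Lemma inord_eq3 (a b : nat) : (a < 3)%N -> (b < 3)%N ->
  (inord a == inord b :> 'I_3) = (a == b).
Proof. by move=> ha hb; rewrite -val_eqE /= !inordK. Qed.

Lemma inord_eq4 (a b : nat) : (a < 4)%N -> (b < 4)%N ->
  (inord a == inord b :> 'I_4) = (a == b).
Proof. by move=> ha hb; rewrite -val_eqE /= !inordK. Qed.

Section Epsilon.
Context {R : realType}.

(** Values of [epsilon3], to decide identities by enumeration of indices. *)
Definition eps3 (i j k : nat) : R :=
  match i, j, k with
  | 0%N, 1%N, 2%N | 1%N, 2%N, 0%N | 2%N, 0%N, 1%N => 1
  | 0%N, 2%N, 1%N | 1%N, 0%N, 2%N | 2%N, 1%N, 0%N => -1
  | _, _, _ => 0
  end.

(** Evaluating the Vandermonde determinant at the entries of s permutes its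
    columns, which multiplies it by the sign of s; this computes the symbol
    without a sum over permutations. *)
Lemma epsilon_vandermonde n (s : n.-tuple 'I_n) :
  levi_civita s * (\prod_(i < n) \prod_(j < n | (i < j)%N) (j%:R - i%:R))
  = \prod_(i < n) \prod_(j < n | (i < j)%N) ((tnth s j)%:R - (tnth s i)%:R) :> R.
Proof.
pose x : 'rV[R]_n := \row_j j%:R.
pose y : 'rV[R]_n := \row_j (tnth s j)%:R.
have h : Vandermonde n y = Vandermonde n x *m (\matrix_(i, j) (tnth s i == j)%:R)^T.
  apply/matrixP => i j; rewrite !mxE (bigD1 (tnth s j)) //= !mxE eqxx mulr1.
  rewrite big1 ?addr0// => k kj; rewrite !mxE eq_sym (negPf kj) mulr0 //.
have := det_Vandermonde y.
rewrite h det_mulmx det_tr det_Vandermonde mulrC.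
rewrite /levi_civita => e.
transitivity (levi_civita s * \prod_(i < n) \prod_(j < n | (i < j)%N) (x 0 j - x 0 i)).
  by congr (_ * _); apply: eq_bigr => i _; apply: eq_bigr => j _; rewrite !mxE.
rewrite /levi_civita e.
by apply: eq_bigr => i _; apply: eq_bigr => j _; rewrite !mxE.
Qed.

Lemma epsilon3_vand (i j k : 'I_3) :
  2 * epsilon3 i j k = (j%:R - i%:R) * (k%:R - i%:R) * (k%:R - j%:R) :> R.
Proof.
have := epsilon_vandermonde [tuple i; j; k].
rewrite -/(epsilon3 i j k).
under eq_bigr do rewrite big_mkcond.
under [in RHS]eq_bigr do rewrite big_mkcond.
rewrite !big3 !inordK //= !mul1r !mulr1 !(tnth_nth i) /= !inordK //= => h.
rewrite mulrC; move: h; rewrite (_ : (1%:R - 0%:R) * (2%:R - 0%:R) * (2%:R - 1%:R) = 2 :> R) //.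
by ring.
Qed.

Lemma epsilon3E (i j k : 'I_3) : epsilon3 i j k = eps3 i j k.
Proof.
apply: (@mulfI _ (2:R)) => //.
rewrite epsilon3_vand; move: i j k.
do 3! (elim/ord3P); rewrite !inordK //=; ring.
Qed.

(** 12 is the Vandermonde determinant of 0, 1, 2, 3. *)
Lemma epsilon4_vand (i j k l : 'I_4) :
  12 * epsilon4 i j k l
  = (j%:R - i%:R) * (k%:R - i%:R) * (l%:R - i%:R) * (k%:R - j%:R)
    * (l%:R - j%:R) * (l%:R - k%:R) :> R.
Proof.
have := epsilon_vandermonde [tuple i; j; k; l].
rewrite -/(epsilon4 i j k l).
under eq_bigr do rewrite big_mkcond.
under [in RHS]eq_bigr do rewrite big_mkcond.
rewrite !big4 !inordK //= !mul1r !mulr1 !(tnth_nth i) /= !inordK //= => h.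
transitivity (epsilon4 i j k l * ((1%:R - 0%:R) * ((2%:R - 0%:R) * (3%:R - 0%:R)) *
       ((2%:R - 1%:R) * (3%:R - 1%:R) * (3%:R - 2%:R))) : R); first by ring.
by rewrite h !mulrA.
Qed.

Lemma epsilon4E (i j k l : 'I_4) :
  epsilon4 i j k l
  = (j%:R - i%:R) * (k%:R - i%:R) * (l%:R - i%:R) * (k%:R - j%:R)
    * (l%:R - j%:R) * (l%:R - k%:R) / 12 :> R.
Proof. by rewrite -epsilon4_vand mulrC mulrA mulVf ?mul1r // pnatr_eq0. Qed.

End Epsilon.

(** * Self-dual forms in the standard coframe *)

Section Frame_forms.
Context {R : realType}.

Definition isqrt2 : R := (Num.sqrt 2)^-1.

Lemma isqrt2_sqr : isqrt2 * isqrt2 = 2^-1.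
Proof. by rewrite /isqrt2 -invfM -expr2 sqr_sqrtr. Qed.

Lemma isqrt2_gt0 : 0 < isqrt2.
Proof. by rewrite invr_gt0 sqrtr_gt0. Qed.

Lemma isqrt2_neq0 : isqrt2 != 0.
Proof. exact: lt0r_neq0 isqrt2_gt0. Qed.

(** [Sigma], for a coframe that is given instead of chosen. *)
Definition SigF (th : 'M[R]_4) (i : 'I_3) : 'M[R]_4 :=
  let sp (b : 'I_3) := row (lift ord0 b) th in
  let j := ordS i in let k := ordS j in
  - (isqrt2 *: (wedge_cov (row ord0 th) (sp i) + wedge_cov (sp j) (sp k))).

Definition Sig0 : 'I_3 -> 'M[R]_4 := locked (SigF 1%:M).

(** The definition is bilinear in the rows of th. *)
Lemma SigF_Sig0 (th : 'M[R]_4) i : SigF th i = th^T *m Sig0 i *m th.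
Proof.
have W (a b : 'I_4) : wedge_cov (row a th) (row b th)
    = th^T *m wedge_cov (row a 1%:M) (row b 1%:M) *m th.
  rewrite /wedge_cov !rowE !mulmx1 mulmxBr mulmxBl !trmx_mul !mulmxA.
  by rewrite -!mulmxA.
by rewrite /Sig0 -lock /SigF !W -mulmxDl -mulmxDr mulmxN mulNmx -scalemxAr -scalemxAl.
Qed.

Definition sd_sign (m i j : nat) : R :=
  match m, i, j with
  | 0%N, 0%N, 1%N | 0%N, 2%N, 3%N | 1%N, 0%N, 2%N
  | 1%N, 3%N, 1%N | 2%N, 0%N, 3%N | 2%N, 1%N, 2%N => 1
  | 0%N, 1%N, 0%N | 0%N, 3%N, 2%N | 1%N, 2%N, 0%N
  | 1%N, 1%N, 3%N | 2%N, 3%N, 0%N | 2%N, 2%N, 1%N => -1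
  | _, _, _ => 0
  end.

Lemma Sig0E m i j : Sig0 m i j = - (isqrt2 * sd_sign m i j).
Proof.
rewrite /Sig0 -lock /SigF /wedge_cov !mxE !big_ord1 !mxE -!val_eqE /= /bump /=.
congr (- (isqrt2 * _)).
move: m i j; elim/ord3P; do 2! elim/ord4P; rewrite !inordK //= ?modn_small //=; ring.
Qed.

Lemma Sig0_skew m : (Sig0 m)^T = - Sig0 m.
Proof.
apply/matrixP => i j; rewrite 2!mxE !Sig0E -mulrN -!mulrN; congr (isqrt2 * _).
move: m i j; elim/ord3P; do 2! elim/ord4P; rewrite !inordK //=; ring.
Qed.

(** Up to normalization, the relations of the imaginary quaternions. *)
Lemma Sig0_mul m n :
  Sig0 m *m Sig0 n = (- (2^-1 * (m == n)%:R))%:M + isqrt2 *: \sum_k epsilon3 m n k *: Sig0 k.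
Proof.
apply/matrixP => i j; rewrite !mxE summxE.
under eq_bigr do rewrite !Sig0E.
under [in RHS]eq_bigr do rewrite !mxE epsilon3E Sig0E.
rewrite !big4 !big3 -isqrt2_sqr.
transitivity (isqrt2 * isqrt2 * (\sum_(k < 4) sd_sign m i k * sd_sign n k j) : R).
  by rewrite big4 /=; ring.
transitivity (isqrt2 * isqrt2 * (- (m == n)%:R * (i == j)%:R - \sum_(k < 3) eps3 m n k * sd_sign k i j) : R); last first.
  by rewrite big3 /= -[_ *+ (i == j)]mulr_natr; ring.
congr (_ * _); rewrite big3 big4 /=.
move: m n i j; do 2! elim/ord3P; do 2! elim/ord4P;
  rewrite ?inord_eq3 ?inord_eq4 // !inordK //=; ring.
Qed.

(** The inner product of 2-forms, in an orthonormal coframe. *)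
Definition ip0 (w v : 'M[R]_4) : R := 2^-1 * \tr (w *m v^T).

Lemma ip0C w v : ip0 w v = ip0 v w.
Proof. by rewrite /ip0 -mxtrace_tr trmx_mul trmxK. Qed.

Lemma ip0_Sig m n : ip0 (Sig0 m) (Sig0 n) = (m == n)%:R.
Proof.
rewrite /ip0 Sig0_skew mulmxN Sig0_mul -[in X in X = _]scaleN1r mxtraceZ mxtraceD mxtrace_scalar.
rewrite mxtraceZ raddf_sum /= big1 => [|k _].
  by rewrite mulr0 addr0 -mulr_natr; field.
rewrite mxtraceZ [X in _ * X](_ : _ = 0) ?mulr0 //.
have : \tr (Sig0 k) = - \tr (Sig0 k) by rewrite -{1}mxtrace_tr Sig0_skew raddfN.
move/eqP; rewrite -subr_eq0 opprK -mulr2n mulrn_eq0 => /eqP //.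
Qed.

(** The Hodge star, in an oriented orthonormal coframe. *)
Definition hodge0 (w : 'M[R]_4) : 'M[R]_4 :=
  \matrix_(i, j) (2^-1 * \sum_k \sum_l epsilon4 i j k l * w k l).

Lemma ip0_Sig0E w m :
  ip0 w (Sig0 m) = - (2^-1 * isqrt2 * \sum_(i < 4) \sum_(j < 4) w i j * sd_sign m i j).
Proof.
rewrite /ip0 /mxtrace -mulrA -mulrN; congr (_ * _); rewrite -mulrN -sumrN mulr_sumr.
apply: eq_bigr => a _; rewrite !mxE -sumrN mulr_sumr; apply: eq_bigr => b _.
by rewrite mxE Sig0E; ring.
Qed.

Definition asd_sign (m i j : nat) : R :=
  match m, i, j with
  | 0%N, 0%N, 1%N | 0%N, 3%N, 2%N | 1%N, 0%N, 2%N
  | 1%N, 1%N, 3%N | 2%N, 0%N, 3%N | 2%N, 2%N, 1%N => 1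
  | 0%N, 1%N, 0%N | 0%N, 2%N, 3%N | 1%N, 2%N, 0%N
  | 1%N, 3%N, 1%N | 2%N, 3%N, 0%N | 2%N, 1%N, 2%N => -1
  | _, _, _ => 0
  end.

(** The anti-self-dual counterpart of [Sig0 m]. *)
Definition Tau0 (m : 'I_3) : 'M[R]_4 := \matrix_(i, j) (- (isqrt2 * asd_sign m i j)).

(** The two factors of so(4) = so(3) + so(3) commute. *)
Lemma Sig0_Tau0 m n : Sig0 m *m Tau0 n = Tau0 n *m Sig0 m.
Proof.
apply/matrixP => i j; rewrite !mxE.
under eq_bigr do rewrite Sig0E mxE.
under [in RHS]eq_bigr do rewrite Sig0E mxE.
transitivity (isqrt2 * isqrt2 * (\sum_(k < 4) sd_sign m i k * asd_sign n k j)).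
  by rewrite mulr_sumr; apply: eq_bigr => k _; ring.
transitivity (isqrt2 * isqrt2 * (\sum_(k < 4) asd_sign n i k * sd_sign m k j)); last first.
  by rewrite mulr_sumr; apply: eq_bigr => k _; ring.
congr (_ * _); rewrite !big4 /=.
move: m n i j; do 2! elim/ord3P; do 2! elim/ord4P; rewrite !inordK //=; ring.
Qed.

Lemma skew_decomposition (w : 'M[R]_4) : w^T = - w ->
  exists q : 'I_3 -> R, w = \sum_m ip0 w (Sig0 m) *: Sig0 m + \sum_m q m *: Tau0 m.
Proof.
move=> wT; have sk i j : w i j = - w j i.
  by move/matrixP: wT => /(_ j i); rewrite !mxE.
have d : forall a, w a a = 0.
  by move=> a; apply/eqP; have /eqP := sk a a; rewrite -addr_eq0 -mulr2n mulrn_eq0.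
exists (fun m => - (2^-1 * isqrt2 * \sum_(i < 4) \sum_(j < 4) w i j * asd_sign m i j)).
apply/matrixP => i j; rewrite mxE !summxE.
under eq_bigr do rewrite mxE ip0_Sig0E Sig0E.
under [X in _ + X]eq_bigr do rewrite 2!mxE.
transitivity (2^-1 * (isqrt2 * isqrt2 * (\sum_(m < 3) ((\sum_(a < 4) \sum_(b < 4) w a b * sd_sign m a b) * sd_sign m i j
   + (\sum_(a < 4) \sum_(b < 4) w a b * asd_sign m a b) * asd_sign m i j)))); last first.
  by rewrite -big_split !mulr_sumr; apply: eq_bigr => m _ /=; ring.
rewrite isqrt2_sqr !big3 !big4 !d.
rewrite (sk (inord 1) (inord 0)) (sk (inord 2) (inord 0)) (sk (inord 3) (inord 0)).
rewrite (sk (inord 2) (inord 1)) (sk (inord 3) (inord 1)) (sk (inord 3) (inord 2)).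
move: i j; do 2! elim/ord4P; rewrite ?d !inordK //=;
rewrite ?(sk (inord 1) (inord 0)) ?(sk (inord 2) (inord 0)) ?(sk (inord 3) (inord 0));
rewrite ?(sk (inord 2) (inord 1)) ?(sk (inord 3) (inord 1)) ?(sk (inord 3) (inord 2)); by field.
Qed.

Lemma selfdual0E (w : 'M[R]_4) : w^T = - w ->
  2^-1 *: (w + hodge0 w) = \sum_m ip0 w (Sig0 m) *: Sig0 m.
Proof.
move=> wT; have sk i j : w i j = - w j i.
  by move/matrixP: wT => /(_ j i); rewrite !mxE.
apply/matrixP => i j; rewrite !mxE summxE.
under [in RHS]eq_bigr do rewrite !mxE Sig0E.
under [in LHS]eq_bigr do under eq_bigr do rewrite epsilon4E.
under [in RHS]eq_bigr do rewrite ip0_Sig0E.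
transitivity (2^-1 * (isqrt2 * isqrt2 * \sum_(m < 3) (\sum_(a < 4) \sum_(b < 4) w a b * sd_sign m a b) * sd_sign m i j)); last first.
  by rewrite !mulr_sumr; apply: eq_bigr => m _; ring.
rewrite isqrt2_sqr; congr (_ * _).
have d : forall a, w a a = 0.
  by move=> a; apply/eqP; have /eqP := sk a a; rewrite -addr_eq0 -mulr2n mulrn_eq0.
rewrite big3 !big4 !d.
rewrite (sk (inord 1) (inord 0)) (sk (inord 2) (inord 0)) (sk (inord 3) (inord 0)).
rewrite (sk (inord 2) (inord 1)) (sk (inord 3) (inord 1)) (sk (inord 3) (inord 2)).
move: i j; do 2! elim/ord4P; rewrite ?d !inordK //=;
rewrite ?(sk (inord 1) (inord 0)) ?(sk (inord 2) (inord 0)) ?(sk (inord 3) (inord 0));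
rewrite ?(sk (inord 2) (inord 1)) ?(sk (inord 3) (inord 1)) ?(sk (inord 3) (inord 2)); by field.
Qed.
End Frame_forms.

(** * Two-forms in an orthonormal coframe *)

Section Epsilon_det.
Context {R : realType}.

(** The Leibniz formula, summed over all quadruples of indices: the symbol
    is itself a determinant, and only permutations contribute. *)
Lemma det4_epsilon (A : 'M[R]_4) :
  \sum_i \sum_j \sum_k \sum_l epsilon4 i j k l
     * (A (inord 0) i * A (inord 1) j * A (inord 2) k * A (inord 3) l)
  = \det A.
Proof.
pose c (s : 'S_4) (a b : 'I_4) : R := A a b * (b == s a)%:R.
have h i j k l : epsilon4 i j k l
     * (A (inord 0) i * A (inord 1) j * A (inord 2) k * A (inord 3) l)
    = \sum_(s : 'S_4) (-1) ^+ s * (c s (inord 0) i * (c s (inord 1) j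
        * (c s (inord 2) k * c s (inord 3) l))) :> R.
  rewrite /epsilon4 /levi_civita /determinant mulr_suml; apply: eq_bigr => s _.
  rewrite big4 !mxE !(tnth_nth i) /= !inordK //= /c.
  by move: ((-1) ^+ s : R) => e; ring.
under eq_bigr do under eq_bigr do under eq_bigr do under eq_bigr do rewrite h.
under eq_bigr do under eq_bigr do under eq_bigr do rewrite exchange_big.
under eq_bigr do under eq_bigr do rewrite exchange_big.
under eq_bigr do rewrite exchange_big.
rewrite exchange_big /=; apply: eq_bigr => s _.
have cE a : \sum_b c s a b = A a (s a).
  rewrite (bigD1 (s a)) //= /c eqxx mulr1 big1 ?addr0// => b /negPf ->.
  by rewrite mulr0.
under eq_bigr do under eq_bigr do under eq_bigr do rewrite -mulr_sumr -!mulr_sumr cE.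
under eq_bigr do under eq_bigr do rewrite -mulr_sumr -!mulr_sumr -mulr_suml cE.
under eq_bigr do rewrite -mulr_sumr -!mulr_sumr -mulr_suml cE.
by rewrite -mulr_sumr -mulr_suml cE big4.
Qed.

Lemma epsilon4_mx (Y : 'M[R]_4) (a b c d : 'I_4) :
  \sum_i \sum_j \sum_k \sum_l epsilon4 i j k l * (Y a i * Y b j * Y c k * Y d l)
  = \det Y * epsilon4 a b c d.
Proof.
pose s := [tuple a; b; c; d].
rewrite /(epsilon4 a b c d) /levi_civita mulrC -det_mulmx -det4_epsilon.
have e (t i : 'I_4) : (\matrix_(i, j) (tnth s i == j)%:R *m Y) t i = Y (tnth s t) i.
  rewrite !mxE (bigD1 (tnth s t)) //= !mxE eqxx mul1r big1 ?addr0// => k.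
  by rewrite eq_sym => /negPf kt; rewrite mxE kt mul0r.
do 4! (apply: eq_bigr => ? _).
by rewrite !e !(tnth_nth a) /= !inordK.
Qed.

End Epsilon_det.

Lemma sum_exchange4 (V : nmodType) n (F : 'I_n -> 'I_n -> 'I_n -> 'I_n -> 'I_n -> V) :
  \sum_c \sum_i \sum_j \sum_k \sum_l F c i j k l
  = \sum_i \sum_j \sum_k \sum_l \sum_c F c i j k l.
Proof.
by do 4! (rewrite exchange_big; apply: eq_bigr => ? _).
Qed.

(** Invariance of the volume form up to the determinant; it makes the Hodge
    star independent of the oriented orthonormal coframe. *)
Lemma hodge0_congr (R : realType) (X W : 'M[R]_4) :
  X *m hodge0 (X^T *m W *m X) *m X^T = \det X *: hodge0 W.
Proof.
apply/matrixP => a b.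
transitivity (2^-1 * \sum_c \sum_d
   (\sum_i \sum_j \sum_k \sum_l epsilon4 i j k l * (X a i * X b j * X c k * X d l)) * W c d);
  last first.
  rewrite !mxE mulrCA; congr (_ * _); rewrite mulr_sumr; apply: eq_bigr => c _.
  by rewrite mulr_sumr; apply: eq_bigr => d _; rewrite epsilon4_mx mulrA.
transitivity (2^-1 * \sum_c \sum_d \sum_i \sum_j \sum_k \sum_l
    epsilon4 i j k l * (X a i * X b j * X c k * X d l) * W c d); last first.
  congr (_ * _); apply: eq_bigr => c _; apply: eq_bigr => d _.
  by do 4! (rewrite mulr_suml; apply: eq_bigr => ? _).
under eq_bigr do rewrite sum_exchange4.
rewrite sum_exchange4 mxE exchange_big /=.
rewrite mulr_sumr; apply: eq_bigr => j _.
rewrite mxE mulr_suml mulr_sumr; apply: eq_bigr => i _.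
rewrite [X^T j b]mxE [hodge0 _ i j]mxE; set T := \sum_k _; set T' := \sum_k _.
have -> : T' = X a i * X b j * T; last by ring.
rewrite /T mulr_sumr; apply: eq_bigr => k _.
rewrite mulr_sumr; apply: eq_bigr => l _.
have -> : (X^T *m W *m X) k l = \sum_c \sum_d X c k * W c d * X d l.
  rewrite mxE exchange_big; apply: eq_bigr => d _.
  by rewrite mxE mulr_suml; apply: eq_bigr => c _; rewrite [X^T k c]mxE.
rewrite !mulr_sumr; apply: eq_bigr => c _.
by rewrite !mulr_sumr; apply: eq_bigr => d _; ring.
Qed.

Section Frame.
Context {R : realType} (g th : 'M[R]_4).
Hypotheses (gE : g = th^T *m th) (dth : 0 < \det th).

Lemma frame_unit : th \in unitmx.
Proof. by rewrite unitmxE unitfE lt0r_neq0. Qed.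
Let thu := frame_unit.

Lemma frame_invg : invmx g = invmx th *m (invmx th)^T.
Proof.
have gu : g \in unitmx by rewrite gE unitmx_mul unitmx_tr thu.
apply: (can_inj (mulKmx gu)); rewrite mulmxV // {1}gE -mulmxA (mulmxA th) mulmxV //.
by rewrite mul1mx -trmx_mul mulVmx // trmx1.
Qed.

Lemma frame_orth : th *m invmx g *m th^T = 1%:M.
Proof.
by rewrite frame_invg !mulmxA mulmxV // mul1mx -trmx_mul mulmxV // trmx1.
Qed.

Lemma invg_sym : (invmx g)^T = invmx g.
Proof. by rewrite frame_invg trmx_mul trmxK. Qed.

Lemma ip2E (w v : 'M[R]_4) :
  ip2 g w v = 2^-1 * \tr (w *m invmx g *m v^T *m (invmx g)^T).
Proof.
rewrite /ip2; congr (_ * _).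
rewrite /mxtrace; apply: eq_bigr => i _.
rewrite mxE exchange_big /=; apply: eq_bigr => k _.
rewrite !mxE mulr_suml exchange_big /=; apply: eq_bigr => l _.
rewrite !mxE !mulr_suml; apply: eq_bigr => j _; rewrite ?mxE; ring.
Qed.

(** The 2-form with components W in the coframe th. *)
Definition form_of (W : 'M[R]_4) : 'M[R]_4 := th^T *m W *m th.
Definition comps_of (w : 'M[R]_4) : 'M[R]_4 := (invmx th)^T *m w *m invmx th.

Lemma form_ofK W : comps_of (form_of W) = W.
Proof.
rewrite /form_of /comps_of !mulmxA -trmx_mul mulmxV // trmx1 mul1mx -mulmxA mulmxV //.
by rewrite mulmx1.
Qed.

Lemma comps_ofK W : form_of (comps_of W) = W.
Proof.
rewrite /form_of /comps_of !mulmxA -trmx_mul mulVmx // trmx1 mul1mx -mulmxA mulVmx //.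
by rewrite mulmx1.
Qed.

Lemma form_of_tr W : (form_of W)^T = form_of W^T.
Proof. by rewrite /form_of !trmx_mul trmxK mulmxA. Qed.

Lemma comps_of_tr W : (comps_of W)^T = comps_of W^T.
Proof. by rewrite /comps_of !trmx_mul trmxK mulmxA. Qed.

Lemma form_of_is_linear : linear form_of.
Proof.
by move=> a u v; rewrite /form_of mulmxDr mulmxDl -scalemxAr -scalemxAl.
Qed.
HB.instance Definition _ :=
  GRing.isLinear.Build R 'M[R]_4 'M[R]_4 *:%R form_of form_of_is_linear.

Lemma comps_of_is_linear : linear comps_of.
Proof.
by move=> a u v; rewrite /comps_of mulmxDr mulmxDl -scalemxAr -scalemxAl.
Qed.
HB.instance Definition _ :=
  GRing.isLinear.Build R 'M[R]_4 'M[R]_4 *:%R comps_of comps_of_is_linear.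

Lemma form_of_mul U W : form_of U *m invmx g *m form_of W = form_of (U *m W).
Proof.
rewrite /form_of -!mulmxA; congr (_ *m (_ *m _)); rewrite !mulmxA.
by rewrite frame_orth mul1mx.
Qed.

Lemma ip2_form_of U W : ip2 g (form_of U) (form_of W) = ip0 U W.
Proof.
rewrite ip2E invg_sym form_of_tr form_of_mul /form_of -!mulmxA mxtrace_mulC -!mulmxA.
by rewrite (mulmxA th) frame_orth mulmx1.
Qed.

Lemma ip2_comps_of u w : ip2 g u w = ip0 (comps_of u) (comps_of w).
Proof. by rewrite -ip2_form_of !comps_ofK. Qed.

Lemma sqrt_det : Num.sqrt (\det g) = \det th.
Proof. by rewrite gE det_mulmx det_tr -expr2 sqrtr_sqr gtr0_norm. Qed.

Lemma hodge_form_of W : hodge_mx g (form_of W) = form_of (hodge0 W).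
Proof.
have gf : invmx g *m th^T = invmx th.
  by rewrite frame_invg -mulmxA -trmx_mul mulmxV // trmx1 mulmx1.
have fg : th *m invmx g = (invmx th)^T by rewrite -gf trmx_mul trmxK invg_sym.
have A i j : hodge_mx g (form_of W) i j = 2^-1 * \det th * \sum_k \sum_l
    epsilon4 i j k l * (invmx th *m W *m (invmx th)^T) k l.
  rewrite mxE /hodge2 sqrt_det; congr (_ * _).
  apply: eq_bigr => k _; apply: eq_bigr => l _.
  have -> : invmx th *m W *m (invmx th)^T = invmx g *m form_of W *m (invmx g)^T.
    by rewrite invg_sym /form_of !mulmxA gf -!mulmxA fg.
  rewrite mxE mulr_sumr exchange_big /=; apply: eq_bigr => q _.
  rewrite !mxE mulr_suml mulr_sumr; apply: eq_bigr => p _.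
  by rewrite mxE /GRing.scale /=; ring.
apply: (can_inj comps_ofK); rewrite form_ofK; pose X := (invmx th)^T.
have XK : X^T = invmx th by rewrite trmxK.
have -> : hodge_mx g (form_of W) = \det th *: hodge0 (X^T *m W *m X).
  by apply/matrixP => i j; rewrite A !mxE XK; ring.
rewrite /comps_of -/X -XK -scalemxAr -scalemxAl hodge0_congr scalerA det_tr det_inv.
by rewrite divff ?scale1r // lt0r_neq0.
Qed.

Lemma SigF_form_of m : SigF th m = form_of (Sig0 m).
Proof. exact: SigF_Sig0. Qed.

Lemma ip2_SigF m n : ip2 g (SigF th m) (SigF th n) = (m == n)%:R.
Proof. by rewrite !SigF_form_of ip2_form_of ip0_Sig. Qed.

Definition comb (s : 'I_3 -> R) : 'M[R]_4 := \sum_m s m *: SigF th m.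

Lemma comb_form_of s : comb s = form_of (\sum_m s m *: Sig0 m).
Proof. by rewrite raddf_sum; apply: eq_bigr => m _; rewrite SigF_form_of /= linearZ. Qed.

Lemma ip2_sumr w s : ip2 g w (comb s) = \sum_m s m * ip2 g w (SigF th m).
Proof.
rewrite ip2E /comb raddf_sum mulmx_sumr mulmx_suml raddf_sum mulr_sumr.
apply: eq_bigr => m _; rewrite ip2E /= linearZ -scalemxAr -scalemxAl mxtraceZ; ring.
Qed.

Lemma ip2_combr m s : ip2 g (SigF th m) (comb s) = s m.
Proof.
rewrite ip2_sumr (bigD1 m) //= ip2_SigF eqxx mulr1 big1 ?addr0 // => n.
by rewrite ip2_SigF eq_sym => /negPf ->; rewrite mulr0.
Qed.

Lemma ip2C u v : ip2 g u v = ip2 g v u.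
Proof. by rewrite !ip2_comps_of ip0C. Qed.

Lemma ip2_comb m s : ip2 g (comb s) (SigF th m) = s m.
Proof. by rewrite ip2C ip2_combr. Qed.

Lemma comb_inj s t : comb s = comb t -> s =1 t.
Proof. by move=> e m; rewrite -(ip2_comb m s) e ip2_comb.  Qed.

Lemma LambdaPlusE w :
  (w \in LambdaPlus g) = (w^T == - w) && (hodge_mx g w == w).
Proof.
pose f1 (w : 'M[R]_4) : 'M[R]_4 := (w + w^T)%R.
have f1L : linear f1.
  by move=> a u v; rewrite /f1 linearP /= scalerDr; rewrite addrACA.
pose F1 : {linear 'M[R]_4 -> 'M[R]_4} :=
  HB.pack f1 (GRing.isLinear.Build R _ _ _ f1 f1L).
pose f2 (w : 'M[R]_4) : 'M[R]_4 := (hodge_mx g w - w)%R.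
have f2L : linear f2.
  move=> a u v; rewrite /f2 -(comps_ofK (a *: u + v)) -[in RHS](comps_ofK u) -[in RHS](comps_ofK v).
  rewrite !hodge_form_of -!raddfB -linearP; congr form_of; rewrite linearP.
  have -> : hodge0 (a *: comps_of u + comps_of v) = a *: hodge0 (comps_of u) + hodge0 (comps_of v).
    apply/matrixP => i j; rewrite !mxE !mulr_sumr -big_split; apply: eq_bigr => k _.
    rewrite !mulr_sumr -big_split; apply: eq_bigr => l _ /=.
    by rewrite [(a *: comps_of u + comps_of v) k l]mxE [(a *: comps_of u) k l]mxE; ring.
  by rewrite scalerBr opprD addrACA.
pose F2 : {linear 'M[R]_4 -> 'M[R]_4} :=
  HB.pack f2 (GRing.isLinear.Build R _ _ _ f2 f2L).
rewrite /LambdaPlus memv_cap !memv_ker.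
rewrite (lfunE F1) (lfunE F2) /= /f1 /f2 subr_eq0; congr (_ && _).
by rewrite addrC addr_eq0.
Qed.

(** The [SigF th m] are an orthonormal basis of Lambda^+. *)
Lemma LambdaPlusP w :
  reflect (w = comb (fun m => ip2 g w (SigF th m))) (w \in LambdaPlus g).
Proof.
apply: (iffP idP) => [|->].
  rewrite LambdaPlusE -{1 2 3 4}(comps_ofK w) hodge_form_of form_of_tr -raddfN.
  rewrite !(can_eq form_ofK) => /andP[/eqP skw /eqP sd].
  rewrite comb_form_of -[LHS]comps_ofK; congr form_of.
  rewrite -[LHS]scale1r (_ : 1 = 2^-1 * 2); last by rewrite mulVf.
  rewrite -scalerA (_ : 2 *: comps_of w = comps_of w + hodge0 (comps_of w)).
    rewrite selfdual0E //; apply: eq_bigr => m _.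
    by rewrite ip2_comps_of SigF_form_of form_ofK.
  by rewrite sd scaler_nat mulr2n.
set s := (fun m => _).
rewrite LambdaPlusE comb_form_of hodge_form_of form_of_tr -raddfN !(can_eq form_ofK).
set W := \sum_m _.
have wT : W^T = - W.
  rewrite /W raddf_sum -sumrN; apply: eq_bigr => m _.
  by rewrite /= linearZ /= Sig0_skew scalerN.
rewrite wT eqxx /=.
have := selfdual0E wT.
have -> : \sum_m ip0 W (Sig0 m) *: Sig0 m = W.
  apply: eq_bigr => m _; congr (_ *: _).
  by rewrite -(ip2_form_of W) -comb_form_of -SigF_form_of ip2_comb.
move=> h; apply/eqP.
have : W + hodge0 W = 2 *: W by rewrite -[in RHS]h scalerA mulfV // scale1r.
by rewrite scaler_nat mulr2n => /addrI.
Qed.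

Lemma comb_LambdaPlus s : comb s \in LambdaPlus g.
Proof.
apply/LambdaPlusP; apply: eq_bigr => m _; by rewrite ip2_comb.
Qed.

End Frame.

(** * Endomorphisms of Lambda^+ as matrices *)

Section Cross.
Context {R : realType}.

Definition cross3 (s t : 'I_3 -> R) (k : 'I_3) : R :=
  \sum_i \sum_j s i * t j * epsilon3 i j k.

Lemma epsilon3C i j k : epsilon3 j i k = - epsilon3 i j k :> R.
Proof.
rewrite !epsilon3E; move: i j k; do 3! elim/ord3P; rewrite !inordK //=; ring.
Qed.

Lemma Sig0_comm m n : Sig0 m *m Sig0 n - Sig0 n *m Sig0 m
  = (2 * isqrt2) *: \sum_k epsilon3 m n k *: Sig0 k :> 'M[R]_4.
Proof.
rewrite !Sig0_mul (eq_sym n m).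
under [X in _ - (_ + _ *: X)]eq_bigr do rewrite epsilon3C scaleNr.
by rewrite sumrN scalerN opprD opprK addrACA subrr add0r -scalerDl -mulr2n mulr_natl.
Qed.

(** The bracket with a self-dual matrix only sees the self-dual part, as
    self-dual and anti-self-dual matrices commute. *)
Lemma Sig0_comm_skew (w : 'M[R]_4) m : w^T = - w ->
  Sig0 m *m w - w *m Sig0 m
  = (2 * isqrt2) *: \sum_k ip0 w (Sig0 k) *: \sum_n epsilon3 m k n *: Sig0 n.
Proof.
move=> wT; have [q {1 2}->] := skew_decomposition wT.
rewrite mulmxDr mulmxDl opprD addrACA -[RHS]addr0; congr (_ + _); last first.
  apply/eqP; rewrite subr_eq0; apply/eqP; rewrite mulmx_sumr mulmx_suml.
  by apply: eq_bigr => k _; rewrite -scalemxAr -scalemxAl Sig0_Tau0.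
rewrite mulmx_sumr mulmx_suml -sumrB scaler_sumr; apply: eq_bigr => k _.
by rewrite -scalemxAr -scalemxAl -scalerBr Sig0_comm !scalerA mulrC.
Qed.

(** The cross product of Lambda^+ is the commutator of 2-forms, regarded by
    means of g as endomorphisms of the tangent space; hence it does not
    depend on the coframe. *)
Lemma comb_comm (g th : 'M[R]_4) (gE : g = th^T *m th) (dth : 0 < \det th) s t :
  comb th s *m invmx g *m comb th t - comb th t *m invmx g *m comb th s
  = (2 * isqrt2) *: comb th (cross3 s t).
Proof.
rewrite !comb_form_of !(form_of_mul gE dth) -raddfB -linearZ; congr form_of.
transitivity (\sum_i \sum_j (s i * t j) *: (Sig0 i *m Sig0 j - Sig0 j *m Sig0 i) : 'M[R]_4).
  under [RHS]eq_bigr do (under eq_bigr do rewrite scalerBr); under [RHS]eq_bigr do rewrite big_split.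
  rewrite big_split /=; congr (_ + _).
    rewrite mulmx_suml; apply: eq_bigr => i _; rewrite mulmx_sumr; apply: eq_bigr => j _.
    by rewrite -scalemxAl -scalemxAr scalerA.
  rewrite exchange_big /= mulmx_suml -sumrN; apply: eq_bigr => i _.
  rewrite mulmx_sumr -sumrN; apply: eq_bigr => j _.
  by rewrite -scalemxAl -scalemxAr scalerA mulrC.
under eq_bigr do under eq_bigr do rewrite Sig0_comm scalerA mulrC -scalerA.
rewrite scaler_sumr /cross3.
transitivity (\sum_i \sum_j \sum_k (2 * isqrt2) *: ((s i * t j * epsilon3 i j k) *: Sig0 k) : 'M[R]_4).
  apply: eq_bigr => i _; apply: eq_bigr => j _.
  rewrite -scaler_sumr; congr (_ *: _); rewrite scaler_sumr; apply: eq_bigr => k _.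
  by rewrite scalerA.
rewrite exchange_big /=; under eq_bigr do rewrite exchange_big /=.
rewrite exchange_big /=; apply: eq_bigr => k _.
rewrite scaler_suml scaler_sumr exchange_big /=; apply: eq_bigr => i _.
by rewrite scaler_suml scaler_sumr.
Qed.

Lemma ip2_linear (g w : 'M[R]_4) : linear (ip2 g ^~ w : 'M[R]_4 -> R^o).
Proof.
move=> a u v; rewrite !ip2E !mulmxDl -!scalemxAl mxtraceD mxtraceZ.
by rewrite /GRing.scale /=; ring.
Qed.

Variables (g th : 'M[R]_4).

Definition mat (f : End_plus g) : 'M[R]_3 :=
  \matrix_(n, m) ip2 g (vsval (f (inplus g (SigF th m)))) (SigF th n).

Lemma mat_linear : linear mat.
Proof.
move=> a f f'; apply/matrixP => n m; rewrite !mxE.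
by rewrite add_lfunE scale_lfunE ip2_linear.
Qed.
HB.instance Definition _ :=
  GRing.isLinear.Build R (End_plus g) 'M[R]_3 *:%R mat mat_linear.

Hypotheses (gE : g = th^T *m th) (dth : 0 < \det th).

Lemma coframeP : g = (coframe g)^T *m coframe g /\ 0 < \det (coframe g).
Proof.
have [h d] : oriented_orthonormal_coframe g (coframe g).
  by rewrite /coframe; apply: xgetPex; exists th; split; [exact: frame_orth|].
split=> //; set c := coframe g in h d *.
have cu : c \in unitmx by rewrite unitmxE unitfE lt0r_neq0.
have gu : g \in unitmx by rewrite gE unitmx_mul unitmx_tr (frame_unit dth).
have e : invmx g *m (c^T *m c) = 1%:M.
  apply: (can_inj (mulmxK cu)); rewrite mul1mx.
  by apply: (can_inj (mulKmx cu)); rewrite !mulmxA h mul1mx.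
by rewrite -[RHS](mulKVmx gu) e mulmx1.
Qed.

Lemma SigmaE m : Sigma g m = SigF (coframe g) m.
Proof. by []. Qed.

(** Both sides are the commutator of [comb_comm], expressed in the coframe th
    and in the one that [Sigma] is built from. *)
Lemma cross_comb s t : cross g (comb th s) (comb th t) = comb th (cross3 s t).
Proof.
have [c1 c2] := coframeP.
have e s' : comb th s' = comb (coframe g) (fun m => ip2 g (comb th s') (Sigma g m)).
  by apply/(LambdaPlusP c1 c2)/(comb_LambdaPlus gE dth).
have r2 : 2 * isqrt2 != 0 :> R by rewrite mulf_neq0 ?isqrt2_neq0.
set s' := (fun m => ip2 g (comb th s) (Sigma g m)).
set t' := (fun m => ip2 g (comb th t) (Sigma g m)).
have -> : cross g (comb th s) (comb th t) = comb (coframe g) (cross3 s' t').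
  rewrite /comb /cross3; under [RHS]eq_bigr do rewrite scaler_suml.
  rewrite [RHS]exchange_big /=; apply: eq_bigr => i _.
  under [RHS]eq_bigr do rewrite scaler_suml.
  by rewrite [RHS]exchange_big.
apply: (scalerI r2); rewrite -(comb_comm gE dth) -(comb_comm c1 c2).
by rewrite -(e s) -(e t).
Qed.

Lemma Sigma_LambdaPlus m : Sigma g m \in LambdaPlus g.
Proof.
have [c1 c2] := coframeP.
apply/(LambdaPlusP c1 c2); rewrite /comb (bigD1 m) //= SigmaE.
rewrite (ip2_SigF c1 c2) eqxx scale1r big1 ?addr0 // => n.
by rewrite (ip2_SigF c1 c2) eq_sym => /negPf ->; rewrite scale0r.
Qed.

Lemma SigF_LambdaPlus m : SigF th m \in LambdaPlus g.
Proof.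
apply/(LambdaPlusP gE dth); rewrite /comb (bigD1 m) //=.
rewrite (ip2_SigF gE dth) eqxx scale1r big1 ?addr0 // => n.
by rewrite (ip2_SigF gE dth) eq_sym => /negPf ->; rewrite scale0r.
Qed.

Lemma ip2_suml I (r : seq I) (c : I -> R) (F : I -> 'M[R]_4) w :
  ip2 g (\sum_(i <- r) c i *: F i) w = \sum_(i <- r) c i * ip2 g (F i) w.
Proof.
rewrite (ip2_comps_of gE dth) raddf_sum /ip0 mulmx_suml raddf_sum mulr_sumr.
apply: eq_bigr => m _; rewrite (ip2_comps_of gE dth) /= linearZ -scalemxAl mxtraceZ /ip0; ring.
Qed.

(** The two orthonormal frames of Lambda^+ differ by an orthogonal matrix. *)
Lemma frame_change (O := fun m n => ip2 g (Sigma g m) (SigF th n)) :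
  (forall m, Sigma g m = \sum_n O m n *: SigF th n) /\
  (forall n n', \sum_m O m n * O m n' = (n == n')%:R).
Proof.
have [c1 c2] := coframeP.
have e1 m : Sigma g m = \sum_n O m n *: SigF th n.
  exact/(LambdaPlusP gE dth)/Sigma_LambdaPlus.
split=> // n n'.
have e2 n1 : SigF th n1 = \sum_m O m n1 *: Sigma g m.
  have /(LambdaPlusP c1 c2) -> := SigF_LambdaPlus n1.
  by apply: eq_bigr => m _; rewrite (ip2C c1 c2).
rewrite -(ip2_SigF gE dth n n') [in RHS](e2 n) ip2_suml.
by apply: eq_bigr => m _.
Qed.

Implicit Type f : End_plus g.

Lemma vsval_mem (v : subvs_of (LambdaPlus g)) : vsval v \in LambdaPlus g.
Proof. exact: subvsP. Qed.

Lemma inplusK w : w \in LambdaPlus g -> vsval (inplus g w) = w.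
Proof. exact: vsprojK. Qed.

Lemma vsval_comb (c : 'I_3 -> R) :
  vsval (\sum_m c m *: inplus g (SigF th m)) = comb th c.
Proof.
rewrite linear_sum; apply: eq_bigr => m _.
by rewrite linearZ; congr (_ *: _); exact: inplusK (SigF_LambdaPlus m).
Qed.

Lemma vsvalE (v : subvs_of (LambdaPlus g)) :
  v = \sum_m ip2 g (vsval v) (SigF th m) *: inplus g (SigF th m).
Proof.
apply: val_inj; rewrite [RHS]vsval_comb.
exact/(LambdaPlusP gE dth)/vsval_mem.
Qed.

Lemma matE f m : vsval (f (inplus g (SigF th m))) = \sum_n mat f n m *: SigF th n.
Proof.
have /(LambdaPlusP gE dth) -> := vsval_mem (f (inplus g (SigF th m))).
by apply: eq_bigr => n _; rewrite mxE.
Qed.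

Lemma mat_col f m :
  f (inplus g (SigF th m)) = \sum_n mat f n m *: inplus g (SigF th n).
Proof. by apply: val_inj; rewrite [RHS]vsval_comb [LHS]matE. Qed.

Definition mkEnd (A : 'M[R]_3) : End_plus g :=
  linfun (fun v : subvs_of (LambdaPlus g) =>
    \sum_n (\sum_m A n m * ip2 g (vsval v) (SigF th m)) *: inplus g (SigF th n)).

Lemma mkEndE A v : mkEnd A v =
  \sum_n (\sum_m A n m * ip2 g (vsval v) (SigF th m)) *: inplus g (SigF th n).
Proof.
rewrite /mkEnd; set F := (fun v => _).
have FL : linear F.
  move=> a u w; rewrite /F scaler_sumr -big_split /=; apply: eq_bigr => n _.
  rewrite scalerA -scalerDl; congr (_ *: _).
  rewrite mulr_sumr -big_split; apply: eq_bigr => m _ /=.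
  by rewrite ip2_linear /GRing.scale /=; ring.
pose F' : {linear _ -> _} := HB.pack F (GRing.isLinear.Build R _ _ _ F FL).
by rewrite (lfunE F').
Qed.

Lemma mkEndK A : mat (mkEnd A) = A.
Proof.
apply/matrixP => n m; rewrite mxE mkEndE vsval_comb (ip2_comb gE dth).
rewrite (bigD1 m) //= inplusK ?SigF_LambdaPlus // (ip2_SigF gE dth) eqxx mulr1.
rewrite big1 ?addr0 // => k /negPf kn.
by rewrite (ip2_SigF gE dth) eq_sym kn mulr0.
Qed.

Lemma matK f : mkEnd (mat f) = f.
Proof.
apply/lfunP => v; rewrite mkEndE [in RHS](vsvalE v) raddf_sum /=.
under [RHS]eq_bigr do rewrite linearZ /= mat_col scaler_sumr.
rewrite [RHS]exchange_big; apply: eq_bigr => n _ /=; rewrite scaler_suml.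
by apply: eq_bigr => m _; rewrite scalerA mulrC.
Qed.

Lemma mat_comp f f' : mat (endo_comp f f') = mat f *m mat f'.
Proof.
apply/matrixP => n m; rewrite !mxE /endo_comp comp_lfunE.
rewrite mat_col linear_sum linear_sum.
under eq_bigr do rewrite linearZ linearZ.
by rewrite ip2_suml; apply: eq_bigr => k _; rewrite [mat f _ _]mxE mulrC.
Qed.

Lemma mat_id : mat (endo_id g) = 1%:M.
Proof.
apply/matrixP => n m; rewrite !mxE id_lfunE inplusK ?SigF_LambdaPlus //.
by rewrite (ip2_SigF gE dth) eq_sym.
Qed.

Lemma mat_inj : injective mat.
Proof. exact: can_inj matK. Qed.

(** [endo_inv] is only a partial inverse in general; invertibility of the
    matrix makes the kernel trivial. *)
Lemma mat_inv f : mat f \in unitmx -> mat (endo_inv f) = invmx (mat f).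
Proof.
move=> fu; have kf : lker f == 0%VS.
  apply/lker0P => u v fuv.
  have <- : mkEnd (invmx (mat f)) (f u) = u.
    rewrite -comp_lfunE -[RHS]id_lfunE; congr (fun_of_lfun _ u).
    by apply: mat_inj; rewrite mat_comp mkEndK mulVmx // mat_id.
  rewrite fuv -comp_lfunE -[RHS]id_lfunE; congr (fun_of_lfun _ v).
  by apply: mat_inj; rewrite mat_comp mkEndK mulVmx // mat_id.
apply: (can_inj (mulKmx fu)); rewrite mulmxV // -mat_comp -mat_id; congr mat.
apply/lfunP => v; rewrite /endo_comp comp_lfunE id_lfunE.
exact: lker0_lfunVK.
Qed.

Lemma ip_plusE (v w : subvs_of (LambdaPlus g)) : ip_plus v w = \sum_m ip2 g (vsval v) (SigF th m) * ip2 g (vsval w) (SigF th m).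
Proof.
rewrite /ip_plus; have /(LambdaPlusP gE dth) {1}-> := vsval_mem v.
by rewrite ip2_suml; apply: eq_bigr => m _; rewrite (ip2C gE dth (SigF th m)).
Qed.

Lemma mat_app f v n : ip2 g (vsval (f v)) (SigF th n)
  = \sum_m mat f n m * ip2 g (vsval v) (SigF th m).
Proof.
by rewrite -[in LHS](matK f) mkEndE vsval_comb (ip2_comb gE dth).
Qed.

Lemma selfadjoint_mat f : selfadjoint f <-> (mat f)^T = mat f.
Proof.
split=> [h|h v w].
  apply/matrixP => n m; rewrite !mxE.
  have := h (inplus g (SigF th n)) (inplus g (SigF th m)).
  rewrite /ip_plus !(inplusK (SigF_LambdaPlus _)) => ->; exact: (ip2C gE dth).
rewrite !ip_plusE.
under eq_bigr do rewrite mat_app mulr_suml.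
under [RHS]eq_bigr do rewrite mat_app mulr_sumr.
rewrite exchange_big; apply: eq_bigr => m _; apply: eq_bigr => n _ /=.
have -> : mat f m n = mat f n m by rewrite -[in LHS]h mxE.
by ring.
Qed.

Lemma posdef_mat f : posdef f ->
  forall v : 'rV[R]_3, v != 0 -> 0 < (v *m mat f *m v^T) 0 0.
Proof.
move=> pf v vn0.
pose u := \sum_m v 0 m *: inplus g (SigF th m).
have uE m : ip2 g (vsval u) (SigF th m) = v 0 m.
  by rewrite vsval_comb (ip2_comb gE dth).
have un0 : u != 0.
  apply: contra vn0 => /eqP u0; apply/eqP/rowP => m; rewrite -uE u0 mxE raddf0.
  by rewrite (ip2_comps_of gE dth) raddf0 /ip0 mul0mx mxtrace0 mulr0.
have := pf u un0; rewrite ip_plusE; congr (0 < _).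
rewrite -mulmxA mxE; apply: eq_bigr => m _; rewrite mulrC uE; congr (_ * _).
by rewrite mat_app mxE; apply: eq_bigr => k _; rewrite uE [v^T _ _]mxE.
Qed.

(** B_h does not depend on the orthonormal frame: the transition matrix
    cancels against its transpose. *)
Lemma Btensor_mat f i j :
  Btensor f i j = \sum_n \sum_m (mat f n m * SigF th n i j) *: SigF th m.
Proof.
have [e o] := frame_change.
rewrite /Btensor.
have e' m : inplus g (Sigma g m) = \sum_n ip2 g (Sigma g m) (SigF th n) *: inplus g (SigF th n).
  by rewrite {1}e /inplus raddf_sum; apply: eq_bigr => n _; rewrite /= linearZ.
transitivity (\sum_m \sum_k \sum_l (ip2 g (Sigma g m) (SigF th k) * ip2 g (Sigma g m) (SigF th l)
   * vsval (f (inplus g (SigF th k))) i j) *: SigF th l).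
  apply: eq_bigr => m _; rewrite e' !linear_sum summxE [in X in _ *: X]e.
  rewrite scaler_suml; apply: eq_bigr => k _.
  rewrite !linearZ mxE scaler_sumr; apply: eq_bigr => l _.
  by rewrite scalerA; congr (_ *: _); ring.
rewrite exchange_big /=; under eq_bigr do rewrite exchange_big /=.
transitivity (\sum_k (vsval (f (inplus g (SigF th k))) i j) *: SigF th k).
  apply: eq_bigr => k _; rewrite (bigD1 k) //= -scaler_suml -mulr_suml o eqxx mul1r.
  rewrite big1 ?addr0 // => l /negPf lk; rewrite -scaler_suml -mulr_suml o eq_sym lk.
  by rewrite mul0r scale0r.
rewrite [RHS]exchange_big; apply: eq_bigr => k _ /=.
rewrite matE summxE scaler_suml; apply: eq_bigr => n _; by rewrite mxE.
Qed.

Lemma endo_ofE T v : endo_of g T v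
  = inplus g (\matrix_(i, j) ip2 g (T i j) (vsval v)).
Proof.
rewrite /endo_of; set F := (fun v => _).
have FL : linear F.
  move=> a u w; rewrite /F -linearP; congr (inplus g _); apply/matrixP => i j.
  rewrite !mxE !(ip2C gE dth (T i j)) linearP.
  by have := ip2_linear g (T i j) a (vsval u) (vsval w).
pose F' : {linear _ -> _} := HB.pack F (GRing.isLinear.Build R _ _ _ F FL).
by rewrite (lfunE F').
Qed.

Lemma hodge2_linear (W W' : lmodType R) (L : {linear W -> W'}) T i j :
  L (hodge2 g T i j) = hodge2 g (fun p q => L (T p q)) i j.
Proof.
rewrite /hodge2 linearZ; congr (_ *: _).
by do 4! (rewrite linear_sum; apply: eq_bigr => ? _); rewrite linearZ.
Qed.

Lemma selfdual_form_of (w : 'M[R]_4) : w^T = - w ->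
  2^-1 *: (w + hodge_mx g w) = comb th (fun n => ip2 g w (SigF th n)).
Proof.
move=> wT; rewrite -{1 2}(comps_ofK dth w) (hodge_form_of gE dth) -raddfD -linearZ /=.
rewrite selfdual0E ?comps_of_tr ?wT ?raddfN // comb_form_of; congr form_of.
by apply: eq_bigr => n _; rewrite (ip2_comps_of gE dth) SigF_form_of (form_ofK dth).
Qed.

(** Taking the self-dual part amounts to ignoring the other components, as the
    [SigF th n] are orthogonal to anti-self-dual forms. *)
Lemma endo_of_mat (W : 'I_3 -> 'M[R]_4) (T := fun i j => \sum_m W m i j *: SigF th m) :
  (forall m, (W m)^T = - W m) ->
  mat (endo_of g (selfdual_part g T)) = \matrix_(n, m) ip2 g (W m) (SigF th n).
Proof.
move=> skW; apply/matrixP => n m; rewrite !mxE endo_ofE.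
rewrite (inplusK (SigF_LambdaPlus m)).
have -> : (\matrix_(i, j) ip2 g (selfdual_part g T i j) (SigF th m))
    = comb th (fun n => ip2 g (W m) (SigF th n)).
  rewrite -selfdual_form_of //; apply/matrixP => i j; rewrite !mxE.
  pose L : {linear 'M[R]_4 -> R^o} :=
    HB.pack (ip2 g ^~ (SigF th m)) (GRing.isLinear.Build R _ _ _ _ (ip2_linear g (SigF th m))).
  have LT p q : L (T p q) = W m p q by rewrite /L /= (ip2_comb gE dth).
  rewrite -[LHS]/(L (selfdual_part g T i j)) /selfdual_part linearZ linearD LT.
  rewrite hodge2_linear; congr (_ * (_ + _)).
  by rewrite /hodge2; congr (_ *: _); do 4! (apply: eq_bigr => ? _); rewrite LT.
by rewrite inplusK ?(comb_LambdaPlus gE dth) // (ip2_comb gE dth).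
Qed.

End Cross.

(** * The inverse of ad_h on triples of vectors *)

Section Det3.
Context {R : realType}.

Lemma det3_epsilon (A : 'M[R]_3) :
  \sum_i \sum_j \sum_k epsilon3 i j k
     * (A (inord 0) i * A (inord 1) j * A (inord 2) k) = \det A.
Proof.
pose c (s : 'S_3) (a b : 'I_3) : R := A a b * (b == s a)%:R.
have h i j k : epsilon3 i j k * (A (inord 0) i * A (inord 1) j * A (inord 2) k)
    = \sum_(s : 'S_3) (-1) ^+ s * (c s (inord 0) i * (c s (inord 1) j
        * c s (inord 2) k)) :> R.
  rewrite /epsilon3 /levi_civita /determinant mulr_suml; apply: eq_bigr => s _.
  rewrite big3 !mxE !(tnth_nth i) /= !inordK //= /c.
  by move: ((-1) ^+ s : R) => e; ring.
under eq_bigr do under eq_bigr do under eq_bigr do rewrite h.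
under eq_bigr do under eq_bigr do rewrite exchange_big.
under eq_bigr do rewrite exchange_big.
rewrite exchange_big /=; apply: eq_bigr => s _.
have cE a : \sum_b c s a b = A a (s a).
  rewrite (bigD1 (s a)) //= /c eqxx mulr1 big1 ?addr0// => b /negPf ->.
  by rewrite mulr0.
under eq_bigr do under eq_bigr do rewrite -mulr_sumr -!mulr_sumr cE.
under eq_bigr do rewrite -mulr_sumr -!mulr_sumr -mulr_suml cE.
by rewrite -mulr_sumr -mulr_suml cE big3.
Qed.

(** The invariance of the permutation symbol behind [ad_mx_coef_mul]. *)
Lemma epsilon3_mx (Y : 'M[R]_3) (a b c : 'I_3) :
  \sum_i \sum_j \sum_k epsilon3 i j k * (Y a i * Y b j * Y c k)
  = \det Y * epsilon3 a b c.
Proof.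
pose s := [tuple a; b; c].
rewrite /(epsilon3 a b c) /levi_civita mulrC -det_mulmx -det3_epsilon.
have e (t i : 'I_3) : (\matrix_(i, j) (tnth s i == j)%:R *m Y) t i = Y (tnth s t) i.
  rewrite !mxE (bigD1 (tnth s t)) //= !mxE eqxx mul1r big1 ?addr0// => k.
  by rewrite eq_sym => /negPf kt; rewrite mxE kt mul0r.
do 3! (apply: eq_bigr => ? _).
by rewrite !e !(tnth_nth a) /= !inordK.
Qed.
End Det3.

Section Ad.
Context {R : realType}.
Implicit Types (H A B : 'M[R]_3) (a c u : 'I_3 -> 'cV[R]_4).

(** A matrix acting on the coefficient factor of R^4 (x) Lambda^+. *)
Definition coef_mul A c (q : 'I_3) : 'cV[R]_4 := \sum_m A q m *: c m.

(** In a coframe, a |-> [a, B_h]: by [frame_dual3_Bcoef], the wedge product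
    with [SigF th n] is the multiplication by [Sig0 n] once 3-forms are
    identified with vectors. *)
Definition ad_mx H a (m : 'I_3) : 'cV[R]_4 :=
  \sum_p \sum_l \sum_n (epsilon3 p l m * H n l) *: (Sig0 n *m a p).

Definition ad_mx1 u (m : 'I_3) : 'cV[R]_4 :=
  \sum_p \sum_l epsilon3 p l m *: (Sig0 l *m u p).

(** This is H^T (S + 1 / sqrt 2) H / det H acting on triples, where S is
    [ad_mx1]: see [ad_mx1K] and [ad_mx_coef_mul]. *)
Definition ad_mx_inv H c : 'I_3 -> 'cV[R]_4 :=
  coef_mul ((\det H)^-1 *: H^T) (fun q => ad_mx1 (coef_mul H c) q + isqrt2 *: coef_mul H c q).

Lemma coef_mul1 c : coef_mul 1%:M c = c.
Proof.
apply/funext => q; rewrite /coef_mul (bigD1 q) //= mxE eqxx scale1r big1 ?addr0 //.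
by move=> k; rewrite eq_sym => /negPf kq; rewrite mxE kq scale0r.
Qed.

Lemma coef_mulM A B c : coef_mul A (coef_mul B c) = coef_mul (A *m B) c.
Proof.
apply/funext => q; rewrite /coef_mul.
under eq_bigr do rewrite scaler_sumr.
rewrite exchange_big; apply: eq_bigr => m _ /=; rewrite mxE scaler_suml.
by apply: eq_bigr => k _; rewrite scalerA.
Qed.

Lemma coef_mulZ k A c q : coef_mul (k *: A) c q = k *: coef_mul A c q.
Proof.
rewrite /coef_mul scaler_sumr; apply: eq_bigr => m _.
by rewrite mxE scalerA.
Qed.

Lemma ad_mx1_0 u : ad_mx1 u (inord 0) = Sig0 (inord 2) *m u (inord 1) - Sig0 (inord 1) *m u (inord 2).
Proof.
rewrite /ad_mx1 !big3 !epsilon3E !inordK //= !(scale0r, add0r, addr0, scale1r, scaleN1r).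
by rewrite addrC.
Qed.

Lemma ad_mx1_1 u : ad_mx1 u (inord 1) = Sig0 (inord 0) *m u (inord 2) - Sig0 (inord 2) *m u (inord 0).
Proof.
by rewrite /ad_mx1 !big3 !epsilon3E !inordK //= !(scale0r, add0r, addr0, scale1r, scaleN1r) addrC.
Qed.

Lemma ad_mx1_2 u : ad_mx1 u (inord 2) = Sig0 (inord 1) *m u (inord 0) - Sig0 (inord 0) *m u (inord 1).
Proof.
by rewrite /ad_mx1 !big3 !epsilon3E !inordK //= !(scale0r, add0r, addr0, scale1r, scaleN1r).
Qed.

Lemma Sig0_sqr m : Sig0 m *m Sig0 m = (- 2^-1)%:M :> 'M[R]_4.
Proof.
rewrite Sig0_mul eqxx mulr1 big1 ?scaler0 ?addr0 // => k _.
rewrite epsilon3E; move: m k; do 2! elim/ord3P; rewrite !inordK //= scale0r //.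
Qed.

Lemma Sig0_mul_rot (m n k : nat) : (m, n, k) \in [:: (0, 1, 2); (1, 2, 0); (2, 0, 1)]%N ->
  Sig0 (inord m) *m Sig0 (inord n) = isqrt2 *: Sig0 (inord k) :> 'M[R]_4 /\
  Sig0 (inord n) *m Sig0 (inord m) = - (isqrt2 *: Sig0 (inord k)) :> 'M[R]_4.
Proof.
rewrite !inE => /or3P[] /eqP[-> -> ->]; rewrite !Sig0_mul !inord_eq3 // !big3 !epsilon3E !inordK //=;
  by rewrite !mulr0 oppr0 raddf0 add0r !(scale0r, add0r, addr0, scale1r, scaleN1r) scalerN.
Qed.

(** The quadratic relation of a spin-orbit operator: S = [ad_mx1] acts on the
    product of a spin 1/2 and a spin 1 representation, and has one eigenvalue
    on each of the two irreducible summands. *)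
Lemma ad_mx1_sqr u m : ad_mx1 (ad_mx1 u) m = u m - isqrt2 *: ad_mx1 u m.
Proof.
have [e01 e10] := @Sig0_mul_rot 0 1 2 isT.
have [e12 e21] := @Sig0_mul_rot 1 2 0 isT.
have [e20 e02] := @Sig0_mul_rot 2 0 1 isT.
have e := (ad_mx1_0, ad_mx1_1, ad_mx1_2).
move: m; elim/ord3P; rewrite !e !mulmxBr !mulmxA ?e01 ?e10 ?e12 ?e21 ?e20 ?e02 !Sig0_sqr
  -!scalemxAl !mulNmx -!scalemxAl !mul_scalar_mx.
- move: (Sig0 _ *m u (inord 2)) (Sig0 _ *m u (inord 1)) => x y.
  by apply/colP => i; rewrite !mxE; field.
- move: (Sig0 _ *m u (inord 0)) (Sig0 _ *m u (inord 2)) => x y.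
  by apply/colP => i; rewrite !mxE; field.
- move: (Sig0 _ *m u (inord 1)) (Sig0 _ *m u (inord 0)) => x y.
  by apply/colP => i; rewrite !mxE; field.
Qed.

(** The three factors H are absorbed by [epsilon3_mx]. *)
Lemma epsilon3_coef_mul H (F : 'I_3 -> 'I_3 -> 'cV[R]_4) q :
  \sum_m H q m *: (\sum_p \sum_l \sum_n (epsilon3 p l m * H n l) *: (\sum_k H k p *: F n k))
  = \det H *: \sum_k \sum_n epsilon3 k n q *: F n k.
Proof.
transitivity (\sum_k \sum_n (\sum_p \sum_l \sum_m epsilon3 p l m * (H k p * H n l * H q m)) *: F n k);
  last first.
  rewrite scaler_sumr; apply: eq_bigr => k _; rewrite scaler_sumr; apply: eq_bigr => n _.
  by rewrite epsilon3_mx scalerA.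
transitivity (\sum_k \sum_n \sum_p \sum_l \sum_m (epsilon3 p l m * (H k p * H n l * H q m)) *: F n k);
  last first.
  apply: eq_bigr => k _; apply: eq_bigr => n _.
  by do 3! (rewrite scaler_suml; apply: eq_bigr => ? _).
transitivity (\sum_p \sum_l \sum_m \sum_k \sum_n (epsilon3 p l m * (H k p * H n l * H q m)) *: F n k); last first.
  under [RHS]eq_bigr do rewrite exchange_big /=.
  rewrite [RHS]exchange_big /=; apply: eq_bigr => p _.
  under [RHS]eq_bigr do rewrite exchange_big /=.
  rewrite [RHS]exchange_big /=; apply: eq_bigr => l _.
  under [RHS]eq_bigr do rewrite exchange_big /=.
  by rewrite [RHS]exchange_big.
under eq_bigr do rewrite scaler_sumr.
rewrite exchange_big; apply: eq_bigr => p _ /=.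
under eq_bigr do rewrite scaler_sumr.
rewrite exchange_big; apply: eq_bigr => l _ /=.
apply: eq_bigr => m _; rewrite exchange_big scaler_sumr; apply: eq_bigr => n _ /=.
rewrite scalerA scaler_sumr; apply: eq_bigr => k _.
by rewrite scalerA; congr (_ *: _); ring.
Qed.

Lemma ad_mx_coef_mul H u q : coef_mul H (ad_mx H (coef_mul H^T u)) q = \det H *: ad_mx1 u q.
Proof.
rewrite /ad_mx1 -epsilon3_coef_mul; apply: eq_bigr => m _; congr (_ *: _).
apply: eq_bigr => p _; apply: eq_bigr => l _; apply: eq_bigr => n _; congr (_ *: _).
by rewrite /coef_mul mulmx_sumr; apply: eq_bigr => k _; rewrite mxE scalemxAr.
Qed.

Lemma ad_mx1D u v m : ad_mx1 (fun m => u m + v m) m = ad_mx1 u m + ad_mx1 v m.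
Proof.
rewrite -big_split; apply: eq_bigr => p _; rewrite -big_split; apply: eq_bigr => l _ /=.
by rewrite mulmxDr scalerDr.
Qed.

Lemma ad_mx1Z k u m : ad_mx1 (fun m => k *: u m) m = k *: ad_mx1 u m.
Proof.
rewrite scaler_sumr; apply: eq_bigr => p _; rewrite scaler_sumr; apply: eq_bigr => l _ /=.
by rewrite -scalemxAr !scalerA mulrC.
Qed.

Lemma ad_mx1K u : ad_mx1 (fun q => ad_mx1 u q + isqrt2 *: u q) = u.
Proof. by apply/funext => m; rewrite ad_mx1D ad_mx1Z ad_mx1_sqr subrK. Qed.

Lemma ad_mx1K' u : (fun q => ad_mx1 (ad_mx1 u) q + isqrt2 *: ad_mx1 u q) = u.
Proof. by apply/funext => m; rewrite ad_mx1_sqr subrK. Qed.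

Lemma ad_mxZ H k u m : ad_mx H (fun m => k *: u m) m = k *: ad_mx H u m.
Proof.
do 3! (rewrite scaler_sumr; apply: eq_bigr => ? _).
by rewrite -scalemxAr !scalerA mulrC.
Qed.

Lemma ad_mx_invZ H k c m : ad_mx_inv H (fun m => k *: c m) m = k *: ad_mx_inv H c m.
Proof.
rewrite /ad_mx_inv.
have -> : coef_mul H (fun m => k *: c m) = fun q => k *: coef_mul H c q.
  apply/funext => q; rewrite /coef_mul scaler_sumr; apply: eq_bigr => p _.
  by rewrite !scalerA mulrC.
rewrite /coef_mul scaler_sumr; apply: eq_bigr => q _; rewrite ad_mx1Z.
by rewrite !scalerDr !scalerA; congr (_ *: _ + _ *: _); ring.
Qed.

Lemma ad_mx_invK H c : \det H != 0 -> ad_mx H (ad_mx_inv H c) = c.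
Proof.
move=> dH; have Hu : H \in unitmx by rewrite unitmxE unitfE.
have inj a b : coef_mul H a = coef_mul H b -> a = b.
  by move=> /(congr1 (coef_mul (invmx H))); rewrite !coef_mulM mulVmx // !coef_mul1.
apply: inj; apply/funext => q.
have -> : ad_mx_inv H c = fun p => (\det H)^-1 *: coef_mul H^T (fun q => ad_mx1 (coef_mul H c) q + isqrt2 *: coef_mul H c q) p.
  by apply/funext => p; rewrite -coef_mulZ.
pose w q := ad_mx1 (coef_mul H c) q + isqrt2 *: coef_mul H c q; rewrite -/w.
transitivity ((\det H)^-1 *: coef_mul H (ad_mx H (coef_mul H^T w)) q).
  rewrite /(coef_mul H) scaler_sumr; apply: eq_bigr => m _.
  by rewrite ad_mxZ !scalerA mulrC.
by rewrite ad_mx_coef_mul scalerA mulVf // scale1r /w ad_mx1K.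
Qed.

Lemma ad_mxK H a : \det H != 0 -> ad_mx_inv H (ad_mx H a) = a.
Proof.
move=> dH; have Hu : H \in unitmx by rewrite unitmxE unitfE.
have Htu : H^T \in unitmx by rewrite unitmx_tr.
have -> : a = coef_mul H^T (coef_mul (invmx H^T) a) by rewrite coef_mulM mulmxV // coef_mul1.
set u := coef_mul _ a.
have e : coef_mul H (ad_mx H (coef_mul H^T u)) = fun q => ad_mx1 (fun q => \det H *: u q) q.
  by apply/funext => q; rewrite ad_mx_coef_mul ad_mx1Z.
rewrite /ad_mx_inv e ad_mx1K'; apply/funext => q; rewrite coef_mulZ /coef_mul scaler_sumr.
by apply: eq_bigr => m _; rewrite !scalerA; congr (_ *: _); rewrite -mulrA mulrCA mulVf // mulr1.
Qed.

End Ad.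

(** * The symbol in a coframe *)

Section Dual3.
Context {R : realType}.
Implicit Types (b : 'I_4 -> 'I_4 -> 'I_4 -> R).

(** Components of a 3-form; these two conditions generate all the symmetries. *)
Definition alt3 b :=
  (forall i j k, b j i k = - b i j k) /\ (forall i j k, b j k i = b i j k).

(** The vector obtained by contracting a 3-form with the standard volume. *)
Definition dual3 b : 'cV[R]_4 :=
  \col_l match nat_of_ord l with
         | 0%N => b (inord 1) (inord 2) (inord 3)
         | 1%N => - b (inord 0) (inord 2) (inord 3)
         | 2%N => b (inord 0) (inord 1) (inord 3)
         | _ => - b (inord 0) (inord 1) (inord 2)
         end.

Definition wedge12 (al : 'rV[R]_4) (w : 'M[R]_4) (i j k : 'I_4) : R :=
  al 0 i * w j k + al 0 j * w k i + al 0 k * w i j.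

Lemma wedge12_alt al w : w^T = - w -> alt3 (wedge12 al w).
Proof.
move=> wT; have sk i j : w i j = - w j i by move/matrixP: wT => /(_ j i); rewrite !mxE.
split=> i j k; rewrite /wedge12; last by ring.
by rewrite (sk i k) (sk k j) (sk j i); ring.
Qed.

(** For a self-dual w, so that [hodge0 w] is w itself, the wedge product of a
    covector with w is the value of w on that covector. *)
Lemma dual3_wedge12 al w : w^T = - w -> dual3 (wedge12 al w) = hodge0 w *m al^T.
Proof.
move=> wT; have sk i j : w i j = - w j i by move/matrixP: wT => /(_ j i); rewrite !mxE.
have d : forall a, w a a = 0.
  by move=> a; apply/eqP; have /eqP := sk a a; rewrite -addr_eq0 -mulr2n mulrn_eq0.
apply/colP => l; rewrite mxE [RHS]mxE.
under [RHS]eq_bigr do rewrite !mxE.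
under [RHS]eq_bigr do (under eq_bigr do (under eq_bigr do rewrite epsilon4E)).
rewrite big4 !big4 !d /wedge12.
rewrite (sk (inord 1) (inord 0)) (sk (inord 2) (inord 0)) (sk (inord 3) (inord 0)).
rewrite (sk (inord 2) (inord 1)) (sk (inord 3) (inord 1)) (sk (inord 3) (inord 2)).
move: l; elim/ord4P; rewrite !inordK //=;
rewrite ?(sk (inord 1) (inord 0)) ?(sk (inord 2) (inord 0)) ?(sk (inord 3) (inord 0));
rewrite ?(sk (inord 2) (inord 1)) ?(sk (inord 3) (inord 1)) ?(sk (inord 3) (inord 2)); by field.
Qed.

Lemma dual3_inj b : alt3 b -> dual3 b = 0 -> forall i j k, b i j k = 0.
Proof.
move=> [b1 b2] /colP d0.
have e0 := d0 (inord 0); have e1 := d0 (inord 1).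
have e2 := d0 (inord 2); have e3 := d0 (inord 3).
rewrite !mxE /= inordK //= in e0; rewrite !mxE /= inordK //= in e1.
rewrite !mxE /= inordK //= in e2; rewrite !mxE /= inordK //= in e3.
move/eqP: e1; rewrite oppr_eq0 => /eqP e1; move/eqP: e3; rewrite oppr_eq0 => /eqP e3.
have z i k : b i i k = 0.
  by apply/eqP; have /eqP := b1 i i k; rewrite -addr_eq0 -mulr2n mulrn_eq0.
have z'' i k : b k i i = 0 by rewrite -(b2 k i i) z.
have z' i k : b i k i = 0 by rewrite -(b2 i k i) z''.
have p i j k : b i j k = 0 -> [/\ b j k i = 0, b k i j = 0, b j i k = 0, b i k j = 0 & b k j i = 0].
  move=> h; have h1 : b j k i = 0 by rewrite (b2 i j k).
  have h2 : b k i j = 0 by rewrite (b2 j k i).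
  by split; rewrite // ?(b1 i j k) ?(b1 k i j) ?(b1 j k i) ?h ?h1 ?h2 oppr0.
have [? ? ? ? ?] := p _ _ _ e0; have [? ? ? ? ?] := p _ _ _ e1.
have [? ? ? ? ?] := p _ _ _ e2; have [? ? ? ? ?] := p _ _ _ e3.
by do 3! elim/ord4P; rewrite ?z ?z' ?z''.
Qed.

Lemma dual3_linear k b b' :
  dual3 (fun i j l => k * b i j l + b' i j l) = k *: dual3 b + dual3 b'.
Proof.
by apply/colP; elim/ord4P; rewrite !mxE !inordK //=; ring.
Qed.

Lemma dual3_sum I (r : seq I) (F : I -> 'I_4 -> 'I_4 -> 'I_4 -> R) :
  dual3 (fun i j k => \sum_(x <- r) F x i j k) = \sum_(x <- r) dual3 (F x).
Proof.
apply/colP; elim/ord4P; rewrite mxE summxE inordK //= ?raddf_sum /=;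
  by apply: eq_bigr => x _; rewrite mxE inordK.
Qed.

Lemma dual3Z k b : dual3 (fun i j l => k * b i j l) = k *: dual3 b.
Proof. by apply/colP; elim/ord4P; rewrite !mxE !inordK //=; ring. Qed.

Lemma hodge0_Sig0 m : hodge0 (Sig0 m) = Sig0 m :> 'M[R]_4.
Proof.
have := selfdual0E (Sig0_skew m : (Sig0 m)^T = - Sig0 m :> 'M[R]_4).
rewrite (bigD1 m) //= ip0_Sig eqxx scale1r big1 ?addr0; last first.
  by move=> k /negPf km; rewrite ip0_Sig eq_sym km scale0r.
move=> /(congr1 ( *:%R 2)); rewrite scalerA divff // scale1r scaler_nat mulr2n.
by move=> /addrI.
Qed.

End Dual3.

Section Ad_inverse.
Context {R : realType}.
Variables (g th : 'M[R]_4).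
Hypotheses (gE : g = th^T *m th) (dth : 0 < \det th).
Implicit Types (H N : 'M[R]_3) (b : 'I_4 -> 'I_4 -> 'I_4 -> R).

(** The components of [dual3] in the frame dual to th; the determinant is the
    ratio of the two volume forms. *)
Definition frame_dual3 b : 'cV[R]_4 := (\det th)^-1 *: (th *m dual3 b).

Lemma frame_dual3_wedge12 (x : 'cV[R]_4) W : W^T = - W ->
  frame_dual3 (wedge12 (x^T *m th) (form_of th W)) = hodge0 W *m x.
Proof.
move=> wT; rewrite /frame_dual3 dual3_wedge12 ?form_of_tr ?wT; last first.
  by rewrite /form_of mulmxN mulNmx.
rewrite trmx_mul trmxK !mulmxA hodge0_congr -scalemxAl scalerA mulVf ?scale1r //.
exact: lt0r_neq0.
Qed.

Lemma frame_dual3_inj b : alt3 b -> frame_dual3 b = 0 -> forall i j k, b i j k = 0.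
Proof.
move=> ba; rewrite /frame_dual3 => /eqP; rewrite scaler_eq0 invr_eq0 gt_eqF //= => /eqP h.
apply: dual3_inj => //.
by apply: (can_inj (mulKmx (frame_unit dth))); rewrite h mulmx0.
Qed.

Lemma frame_dual3_sum I (r : seq I) (F : I -> 'I_4 -> 'I_4 -> 'I_4 -> R) :
  frame_dual3 (fun i j k => \sum_(x <- r) F x i j k) = \sum_(x <- r) frame_dual3 (F x).
Proof. by rewrite /frame_dual3 dual3_sum mulmx_sumr scaler_sumr. Qed.

Lemma frame_dual3Z k b : frame_dual3 (fun i j l => k * b i j l) = k *: frame_dual3 b.
Proof. by rewrite /frame_dual3 dual3Z -scalemxAr !scalerA mulrC. Qed.

Lemma frame_dual3_linear k b b' :
  frame_dual3 (fun i j l => k * b i j l + b' i j l) = k *: frame_dual3 b + frame_dual3 b'.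
Proof. by rewrite /frame_dual3 dual3_linear mulmxDr scalerDr -scalemxAr !scalerA mulrC. Qed.

(** The 2-form that is the coefficient of [SigF th m] in B_h, when H is the
    matrix of h. *)
Definition Bcoef H (m : 'I_3) : 'M[R]_4 := \sum_n H n m *: SigF th n.

Lemma Bcoef_form_of H m : Bcoef H m = form_of th (\sum_n H n m *: Sig0 n).
Proof. exact: comb_form_of. Qed.

Lemma sum_skew (s : 'I_3 -> R) : (\sum_n s n *: Sig0 n)^T = - (\sum_n s n *: Sig0 n) :> 'M[R]_4.
Proof.
by rewrite raddf_sum -sumrN; apply: eq_bigr => n _; rewrite /= linearZ /= Sig0_skew scalerN.
Qed.

Lemma Bcoef_skew H m : (Bcoef H m)^T = - Bcoef H m.
Proof. by rewrite Bcoef_form_of form_of_tr sum_skew /form_of mulmxN mulNmx. Qed.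

Lemma hodge0_sum (s : 'I_3 -> R) : hodge0 (\sum_n s n *: Sig0 n) = \sum_n s n *: Sig0 n :> 'M[R]_4.
Proof.
apply/matrixP => i j; rewrite mxE.
under eq_bigr do under eq_bigr do rewrite summxE mulr_sumr.
under eq_bigr do rewrite exchange_big /=.
rewrite exchange_big mulr_sumr summxE /=; apply: eq_bigr => n _.
rewrite mxE -[in RHS](hodge0_Sig0 n) mxE mulrCA; congr (_ * _).
rewrite mulr_sumr; apply: eq_bigr => k _; rewrite mulr_sumr; apply: eq_bigr => l _.
by rewrite mxE; ring.
Qed.

Lemma frame_dual3_Bcoef x H m :
  frame_dual3 (wedge12 (x^T *m th) (Bcoef H m)) = \sum_n H n m *: (Sig0 n *m x).
Proof.
rewrite Bcoef_form_of frame_dual3_wedge12 ?sum_skew // hodge0_sum mulmx_suml.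
by apply: eq_bigr => n _; rewrite scalemxAl.
Qed.

(** The section of T^*M (x) Lambda^+ whose coefficient of [SigF th m] is the
    covector with components al m in th. *)
Definition cov_comb (al : 'I_3 -> 'cV[R]_4) (i : 'I_4) : 'M[R]_4 :=
  comb th (fun m => ((al m)^T *m th) 0 i).

Lemma Btensor_Bcoef (h : End_plus g) i j :
  Btensor h i j = comb th (fun m => Bcoef (mat th h) m i j).
Proof.
rewrite (Btensor_mat gE dth) exchange_big; apply: eq_bigr => m _ /=.
rewrite /Bcoef summxE scaler_suml; apply: eq_bigr => n _; congr (_ *: _).
by rewrite [RHS]mxE.
Qed.

Lemma bracket12_frame al H i j k (B := fun j k => comb th (fun m => Bcoef H m j k)) :
  bracket12 g (cov_comb al) B i j k = comb th (fun m =>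
    \sum_p \sum_l epsilon3 p l m * wedge12 ((al p)^T *m th) (Bcoef H l) i j k).
Proof.
rewrite /bracket12 /cov_comb /B !(cross_comb gE dth) /comb -!big_split /=.
apply: eq_bigr => m _; rewrite -!scalerDl; congr (_ *: _).
rewrite /cross3 -!big_split /=; apply: eq_bigr => p _.
rewrite -!big_split /=; apply: eq_bigr => l _.
by rewrite /wedge12; ring.
Qed.

Lemma frame_dual3_bracket12 al H m :
  frame_dual3 (fun i j k => \sum_p \sum_l epsilon3 p l m * wedge12 ((al p)^T *m th) (Bcoef H l) i j k)
  = ad_mx H al m.
Proof.
rewrite frame_dual3_sum; apply: eq_bigr => p _; rewrite frame_dual3_sum; apply: eq_bigr => l _.
rewrite frame_dual3Z frame_dual3_Bcoef scaler_sumr; apply: eq_bigr => n _.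
by rewrite scalerA.
Qed.

Lemma alt3_scale k b b' : alt3 b -> alt3 b' -> alt3 (fun i j l => k * b i j l + b' i j l).
Proof.
move=> [b1 b2] [c1 c2]; split=> i j l; last by rewrite (b2 i j l) (c2 i j l).
by rewrite (b1 i j l) (c1 i j l); ring.
Qed.

Lemma alt3_sum I (r : seq I) (F : I -> 'I_4 -> 'I_4 -> 'I_4 -> R) :
  (forall x, alt3 (F x)) -> alt3 (fun i j k => \sum_(x <- r) F x i j k).
Proof.
move=> FA; split=> i j k; rewrite -?sumrN; apply: eq_bigr => x _;
  have [h1 h2] := FA x; first exact: h1.
exact: h2.
Qed.

Lemma alt3Z k b : alt3 b -> alt3 (fun i j l => k * b i j l).
Proof.
by move=> [b1 b2]; split=> i j l; rewrite ?(b2 i j l) // (b1 i j l) mulrN.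
Qed.

(** Contraction with the volume form is injective on 3-forms and carries
    [a, B_h] to [ad_mx], which [ad_mx_inv] inverts on both sides. *)
Lemma ad_inv_frame H (be : 'I_3 -> 'I_4 -> 'I_4 -> 'I_4 -> R) :
  \det H != 0 -> (forall m, alt3 (be m)) ->
  ad_inv g (fun j k => comb th (fun m => Bcoef H m j k))
    (fun i j k => comb th (fun m => be m i j k))
  = cov_comb (ad_mx_inv H (fun m => frame_dual3 (be m))).
Proof.
move=> dH beA; rewrite /ad_inv; apply: xget_unique.
  split=> [i|i j k]; first exact: comb_LambdaPlus.
  rewrite bracket12_frame; apply: eq_bigr => m _; congr (_ *: _).
  apply/eqP; rewrite -subr_eq0; apply/eqP; set S := \sum_p _.
  have -> : S - be m i j k = -1 * be m i j k + S by ring.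
  rewrite /S {S}; move: i j k; apply: frame_dual3_inj.
    apply: alt3_scale => //; apply: alt3_sum => p; apply: alt3_sum => l.
    exact/alt3Z/wedge12_alt/Bcoef_skew.
  rewrite frame_dual3_linear frame_dual3_bracket12 ad_mx_invK // scaleN1r addrC subrr //.
move=> a [aL ab].
pose al m : 'cV[R]_4 := ((\row_i ip2 g (a i) (SigF th m)) *m invmx th)^T.
have aE : a = cov_comb al.
  apply/funext => i; have /(LambdaPlusP gE dth) {1}-> := aL i.
  apply: eq_bigr => m _; congr (_ *: _).
  by rewrite trmxK -mulmxA mulVmx ?frame_unit // mulmx1 mxE.
rewrite aE; congr cov_comb; rewrite -[LHS](ad_mxK al dH); congr ad_mx_inv.
apply/funext => m; rewrite -frame_dual3_bracket12; congr frame_dual3.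
apply/funext => i; apply/funext => j; apply/funext => k.
by have := ab i j k; rewrite aE bracket12_frame => /(comb_inj gE dth) ->.
Qed.

(** The components of a covector in the coframe th. *)
Definition covec (xi : 'rV[R]_4) : 'cV[R]_4 := (xi *m invmx th)^T.

Lemma covecK xi : (covec xi)^T *m th = xi.
Proof. by rewrite trmxK -mulmxA mulVmx ?mulmx1 ?frame_unit. Qed.

Lemma norm2_covec xi : norm2_cov g xi = ((covec xi)^T *m covec xi) 0 0.
Proof.
by rewrite /norm2_cov (frame_invg gE dth) trmxK /covec trmx_mul !mulmxA.
Qed.

(** The 3-form xi /\ B_eta, after contraction with the volume form. *)
Definition symbol_dual N (k : 'cV[R]_4) (m : 'I_3) : 'cV[R]_4 :=
  \sum_n N n m *: (Sig0 n *m k).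

(** The self-dual part of xi /\ a, as an endomorphism of Lambda^+. *)
Definition wedge_plus (k : 'cV[R]_4) (al : 'I_3 -> 'cV[R]_4) : 'M[R]_3 :=
  \matrix_(n, m) (k^T *m Sig0 n *m al m) 0 0.

Lemma ip0_wedge (k x : 'cV[R]_4) n :
  ip0 (k *m x^T - x *m k^T) (Sig0 n) = (k^T *m Sig0 n *m x) 0 0.
Proof.
rewrite /ip0 Sig0_skew mulmxN mulmxBl opprB mxtraceD raddfN /=.
rewrite -!mulmxA mxtrace_mulC [X in _ - X]mxtrace_mulC !trace_mx11 -!mulmxA.
have -> : (x^T *m (Sig0 n *m k)) 0 0 = - (k^T *m (Sig0 n *m x)) 0 0.
  rewrite -[LHS]trace_mx11 -mxtrace_tr trace_mx11 !trmx_mul trmxK Sig0_skew.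
  by rewrite mulmxN mulNmx mxE mulmxA.
by field.
Qed.

Lemma form_of_outer (u v : 'cV[R]_4) :
  form_of th (u *m v^T) = (u^T *m th)^T *m (v^T *m th).
Proof. by rewrite /form_of trmx_mul trmxK !mulmxA. Qed.

Lemma wedge_form_of (xi : 'rV[R]_4) (al : 'I_3 -> 'cV[R]_4) m :
  \matrix_(i, j) (xi 0 i * ((al m)^T *m th) 0 j - xi 0 j * ((al m)^T *m th) 0 i)
  = form_of th (covec xi *m (al m)^T - al m *m (covec xi)^T).
Proof.
rewrite linearB /= !form_of_outer covecK; move: ((al m)^T *m th) => r.
by apply/matrixP => i j; rewrite !mxE !big_ord1 !mxE; ring.
Qed.

Lemma wedge_plus_ip2 (xi : 'rV[R]_4) (al : 'I_3 -> 'cV[R]_4) n m :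
  ip2 g (\matrix_(i, j) (xi 0 i * ((al m)^T *m th) 0 j - xi 0 j * ((al m)^T *m th) 0 i)) (SigF th n)
  = wedge_plus (covec xi) al n m.
Proof. by rewrite wedge_form_of SigF_form_of (ip2_form_of gE dth) ip0_wedge [RHS]mxE. Qed.

Lemma endo_of_wedge (xi : 'rV[R]_4) al :
  mat th (endo_of g (selfdual_part g (cov_wedge1 xi (cov_comb al))))
  = wedge_plus (covec xi) al.
Proof.
pose W m : 'M[R]_4 :=
  \matrix_(i, j) (xi 0 i * ((al m)^T *m th) 0 j - xi 0 j * ((al m)^T *m th) 0 i).
have WE : cov_wedge1 xi (cov_comb al) = fun i j => \sum_m W m i j *: SigF th m.
  apply/funext => i; apply/funext => j; rewrite /cov_wedge1 /cov_comb /comb.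
  rewrite !scaler_sumr -sumrB; apply: eq_bigr => m _.
  by rewrite !scalerA -scalerBl [W m i j]mxE.
rewrite WE (endo_of_mat gE dth) => [|m]; last by apply/matrixP => i j; rewrite !mxE opprB.
by apply/matrixP => n m; rewrite [LHS]mxE wedge_plus_ip2.
Qed.

Lemma symbol_mat_wedge (h eta : End_plus g) xi : \det (mat th h) != 0 ->
  mat th (symbol_formula h xi eta)
  = wedge_plus (covec xi) (ad_mx_inv (mat th h) (symbol_dual (mat th eta) (covec xi)))
    *m invmx (mat th h).
Proof.
move=> dH; rewrite /symbol_formula (mat_comp gE dth) (mat_inv gE dth) ?unitmxE ?unitfE //.
congr (_ *m _).
have -> : Btensor h = fun j k => comb th (fun m => Bcoef (mat th h) m j k).
  by apply/funext => j; apply/funext => k; rewrite Btensor_Bcoef.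
have -> : cov_wedge2 xi (Btensor eta) = fun i j k =>
    comb th (fun m => wedge12 xi (Bcoef (mat th eta) m) i j k).
  do 3! apply/funext => ?; rewrite /cov_wedge2 !Btensor_Bcoef /comb !scaler_sumr -!big_split.
  by apply: eq_bigr => m _ /=; rewrite !scalerA -!scalerDl.
rewrite ad_inv_frame // => [|m]; last exact/wedge12_alt/Bcoef_skew.
rewrite endo_of_wedge; congr (wedge_plus _ (ad_mx_inv _ _)); apply/funext => m.
by rewrite -{1}(covecK xi) frame_dual3_Bcoef.
Qed.

Lemma quad_Sig0 (k : 'cV[R]_4) n : (k^T *m Sig0 n *m k) 0 0 = 0.
Proof.
have : (k^T *m Sig0 n *m k) 0 0 = - (k^T *m Sig0 n *m k) 0 0.
  rewrite -[LHS]trace_mx11 -mxtrace_tr trace_mx11 !trmx_mul trmxK Sig0_skew.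
  by rewrite mulNmx mulmxN mxE mulmxA.
by move/eqP; rewrite -subr_eq0 opprK -mulr2n mulrn_eq0 => /eqP.
Qed.

Lemma quad_Sig0_2 (k : 'cV[R]_4) n r :
  (k^T *m Sig0 n *m (Sig0 r *m k)) 0 0 = - 2^-1 * (n == r)%:R * (k^T *m k) 0 0.
Proof.
rewrite mulmxA -(mulmxA k^T) Sig0_mul mulmxDr mulmxDl mul_mx_scalar -scalemxAl.
rewrite mxE mxE [X in _ + X](_ : _ = 0) ?addr0 ?mulNr //.
rewrite -scalemxAr -scalemxAl mxE mulmx_sumr mulmx_suml summxE big1 ?mulr0 // => s _.
by rewrite -scalemxAr -scalemxAl mxE quad_Sig0 mulr0.
Qed.

(** In the quaternion algebra only the scalar part of a product of three units
    contributes, the forms [Sig0 s] being antisymmetric. *)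
Lemma quad_Sig0_3 (k : 'cV[R]_4) n l r :
  (k^T *m Sig0 n *m (Sig0 l *m (Sig0 r *m k))) 0 0
  = - 2^-1 * isqrt2 * epsilon3 n l r * (k^T *m k) 0 0.
Proof.
rewrite (mulmxA (k^T *m Sig0 n)) -(mulmxA k^T) Sig0_mul mulmxDr mulmxDl mul_mx_scalar -scalemxAl.
rewrite mxE mxE mulmxA quad_Sig0 mulr0 add0r.
rewrite -scalemxAr -scalemxAl mxE mulmx_sumr mulmx_suml summxE (bigD1 r) //=.
rewrite big1 ?addr0 => [|s /negPf sr]; rewrite -scalemxAr -scalemxAl mxE quad_Sig0_2 ?sr ?eqxx.
  by rewrite mulr1; ring.
by rewrite mulr0 mul0r mulr0.
Qed.

Lemma epsilon3_contract (p q n r : 'I_3) :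
  \sum_l epsilon3 p l q * epsilon3 n l r
  = (p == n)%:R * (q == r)%:R - (p == r)%:R * (q == n)%:R :> R.
Proof.
under eq_bigr do rewrite !epsilon3E.
by rewrite big3; move: p q n r; do 4! elim/ord3P; rewrite !inordK ?inord_eq3 //=; ring.
Qed.

(** All products of three [Sig0] between k and k are multiples of |k|^2, and the
    contraction of two permutation symbols leaves a trace and a transpose. *)
Lemma wedge_plus_ad_mx1 (k : 'cV[R]_4) (Y : 'M[R]_3)
    (w := fun q => \sum_r Y r q *: (Sig0 r *m k)) :
  wedge_plus k (fun q => ad_mx1 w q + isqrt2 *: w q)
  = (2^-1 * isqrt2 * (k^T *m k) 0 0) *: ((\tr Y)%:M - Y - Y^T).
Proof.
apply/matrixP => n q; rewrite mxE mulmxDr mxE.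
have -> : (k^T *m Sig0 n *m ad_mx1 w q) 0 0
    = - 2^-1 * isqrt2 * (k^T *m k) 0 0 * \sum_p \sum_r
       Y r p * (\sum_l epsilon3 p l q * epsilon3 n l r).
  rewrite /ad_mx1 mulmx_sumr summxE mulr_sumr; apply: eq_bigr => p _.
  rewrite mulmx_sumr summxE mulr_sumr.
  transitivity (\sum_r \sum_l - 2^-1 * isqrt2 * (k^T *m k) 0 0 * (Y r p * (epsilon3 p l q * epsilon3 n l r))).
    rewrite exchange_big /=; apply: eq_bigr => l _.
    rewrite -scalemxAr mxE /w mulmx_sumr mulmx_sumr summxE mulr_sumr; apply: eq_bigr => r _.
    by rewrite -!scalemxAr mxE quad_Sig0_3; ring.
  by apply: eq_bigr => r _; rewrite -mulr_sumr -mulr_sumr.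
have -> : (k^T *m Sig0 n *m (isqrt2 *: w q)) 0 0 = - 2^-1 * isqrt2 * (k^T *m k) 0 0 * Y n q.
  rewrite -scalemxAr mxE /w mulmx_sumr summxE (bigD1 n) //= -scalemxAr mxE quad_Sig0_2 eqxx.
  rewrite big1 ?addr0 => [|r /negPf rn]; first by rewrite mulr1; ring.
  by rewrite -scalemxAr mxE quad_Sig0_2 eq_sym rn mulr0 mul0r mulr0.
under eq_bigr do under eq_bigr do rewrite epsilon3_contract.
have -> : \sum_p \sum_r Y r p * ((p == n)%:R * (q == r)%:R - (p == r)%:R * (q == n)%:R)
    = Y q n - \tr Y * (q == n)%:R.
  under eq_bigr do (under eq_bigr do rewrite mulrBr; rewrite sumrB); rewrite sumrB; congr (_ - _).
    rewrite (bigD1 n) //= (bigD1 q) //= !eqxx !mulr1 !big1 ?addr0 //.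
      by move=> p /negPf pn; rewrite big1 // => r _; rewrite pn mul0r mulr0.
    by move=> r /negPf rq; rewrite eq_sym rq !mulr0.
  rewrite /mxtrace mulr_suml; apply: eq_bigr => p _.
  rewrite (bigD1 p) //= eqxx mul1r big1 ?addr0 // => r /negPf rp.
  by rewrite eq_sym rp mul0r mulr0.
by rewrite !mxE (eq_sym n) -[_ *+ (q == n)]mulr_natr; ring.
Qed.

(** The factor H that ends the formula of [ad_mx_inv] cancels against the final
    composition with h^-1. *)
Lemma symbol_mat (h eta : End_plus g) xi (H := mat th h) (Y := mat th eta *m H^T) :
  \det H != 0 ->
  mat th (symbol_formula h xi eta)
  = (norm2_cov g xi * isqrt2 / 2 / \det H) *: ((\tr Y)%:M - Y - Y^T).
Proof.
move=> dH; rewrite symbol_mat_wedge // -/H.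
have Hu : H \in unitmx by rewrite unitmxE unitfE.
set k := covec xi.
have wE : coef_mul H (symbol_dual (mat th eta) k) = fun q => \sum_r Y r q *: (Sig0 r *m k).
  apply/funext => q; rewrite /coef_mul /symbol_dual.
  under eq_bigr do rewrite scaler_sumr.
  rewrite exchange_big; apply: eq_bigr => r _ /=; rewrite [Y r q]mxE scaler_suml.
  by apply: eq_bigr => m _; rewrite scalerA [H^T _ _]mxE mulrC.
have -> : wedge_plus k (ad_mx_inv H (symbol_dual (mat th eta) k))
   = (\det H)^-1 *: (wedge_plus k (fun q => ad_mx1 (fun q => \sum_r Y r q *: (Sig0 r *m k)) q
         + isqrt2 *: \sum_r Y r q *: (Sig0 r *m k)) *m H).
  rewrite /ad_mx_inv wE; set z := fun q => _.
  apply/matrixP => n m; rewrite mxE coef_mulZ -scalemxAr mxE [RHS]mxE; congr (_ * _).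
  rewrite /coef_mul mulmx_sumr summxE mxE; apply: eq_bigr => q _.
  by rewrite -scalemxAr mxE [H^T m q]mxE mulrC [wedge_plus _ _ _ _]mxE.
rewrite -scalemxAl mulmxK // wedge_plus_ad_mx1 scalerA norm2_covec; congr (_ *: _).
by rewrite mulrC; ring.
Qed.

End Ad_inverse.

(** * Bijectivity of the symbol *)

Section Lyapunov.
Context {R : realType} (H : 'M[R]_3).
Hypotheses (HT : H^T = H)
  (Hpos : forall v : 'rV[R]_3, v != 0 -> 0 < (v *m H *m v^T) 0 0).

(** The symbol, up to a scalar factor, on symmetric matrices. *)
Definition lyap (N : 'M[R]_3) : 'M[R]_3 := (\tr (N *m H))%:M - H *m N - N *m H.

Lemma lyap_is_linear : linear lyap.
Proof.
move=> a u v; rewrite /lyap mulmxDl mulmxDr -!scalemxAl -!scalemxAr.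
rewrite mxtraceD mxtraceZ; move: (u *m H) (v *m H) (H *m u) (H *m v) => x y z t.
by apply/matrixP => i j; rewrite !mxE; case: (i == j); rewrite ?mulr1n ?mulr0n; ring.
Qed.
HB.instance Definition _ :=
  GRing.isLinear.Build R 'M[R]_3 'M[R]_3 *:%R lyap lyap_is_linear.

Lemma lyap_tr N : (lyap N)^T = lyap N^T.
Proof.
rewrite /lyap !linearB /= tr_scalar_mx !trmx_mul HT addrAC.
by rewrite -[in RHS]mxtrace_tr trmx_mul trmxK HT mxtrace_mulC.
Qed.

Lemma mxtrace_form_gt0 (N : 'M[R]_3) : N != 0 -> 0 < \tr (N *m H *m N^T).
Proof.
move=> N0; have rE i : (N *m H *m N^T) i i = (row i N *m H *m (row i N)^T) 0 0.
  by rewrite -!row_mul tr_row !mxE; apply: eq_bigr => j _; rewrite !mxE.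
have ge i : 0 <= (N *m H *m N^T) i i.
  rewrite rE; have [->|/Hpos/ltW //] := eqVneq (row i N) 0.
  by rewrite !mul0mx mxE.
have [i ri] : exists i, row i N != 0.
  apply/existsP; apply: contraR N0; rewrite negb_exists => /forallP h.
  by apply/eqP/row_matrixP => i; rewrite row0; apply/eqP; rewrite -[_ == _]negbK h.
rewrite /mxtrace (bigD1 i) //= ltr_pwDl ?sumr_ge0 //.
by rewrite rE Hpos.
Qed.

Lemma mxtrace_form_ge0 (N : 'M[R]_3) : 0 <= \tr (N *m H *m N^T).
Proof.
have [->|/mxtrace_form_gt0/ltW //] := eqVneq N 0.
by rewrite !mul0mx mxtrace0.
Qed.

(** If N is in the kernel, the trace of its image gives tr (N H) = 0, so that N
    and H anticommute and two nonnegative traces are opposite. *)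
Lemma lyap_inj N : lyap N = 0 -> N = 0.
Proof.
move=> N0.
(* The image has trace 3 t - 2 t = t, where t is the trace of N H. *)
have t0 : \tr (N *m H) = 0.
  have := congr1 mxtrace N0; rewrite /lyap !raddfB /= mxtrace_scalar mxtrace0.
  by rewrite (mxtrace_mulC H) => h; lra.
apply/eqP; apply: contraT => Nn0.
have e : H *m N = - (N *m H).
  by move: N0; rewrite /lyap t0 raddf0 sub0r => /eqP; rewrite subr_eq0 => /eqP <-; rewrite opprK.
have p1 := mxtrace_form_gt0 Nn0; have p2 := mxtrace_form_ge0 N^T.
have := p2; rewrite trmxK -mulmxA e mulmxN raddfN /= mxtrace_mulC.
by rewrite oppr_ge0 leNgt p1.
Qed.

Lemma lyap_surj Y : exists N, lyap N = Y.
Proof.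
pose L : 'End('M[R]_3) := linfun lyap.
have LE N : L N = lyap N by rewrite /L (lfunE lyap).
have k0 : lker L == 0%VS.
  apply/lker0P => u v; rewrite !LE => /eqP; rewrite -subr_eq0 -linearB => /eqP /lyap_inj /eqP.
  by rewrite subr_eq0 => /eqP.
by exists ((L^-1)%VF Y); rewrite -LE lker0_lfunVK.
Qed.

(** Transposition commutes with [lyap], so that a preimage of a symmetric matrix
    is symmetric by injectivity. *)
Lemma lyap_sym_surj Y : Y^T = Y -> exists2 N, N^T = N & lyap N = Y.
Proof.
move=> YT; have [N NY] := lyap_surj Y; exists N => //.
apply/eqP; rewrite -subr_eq0; apply/eqP/lyap_inj.
by rewrite linearB /= -lyap_tr NY YT subrr.
Qed.

Lemma posdef_det : \det H != 0.
Proof.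
rewrite -unitfE -unitmxE -row_free_unit -kermx_eq0; apply/eqP/row_matrixP => i.
rewrite row0; apply/eqP; apply: contraT => /Hpos; rewrite -row_mul mulmx_ker.
by rewrite row0 mul0mx mxE ltxx.
Qed.
End Lyapunov.

Section Symbol.
Context {R : realType} (g th : 'M[R]_4).
Hypotheses (gE : g = th^T *m th) (dth : 0 < \det th).
Implicit Types (h eta f : End_plus g).
Opaque symbol_formula.

Lemma symbol_linear h xi : \det (mat th h) != 0 -> linear (symbol_formula h xi).
Proof.
move=> dH a u v; apply: (mat_inj gE dth).
have e eta := symbol_mat gE dth eta xi dH.
apply: (etrans (e _)); apply: etrans (esym (mat_linear th a _ _)).
apply: etrans (esym (congr2 (fun x y => a *: x + y) (e u) (e v))).
rewrite mat_linear.
rewrite mulmxDl -scalemxAl mxtraceD mxtraceZ.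
move: (_ *m _^T) (_ *m _^T) => x y; move: (norm2_cov g xi * isqrt2 / 2 / _) => c.
by apply/matrixP => i j; rewrite !mxE; case: (i == j); rewrite ?mulr1n ?mulr0n; ring.
Qed.

Lemma norm2_cov_gt0 xi : xi != 0 -> 0 < norm2_cov g xi.
Proof.
move=> xi0; rewrite (norm2_covec gE dth) mxE.
have k0 : covec th xi != 0.
  apply: contra xi0 => /eqP k0; rewrite -(covecK dth xi) k0 trmx0 mul0mx //.
have [i ki] : exists i, covec th xi i 0 != 0.
  apply/existsP; apply: contraR k0; rewrite negb_exists => /forallP h.
  by apply/eqP/colP => i; have := h i; rewrite negbK => /eqP ->; rewrite mxE.
have e j : ((covec th xi)^T) 0 j * covec th xi j 0 = covec th xi j 0 ^+ 2.
  by rewrite mxE expr2.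
rewrite (bigD1 i) //= ltr_pwDl ?sumr_ge0 // => [|j _]; rewrite e ?sqr_ge0 //.
by rewrite lt_neqAle eq_sym sqrf_eq0 ki sqr_ge0.
Qed.

Lemma symbol_lyap h eta xi : selfadjoint h -> selfadjoint eta -> \det (mat th h) != 0 ->
  mat th (symbol_formula h xi eta)
  = (norm2_cov g xi * isqrt2 / 2 / \det (mat th h)) *: lyap (mat th h) (mat th eta).
Proof.
move=> /(selfadjoint_mat gE dth) HT /(selfadjoint_mat gE dth) NT dH.
rewrite (symbol_mat gE dth) // HT /lyap trmx_mul HT NT.
by congr (_ *: _); rewrite addrAC.
Qed.

Lemma symbol_bij h xi : xi != 0 -> selfadjoint h -> posdef h ->
  set_bij (@selfadjoint R g) (@selfadjoint R g) (symbol_formula h xi).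
Proof.
move=> xi0 hs hp; have Hpos := posdef_mat gE dth hp.
have HT := (selfadjoint_mat gE dth h).1 hs.
have dH := posdef_det Hpos.
set c := norm2_cov g xi * isqrt2 / 2 / \det (mat th h).
have c0 : c != 0.
  by rewrite /c !mulf_neq0 ?invr_eq0 ?isqrt2_neq0 // gt_eqF // norm2_cov_gt0.
split=> [eta etas|eta1 eta2 /set_mem s1 /set_mem s2 e|eta etas] /=.
- apply/(selfadjoint_mat gE dth); rewrite (symbol_lyap xi hs etas dH) linearZ /= lyap_tr //.
  by rewrite ((selfadjoint_mat gE dth eta).1 etas).
- apply: (mat_inj gE dth); apply/eqP; rewrite -subr_eq0; apply/eqP.
  apply: (lyap_inj Hpos); rewrite linearB /=.
  have := etrans (esym (symbol_lyap xi hs s1 dH)) (etrans (congr1 (mat th) e) (symbol_lyap xi hs s2 dH)).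
  by move=> /(scalerI c0) ->; rewrite subrr.
- have := (selfadjoint_mat gE dth eta).1 etas => YT.
  have [|N NT NY] := lyap_sym_surj HT Hpos (Y := c^-1 *: mat th eta).
    by rewrite linearZ /= YT.
  have Ns : selfadjoint (mkEnd g th N).
    by apply/(selfadjoint_mat gE dth); rewrite (mkEndK gE dth).
  exists (mkEnd g th N) => //; apply: (mat_inj gE dth).
  by apply: (etrans (symbol_lyap xi hs Ns dH)); rewrite (mkEndK gE dth) NY scalerA divff // scale1r.
Qed.

Lemma selfadjoint_id : selfadjoint (endo_id g).
Proof. by move=> v w; rewrite !id_lfunE. Qed.

Lemma trace_plus_mat f : trace_plus f = \tr (mat (coframe g) f).
Proof.
rewrite /trace_plus /mxtrace; apply: eq_bigr => i _; rewrite mxE /ip_plus.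
by rewrite SigmaE !(inplusK (Sigma_LambdaPlus gE dth i)).
Qed.

Lemma symbol_id xi eta eta0 eta1 : selfadjoint eta ->
  eta = eta0 + eta1 -> trace_plus eta0 = 0 ->
  3%:R *: eta1 = trace_plus eta *: endo_id g ->
  symbol_formula (endo_id g) xi eta
  = (norm2_cov g xi / (2 * Num.sqrt 2)) *: (eta1 - 2 *: eta0).
Proof.
have [c1 c2] := coframeP gE dth; set c := coframe g in c1 c2 *.
move=> es e t0 e1; have idE := mat_id c1 c2.
apply: (mat_inj c1 c2).
have dH : \det (mat c (endo_id g)) != 0 by rewrite idE det1 oner_neq0.
rewrite (symbol_mat c1 c2) // idE det1 trmx1 mulmx1 divr1.
rewrite ((selfadjoint_mat c1 c2 eta).1 es).
have -> : norm2_cov g xi / (2 * Num.sqrt 2) = norm2_cov g xi * isqrt2 / 2.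
  by rewrite invfM mulrA mulrAC.
have mZ a f : mat c (a *: f) = a *: mat c f by rewrite linearZ.
have mD f f' : mat c (f + f') = mat c f + mat c f' by rewrite linearD.
have mN f : mat c (- f) = - mat c f by rewrite linearN.
rewrite mZ mD mN mZ; congr (_ *: _).
have := congr1 (mat c) e1; rewrite !mZ idE trace_plus_mat -/c scalemx1 => <-.
by rewrite e mD; apply/matrixP => i j; rewrite !mxE; ring.
Qed.

End Symbol.

(** * Smooth functions and smooth coframes *)

Section Smooth.
Context {R : realType} (V : set 'rV[R]_4) (Vo : open V).

Lemma Vnear (y : 'rV[R]_4) : V y -> \forall z \near y, V z.
Proof. by move=> Vy; apply: open_nbhs_nbhs; split. Qed.

Lemma continuous_eq_on (W : normedModType R) (f g : 'rV[R]_4 -> W) y :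
  (\near y, f y = g y) -> {for y, continuous f} -> {for y, continuous g}.
Proof.
move=> fg cf; have e : f y = g y := nbhs_singleton fg.
rewrite /prop_for /continuous_at -e; exact: (cvg_trans (near_eq_cvg fg) cf).
Qed.

Lemma Ck_eq (W : normedModType R) n (f g : 'rV[R]_4 -> W) :
  (forall y, V y -> f y = g y) -> Ck n V f -> Ck n V g.
Proof.
move=> fg; have nfg y : V y -> \near y, f y = g y.
  by move=> Vy; apply: filterS (Vnear Vy) => z; exact: fg.
elim: n f g fg nfg => [|n IH] f g fg nfg [cf df].
  by split=> // y Vy; apply: continuous_eq_on (nfg _ Vy) (cf _ Vy).
split=> [y Vy|i]; first by apply: continuous_eq_on (nfg _ Vy) (cf _ Vy).
have [d1 d2] := df i; split=> [y Vy|]; first exact: near_eq_derivable (nfg _ Vy) (d1 _ Vy).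
have e y : V y -> pd i f y = pd i g y by move=> Vy; exact: near_eq_derive (nfg _ Vy).
apply: (IH _ _ e) => // y Vy.
by apply: filterS (Vnear Vy) => z; exact: e.
Qed.

Lemma CkW (W : normedModType R) n (f : 'rV[R]_4 -> W) : Ck n.+1 V f -> Ck n V f.
Proof.
elim: n f => [|n IH] f [cf df]; first by split.
by split=> // i; have [d1 d2] := df i; split=> //; exact: IH.
Qed.

Lemma CkS (W : normedModType R) n (f : 'rV[R]_4 -> W) :
  (forall y, V y -> {for y, continuous f}) ->
  (forall i y, V y -> derivable f y (delta_mx 0 i)) ->
  (forall i, Ck n V (pd i f)) -> Ck n.+1 V f.
Proof. by move=> h1 h2 h3; split=> // i; split=> // y; exact: h2. Qed.

Implicit Types f g : 'rV[R]_4 -> R.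

Lemma Ck_cst n (c : R) : Ck n V (fun=> c : R).
Proof.
elim: n c => [|n IH] c; first by split=> // y _; exact: cst_continuous.
apply: CkS => [y _|i y _|i]; [exact: cst_continuous|exact: derivable_cst|].
by apply: Ck_eq (IH 0) => y _; rewrite /pd derive_cst.
Qed.

Lemma CkD n f g : Ck n V f -> Ck n V g -> Ck n V (fun y => f y + g y).
Proof.
elim: n f g => [|n IH] f g [cf df] [cg dg].
  by split=> // y Vy; exact: (cvgD (cf _ Vy) (cg _ Vy)).
apply: CkS => [y Vy|i y Vy|i].
- by exact: (cvgD (cf _ Vy) (cg _ Vy)).
- by apply: derivableD; [exact: (df i).1|exact: (dg i).1].
- apply: Ck_eq (IH _ _ (df i).2 (dg i).2) => y Vy.
  by rewrite /pd -deriveD //; [exact: (df i).1|exact: (dg i).1].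
Qed.

Lemma CkM n f g : Ck n V f -> Ck n V g -> Ck n V (fun y => f y * g y).
Proof.
elim: n f g => [|n IH] f g Cf Cg.
  have [[cf _] [cg _]] := (Cf, Cg).
  by split=> // y Vy; exact: (cvgM (cf _ Vy) (cg _ Vy)).
have [[cf df] [cg dg]] := (Cf, Cg).
apply: CkS => [y Vy|i y Vy|i].
- by exact: (cvgM (cf _ Vy) (cg _ Vy)).
- by apply: derivableM; [exact: (df i).1|exact: (dg i).1].
- have := CkD (IH _ _ (CkW Cf) (dg i).2) (IH _ _ (CkW Cg) (df i).2).
  apply: Ck_eq => y Vy.
  by rewrite /pd -[RHS]/('D_(delta_mx 0 i) (f * g) y) deriveM //; [exact: (df i).1|exact: (dg i).1].
Qed.

Lemma CkZ n (c : R) f : Ck n V f -> Ck n V (fun y => c * f y).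
Proof. exact/CkM/Ck_cst. Qed.

Lemma CkN n f : Ck n V f -> Ck n V (fun y => - f y).
Proof. by move=> /(CkZ (-1)); apply: Ck_eq => y _; rewrite mulN1r. Qed.

Lemma CkV n f : (forall y, V y -> f y != 0) -> Ck n V f -> Ck n V (fun y => (f y)^-1).
Proof.
move=> f0; elim: n f f0 => [|n IH] f f0 Cf.
  by have [cf _] := Cf; split=> // y Vy; exact: (cvgV (f0 _ Vy) (cf _ Vy)).
have [cf df] := Cf.
apply: CkS => [y Vy|i y Vy|i].
- by exact: (cvgV (f0 _ Vy) (cf _ Vy)).
- by apply: derivableV; [exact: f0|exact: (df i).1].
- have Cv := IH _ f0 (CkW Cf).
  apply: Ck_eq (CkM (CkN (CkM Cv Cv)) (df i).2) => y Vy.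
  rewrite /pd deriveV; [|exact: f0|exact: (df i).1].
  by rewrite expr2 invfM.
Qed.

(** A directional derivative is an ordinary derivative along a line. *)
Lemma derive_line (W : normedModType R) (f : 'rV[R]_4 -> W) y v t :
  derivable f (y + t *: v) v ->
  is_derive t (1 : R) (fun u : R => f (y + u *: v)) ('D_v f (y + t *: v)).
Proof.
have e : (fun h : R => h^-1 *: (((fun u : R => f (y + u *: v)) \o shift t) (h *: (1:R)) - f (y + t *: v)))
   = (fun h : R => h^-1 *: ((f \o shift (y + t *: v)) (h *: v) - f (y + t *: v))).
  apply/funext => h /=; congr (_ *: (f _ - _)).
  by rewrite [h *: 1]mulr1 scalerDl addrCA.
by move=> df; split; rewrite /derivable ?/derive e.
Qed.

(** The chain rule for a scalar function restricted to a line. *)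
Lemma is_derive_sqrt_comp f y v : 0 < f y -> derivable f y v ->
  is_derive y v (fun z => Num.sqrt (f z)) ((2 * Num.sqrt (f y))^-1 * 'D_v f y).
Proof.
move=> fy df; pose phi (h : R) := f (h *: v + y).
have e0 : phi 0 = f y by rewrite /phi scale0r add0r.
have gr (F : 'rV[R]_4 -> R) : (fun h : R => h^-1 *: ((F \o shift y) (h *: v) - F y))
   = (fun h : R => h^-1 *: (((fun h => F (h *: v + y)) \o shift 0) (h *: (1:R)) - F (0 *: v + y))).
  by apply/funext => h /=; rewrite addr0 scale0r add0r [h *: 1]mulr1.
have dphi : derivable phi 0 1 := (derivable1P f y v).1 df.
have dsq : derivable (@Num.sqrt R) (phi 0) 1.
  by rewrite e0; have [] := is_derive1_sqrt fy.
have dc : derivable (@Num.sqrt R \o phi) 0 1.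
  apply: (derivable1_diffP _ _).2.
  exact: differentiable_comp ((derivable1_diffP _ _).1 dphi) ((derivable1_diffP _ _).1 dsq).
split; first exact: (derivable1P (fun z => Num.sqrt (f z)) y v).2 dc.
have -> : 'D_v (fun z => Num.sqrt (f z)) y = derive1 (@Num.sqrt R \o phi) 0.
  by rewrite derive1E /derive gr.
have hs : derive1 (@Num.sqrt R) (phi 0) = (2 * Num.sqrt (f y))^-1.
  by rewrite e0 derive1E derive_sqrt.
have hv : derive1 phi 0 = 'D_v f y by rewrite derive1E /derive gr.
exact: etrans (derive1_comp dphi dsq) (congr2 *%R hs hv).
Qed.

Lemma Ck_sqrt n f : (forall y, V y -> 0 < f y) -> Ck n V f ->
  Ck n V (fun y => Num.sqrt (f y)).
Proof.
move=> f0; elim: n f f0 => [|n IH] f f0 Cf.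
  have [cf _] := Cf; split=> // y Vy; apply: (@continuous_comp _ _ _ f Num.sqrt) => //.
    exact: cf.
  exact: sqrt_continuous.
have [cf df] := Cf.
apply: CkS => [y Vy|i y Vy|i].
- apply: (@continuous_comp _ _ _ f Num.sqrt) => //; first exact: cf.
  exact: sqrt_continuous.
- by have [] := is_derive_sqrt_comp (f0 _ Vy) ((df i).1 _ Vy).
- have Cs := CkZ 2 (IH _ f0 (CkW Cf)).
  have s0 y : V y -> 2 * Num.sqrt (f y) != 0.
    by move=> Vy; rewrite mulf_neq0 // gt_eqF // sqrtr_gt0 f0.
  apply: Ck_eq (CkM (CkV s0 Cs) (df i).2) => y Vy.
  by have [_ e] := is_derive_sqrt_comp (f0 _ Vy) ((df i).1 _ Vy); rewrite [RHS]e.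
Qed.

Definition smooth f := smooth_on V (f : 'rV[R]_4 -> R).

Lemma smooth_eq f g : (forall y, V y -> f y = g y) -> smooth f -> smooth g.
Proof. by move=> fg sf n; apply: Ck_eq (sf n). Qed.
Lemma smooth_cst c : smooth (fun=> c). Proof. by move=> n; exact: Ck_cst. Qed.
Lemma smoothD f g : smooth f -> smooth g -> smooth (fun y => f y + g y).
Proof. by move=> sf sg n; apply: CkD. Qed.
Lemma smoothN f : smooth f -> smooth (fun y => - f y).
Proof. by move=> sf n; apply: CkN. Qed.
Lemma smoothM f g : smooth f -> smooth g -> smooth (fun y => f y * g y).
Proof. by move=> sf sg n; apply: CkM. Qed.
Lemma smoothV f : (forall y, V y -> f y != 0) -> smooth f -> smooth (fun y => (f y)^-1).
Proof. by move=> f0 sf n; apply: CkV. Qed.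
Lemma smooth_sqrt f : (forall y, V y -> 0 < f y) -> smooth f -> smooth (fun y => Num.sqrt (f y)).
Proof. by move=> f0 sf n; apply: Ck_sqrt. Qed.
Lemma smooth_sum I (r : seq I) (F : I -> 'rV[R]_4 -> R) :
  (forall i, smooth (F i)) -> smooth (fun y => \sum_(i <- r) F i y).
Proof.
move=> sF; elim: r => [|x r IH].
  by apply: smooth_eq (smooth_cst 0) => y _; rewrite big_nil.
by apply: smooth_eq (smoothD (sF x) IH) => y _; rewrite big_cons.
Qed.
Lemma smooth_prod I (r : seq I) (F : I -> 'rV[R]_4 -> R) :
  (forall i, smooth (F i)) -> smooth (fun y => \prod_(i <- r) F i y).
Proof.
move=> sF; elim: r => [|x r IH].
  by apply: smooth_eq (smooth_cst 1) => y _; rewrite big_nil.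
by apply: smooth_eq (smoothM (sF x) IH) => y _; rewrite big_cons.
Qed.
Lemma smooth_pd i f : smooth f -> smooth (pd i f).
Proof. by move=> sf n; have [_ /(_ i) []] := sf n.+1. Qed.
Lemma smooth_derivable i f y : smooth f -> V y -> derivable f y (delta_mx 0 i).
Proof. by move=> sf; have [_ /(_ i) [h _]] := sf 1%N; exact: h. Qed.
Lemma smooth_continuous f y : smooth f -> V y -> {for y, continuous f}.
Proof. by move=> sf; have [h _] := sf 0%N; exact: h. Qed.

Definition smooth_mx m n (A : 'rV[R]_4 -> 'M[R]_(m, n)) :=
  forall i j, smooth (fun y => A y i j).

Lemma continuous_mx m n (A : 'rV[R]_4 -> 'M[R]_(m, n)) y :
  {for y, continuous A} <-> forall i j, {for y, continuous (fun z => A z i j)}.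
Proof.
split=> [cA i j|cA P [Q nQ QP]].
  apply: (@continuous_comp _ _ _ A (fun M : 'M[R]_(m, n) => M i j)) => //.
  exact: coord_continuous.
apply: (@filterS _ (nbhs y) _ [set z | forall i j, Q i j (A z i j)]).
  by move=> z Qz; exact: QP.
apply: (@filterS _ (nbhs y) _ [set z | forall ij : 'I_m * 'I_n, Q ij.1 ij.2 (A z ij.1 ij.2)]).
  by move=> z h i j; exact: (h (i, j)).
apply: (@filter_forall _ _ (fun (ij : 'I_m * 'I_n) z => Q ij.1 ij.2 (A z ij.1 ij.2)) (nbhs y)) => -[i j] /=.
exact: (cA i j _ (nQ i j)).
Qed.

Lemma Ck_mx k m n (A : 'rV[R]_4 -> 'M[R]_(m, n)) :
  Ck k V A <-> forall i j, Ck k V (fun z => A z i j : R).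
Proof.
elim: k A => [|k IH] A.
  split=> [[cA _] i j|cA]; split=> // y Vy.
    by have /continuous_mx := cA _ Vy; exact.
  by apply/continuous_mx => i j; exact: (cA i j).1.
have pdE l y : (forall y, V y -> derivable A y (delta_mx 0 l)) -> V y ->
    pd l A y = \matrix_(i, j) pd l (fun z => A z i j) y.
  by move=> dA Vy; rewrite /pd derive_mx //; exact: dA.
split=> [[cA dA] i j|CA].
  apply: CkS => [y Vy|l y Vy|l].
  - by have /continuous_mx := cA _ Vy; exact.
  - by have /derivable_mxP := (dA l).1 _ Vy; exact.
  - apply: Ck_eq ((IH _).1 (dA l).2 i j) => y Vy.
    by rewrite pdE // ?mxE //; exact: (dA l).1.
have dA l y : V y -> derivable A y (delta_mx 0 l).
  by move=> Vy; apply/derivable_mxP => i j; have [_ /(_ l) [h _]] := CA i j; exact: h.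
apply: CkS => [y Vy|l y Vy|l].
- by apply/continuous_mx => i j; exact: (CA i j).1.
- exact: dA.
- apply/IH => i j; have [_ /(_ l) [_ h]] := CA i j.
  by apply: Ck_eq h => y Vy; rewrite pdE ?mxE //; exact: dA.
Qed.

Lemma smooth_mxP m n (A : 'rV[R]_4 -> 'M[R]_(m, n)) : smooth_on V A <-> smooth_mx A.
Proof.
by split=> [sA i j k|sA k]; [exact: ((Ck_mx k A).1 (sA k))|apply/Ck_mx => i j; exact: sA].
Qed.

Lemma smooth_mulmx m n p (A : 'rV[R]_4 -> 'M[R]_(m, n)) (B : 'rV[R]_4 -> 'M[R]_(n, p)) :
  smooth_mx A -> smooth_mx B -> smooth_mx (fun y => A y *m B y).
Proof.
move=> sA sB i j; apply: (@smooth_eq (fun y => \sum_k A y i k * B y k j)).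
  by move=> y _; rewrite mxE.
by apply: smooth_sum => k; exact: smoothM.
Qed.

Lemma smooth_mx_eq m n (A B : 'rV[R]_4 -> 'M[R]_(m, n)) :
  (forall y, V y -> A y = B y) -> smooth_mx A -> smooth_mx B.
Proof. by move=> AB sA i j; apply: smooth_eq (sA i j) => y /AB ->. Qed.

Lemma smooth_trmx m n (A : 'rV[R]_4 -> 'M[R]_(m, n)) :
  smooth_mx A -> smooth_mx (fun y => (A y)^T).
Proof. by move=> sA i j; apply: smooth_eq (sA j i) => y _; rewrite mxE. Qed.

Lemma smooth_mxD m n (A B : 'rV[R]_4 -> 'M[R]_(m, n)) :
  smooth_mx A -> smooth_mx B -> smooth_mx (fun y => A y + B y).
Proof. by move=> sA sB i j; apply: smooth_eq (smoothD (sA i j) (sB i j)) => y _; rewrite mxE. Qed.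

Lemma smooth_mxN m n (A : 'rV[R]_4 -> 'M[R]_(m, n)) :
  smooth_mx A -> smooth_mx (fun y => - A y).
Proof. by move=> sA i j; apply: smooth_eq (smoothN (sA i j)) => y _; rewrite mxE. Qed.

Lemma smooth_mxZ m n (c : 'rV[R]_4 -> R) (A : 'rV[R]_4 -> 'M[R]_(m, n)) :
  smooth c -> smooth_mx A -> smooth_mx (fun y => c y *: A y).
Proof. by move=> sc sA i j; apply: smooth_eq (smoothM sc (sA i j)) => y _; rewrite mxE. Qed.

Lemma smooth_mx_cst m n (A : 'M[R]_(m, n)) : smooth_mx (fun=> A).
Proof. by move=> i j; exact: smooth_cst. Qed.

Lemma smooth_mx_sum m n I (r : seq I) (F : I -> 'rV[R]_4 -> 'M[R]_(m, n)) :
  (forall i, smooth_mx (F i)) -> smooth_mx (fun y => \sum_(i <- r) F i y).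
Proof.
move=> sF i j; apply: (@smooth_eq (fun y => \sum_(x <- r) F x y i j)).
  by move=> y _; rewrite summxE.
by apply: smooth_sum => x; exact: sF.
Qed.

Lemma smooth_det n (A : 'rV[R]_4 -> 'M[R]_n) : smooth_mx A -> smooth (fun y => \det (A y)).
Proof.
move=> sA; apply: smooth_sum => s; apply: smoothM; first exact: smooth_cst.
by apply: smooth_prod => i; exact: sA.
Qed.

Lemma smooth_invmx n (A : 'rV[R]_4 -> 'M[R]_n) :
  (forall y, V y -> \det (A y) != 0) -> smooth_mx A -> smooth_mx (fun y => invmx (A y)).
Proof.
move=> dA sA i j.
apply: (@smooth_eq (fun y => (\det (A y))^-1 * cofactor (A y) j i)).
  by move=> y Vy; rewrite /invmx unitmxE unitfE dA // !mxE.
apply: smoothM; first exact/smoothV/smooth_det.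
apply: smoothM; first exact: smooth_cst.
apply: smooth_det => k l.
by apply: smooth_eq (sA (lift j k) (lift i l)) => y _; rewrite !mxE.
Qed.

Lemma smooth_pd_mx m n i (A : 'rV[R]_4 -> 'M[R]_(m, n)) : smooth_mx A -> smooth_mx (pd i A).
Proof. by move=> /smooth_mxP sA; apply/smooth_mxP => k; have [_ /(_ i) []] := sA k.+1. Qed.

Lemma pd_mxE m n i (A : 'rV[R]_4 -> 'M[R]_(m, n)) y j k : smooth_mx A -> V y ->
  pd i A y j k = pd i (fun z => A z j k) y.
Proof.
move=> sA Vy; rewrite /pd derive_mx ?mxE //.
by apply/derivable_mxP => a b; exact: smooth_derivable (sA a b) Vy.
Qed.

(** One step of the Gram-Schmidt process: complete the square in the first
    coordinate, and apply induction to the Schur complement.  Only rational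
    operations and square roots of positive functions are used, so that the
    result is smooth. *)
Lemma smooth_cholesky n (G : 'rV[R]_4 -> 'M[R]_n) : smooth_mx G ->
  (forall y, V y -> (G y)^T = G y) ->
  (forall y, V y -> forall v : 'rV[R]_n, v != 0 -> 0 < (v *m G y *m v^T) 0 0) ->
  exists2 L : 'rV[R]_4 -> 'M[R]_n, smooth_mx L &
    forall y, V y -> G y = (L y)^T *m L y /\ 0 < \det (L y).
Proof.
elim: n G => [|n IH] G sG GT Gpos.
  by exists (fun=> 0) => [|y Vy]; [exact: smooth_mx_cst|rewrite det_mx00 ltr01; split=> //; by apply/matrixP => -[]].
have sG' : smooth_mx (G : 'rV[R]_4 -> 'M[R]_(1 + n)) by [].
pose a y := ulsubmx (G y : 'M[R]_(1 + n)) 0 0.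
pose b y : 'rV[R]_n := ursubmx (G y : 'M[R]_(1 + n)).
pose D y : 'M[R]_n := drsubmx (G y : 'M[R]_(1 + n)).
have GE y : V y -> G y = block_mx (a y)%:M (b y) (b y)^T (D y) :> 'M[R]_(1 + n).
  move=> Vy; rewrite -[LHS](@submxK _ 1 n 1 n); congr block_mx; first exact: mx11_scalar.
  by rewrite /b -{1}(GT y Vy) trmx_ursub.
have quad y : V y -> forall (s : R) (v : 'rV[R]_n),
    (row_mx s%:M v *m (G y : 'M[R]_(1 + n)) *m (row_mx s%:M v)^T) 0 0
    = a y * s ^+ 2 + 2 * s * (v *m (b y)^T) 0 0 + (v *m D y *m v^T) 0 0.
  move=> Vy s v; rewrite GE // mul_row_block tr_row_mx mul_row_col.
  rewrite tr_scalar_mx !mul_scalar_mx !mul_mx_scalar mulmxDl -!scalemxAl.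
  have -> : b y *m v^T = v *m (b y)^T.
    by rewrite [LHS]mx11_scalar [RHS]mx11_scalar -[in RHS]trace_mx11 -mxtrace_tr trace_mx11 trmx_mul trmxK.
  by rewrite !mxE eqxx mulr1n; ring.
have apos y : V y -> 0 < a y.
  move=> Vy; have := Gpos y Vy (row_mx 1%:M 0).
  rewrite quad // mul0mx !mul0mx !mxE expr1n mulr1 mulr0 !addr0; apply.
  by apply/eqP => /(congr1 (@lsubmx R 1 1 n)); rewrite row_mxKl linear0 => /matrixP /(_ 0 0); rewrite !mxE => /eqP; rewrite oner_eq0.
pose r y := Num.sqrt (a y).
have sa : smooth a.
  by apply: smooth_eq (sG (lshift n (0 : 'I_1)) (lshift n (0 : 'I_1))) => y _; rewrite /a !mxE.
have sb : smooth_mx b.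
  by move=> i j; apply: smooth_eq (sG (lshift n i) (rshift 1 j)) => y _; rewrite /b !mxE.
have sD : smooth_mx D.
  by move=> i j; apply: smooth_eq (sG (rshift 1 i) (rshift 1 j)) => y _; rewrite /D !mxE.
have sr : smooth r by exact: smooth_sqrt.
have r0 y : V y -> r y != 0 by move=> Vy; rewrite gt_eqF // sqrtr_gt0 apos.
have a0 y : V y -> a y != 0 by move=> Vy; rewrite gt_eqF // apos.
pose G' y := D y - (a y)^-1 *: ((b y)^T *m b y).
have [L' sL' L'E] : exists2 L' : 'rV[R]_4 -> 'M[R]_n, smooth_mx L' &
    forall y, V y -> G' y = (L' y)^T *m L' y /\ 0 < \det (L' y).
  apply: IH => [|y Vy|y Vy v v0].
  - apply/smooth_mxD/smooth_mxN/smooth_mxZ => //; first exact: smoothV.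
    exact/smooth_mulmx/sb/smooth_trmx.
  - rewrite /G' linearB linearZ /= trmx_mul trmxK; congr (_ - _).
    by rewrite /D trmx_drsub; congr drsubmx; exact: GT.
  (* The first coordinate minimizing the quadratic form, v being fixed. *)
  - pose s := - (a y)^-1 * (v *m (b y)^T) 0 0.
    have := Gpos y Vy (row_mx s%:M v); rewrite quad // => h.
    have {}h := h _; rewrite /G' mulmxBr mulmxBl -scalemxAr -scalemxAl.
    rewrite mulmxA -[_ *m b y *m v^T]mulmxA.
    have -> : b y *m v^T = v *m (b y)^T.
      by rewrite [LHS]mx11_scalar [RHS]mx11_scalar -[in RHS]trace_mx11 -mxtrace_tr trace_mx11 trmx_mul trmxK.
    have -> : (v *m D y *m v^T - (a y)^-1 *: (v *m (b y)^T *m (v *m (b y)^T))) 0 0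
       = a y * s ^+ 2 + 2 * s * (v *m (b y)^T) 0 0 + (v *m D y *m v^T) 0 0.
      rewrite mxE [X in _ + X]mxE [X in _ - X]mxE [(_ *m (v *m _)) 0 0]mxE big_ord1 /s; field.
      exact: a0.
    apply: h; apply: contra v0 => /eqP /(congr1 (@rsubmx R 1 1 n)); rewrite row_mxKr linear0 => ->.
    by [].
pose L y : 'M[R]_(1 + n) := block_mx (r y)%:M ((r y)^-1 *: b y) 0 (L' y).
exists L => [|y Vy].
  move=> i j; rewrite /L.
  case: (@split_ordP 1 n i) => i' ->; case: (@split_ordP 1 n j) => j' ->.
  - apply: (@smooth_eq r) => // y _.
    have := block_mxEul (r y)%:M ((r y)^-1 *: b y) 0 (L' y) i' j'.
    by rewrite [RHS]mxE !ord1 eqxx mulr1n => e; exact: esym e.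
  - apply: (@smooth_eq (fun y => (r y)^-1 * b y i' j')); last exact/smoothM/sb/smoothV.
    move=> y _; have := block_mxEur (r y)%:M ((r y)^-1 *: b y) 0 (L' y) i' j'.
    by rewrite [RHS]mxE => e; exact: esym e.
  - apply: (@smooth_eq (fun=> 0)); last exact: smooth_cst.
    move=> y _; have := block_mxEdl (r y)%:M ((r y)^-1 *: b y) 0 (L' y) i' j'.
    by rewrite [RHS]mxE => e; exact: esym e.
  - apply: smooth_eq (sL' i' j') => y _.
    exact: esym (block_mxEdr (r y)%:M ((r y)^-1 *: b y) 0 (L' y) i' j').
have [G'E dL'] := L'E y Vy.
have ry : 0 < r y by rewrite sqrtr_gt0 apos.
split; last first.
  have e := det_ublock (r y)%:M ((r y)^-1 *: b y) (L' y).
  have h : 0 < r y * \det (L' y) by rewrite mulr_gt0.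
  by rewrite det_scalar expr1 in e; rewrite -e in h; exact: h.
pose Ly : 'M[R]_(1 + n) := block_mx (r y)%:M ((r y)^-1 *: b y) 0 (L' y).
suff e : Ly^T *m Ly = block_mx (a y)%:M (b y) (b y)^T (D y).
  exact: etrans (GE y Vy) (esym e).
rewrite /Ly tr_block_mx mulmx_block !tr_scalar_mx !trmx0 !linearZ /= !mul0mx !mulmx0 !addr0.
rewrite -G'E /G'; congr block_mx.
- by rewrite -scalar_mxM -expr2 sqr_sqrtr // ltW // apos.
- by rewrite mul_scalar_mx scalerA ?mulVf ?mulfV ?scale1r ?r0.
- by rewrite mul_mx_scalar scalerA ?mulVf ?mulfV ?scale1r ?r0.
- rewrite -?scalemxAl -?scalemxAr scalerA -invfM -expr2 sqr_sqrtr ?ltW ?apos //.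
  by rewrite addrC subrK.
Qed.

End Smooth.

Lemma dist_le_halves (R : realType) (p q r eps : R) :
  `|q - p| < eps / 2 -> `|r - p| < eps / 2 -> `|q - r| <= eps.
Proof.
move=> h1 h2; have -> : q - r = (q - p) - (r - p) by rewrite opprB addrA subrK.
by rewrite (le_trans (ler_normB _ _)) // (splitr eps) lerD // ltW.
Qed.

Section Schwarz.
Context {R : realType} (V : set 'rV[R]_4) (Vo : open V).
Implicit Types (f : 'rV[R]_4 -> R) (y e : 'rV[R]_4).

(** All the small squares with corner y and sides e and e' lie in a given
    neighbourhood of y. *)
Lemma square_in_nbhs y e (e' : 'rV[R]_4) (A : set 'rV[R]_4) : nbhs y A ->
  exists2 s : R, 0 < s & forall a b : R, 0 <= a <= s -> 0 <= b <= s ->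
    A (y + a *: e + b *: e').
Proof.
move=> /nbhs_ballP[d /= d0 dA].
pose K := `|e| + `|e'| + 1.
have K0 : 0 < K by rewrite /K ltr_wpDl // addr_ge0.
(* K exceeds the sum of the norms, so that a e + b e' has norm less than d / 2. *)
exists (d / 2 / K) => [|a b /andP[a0 as_] /andP[b0 bs]].
  by rewrite !divr_gt0.
apply: dA; rewrite -ball_normE /= -addrA opprD addNKr normrN.
apply: (le_lt_trans (ler_normD _ _)); rewrite !normrZ !ger0_norm //.
apply: (@le_lt_trans _ _ (d / 2 / K * (`|e| + `|e'|))).
  by rewrite mulrDr lerD // ler_wpM2r.
apply: (@le_lt_trans _ _ (d / 2 / K * K)).
  by rewrite ler_wpM2l ?lerDl // !divr_ge0 // ltW.
by rewrite divfK ?gt_eqF // ltr_pdivrMr // ltr_pMr // ltr1n.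
Qed.

(** The mean value theorem, twice: a second difference quotient of f is a
    value of a mixed second derivative. *)
Lemma second_difference f y (i j : 'I_4) (s : R) (e := delta_mx 0 i) (e' := delta_mx 0 j) :
  0 < s ->
  (forall a b : R, 0 <= a <= s -> 0 <= b <= s -> V (y + a *: e + b *: e')) ->
  (forall z, V z -> derivable f z e) -> (forall z, V z -> derivable (pd i f) z e') ->
  exists a b : R, [/\ 0 <= a <= s, 0 <= b <= s &
    f (y + s *: e + s *: e') - f (y + s *: e) - (f (y + s *: e') - f y)
    = s * s * pd j (pd i f) (y + a *: e + b *: e')].
Proof.
move=> s0 inV df ddf; have s00 : 0 <= s <= s by rewrite ltW /=.
have z00 : (0:R) <= 0 <= s by rewrite lexx ltW.
pose phi (a : R) := f (y + s *: e' + a *: e) - f (y + a *: e).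
pose dphi (a : R) := pd i f (y + s *: e' + a *: e) - pd i f (y + a *: e).
have dphiE (a : R) : a \in `[0, s]%R -> is_derive a (1:R) phi (dphi a).
  rewrite in_itv /= => ha; apply: is_deriveB; apply: derive_line; apply: df.
    by rewrite addrAC; exact: inV.
  by rewrite -[y + _]addr0 -(scale0r e'); exact: inV.
have [a] := @MVT R phi dphi 0 s s0 (fun a ha => dphiE a (subset_itv_oo_cc ha))
   (derivable_within_continuous (fun a ha => @ex_derive _ _ _ _ _ _ _ (dphiE a ha))).
rewrite in_itv /= subr0 => /andP[a0 as_] pe.
have ha : 0 <= a <= s by rewrite !ltW.
pose psi (b : R) := pd i f (y + a *: e + b *: e').
pose dpsi (b : R) := pd j (pd i f) (y + a *: e + b *: e').
have dpsiE (b : R) : b \in `[0, s]%R -> is_derive b (1:R) psi (dpsi b).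
  by rewrite in_itv /= => hb; apply: derive_line; apply: ddf; exact: inV.
have [b] := @MVT R psi dpsi 0 s s0 (fun a ha => dpsiE a (subset_itv_oo_cc ha))
   (derivable_within_continuous (fun a ha => @ex_derive _ _ _ _ _ _ _ (dpsiE a ha))).
rewrite in_itv /= subr0 => /andP[b0 bs] qe.
exists a, b; split; rewrite ?ltW //.
move: pe qe; rewrite /phi /dphi /psi /dpsi !scale0r !addr0 => pe qe.
rewrite (addrAC y (s *: e') (s *: e)) (addrAC y (s *: e') (a *: e)) qe in pe.
by rewrite pe; ring.
Qed.

(** Both mixed derivatives are limits of the same second difference quotient,
    taken in one order and in the other. *)
Lemma schwarz f i j y : smooth V f -> V y -> pd i (pd j f) y = pd j (pd i f) y.
Proof.
move=> sf Vy; apply/eqP; rewrite -subr_eq0 -normr_le0; apply/ler_addgt0Pl => eps eps0.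
rewrite addr0.
have e2 : 0 < eps / 2 by rewrite divr_gt0.
have near_c k l : \forall z \near y, `|pd k (pd l f) y - pd k (pd l f) z| < eps / 2.
  have := smooth_continuous (smooth_pd k (smooth_pd l sf)) Vy.
  by move=> /cvgrPdist_lt /(_ _ e2).
have n1 : \forall z \near y, [/\ V z, `|pd i (pd j f) y - pd i (pd j f) z| < eps / 2
    & `|pd j (pd i f) y - pd j (pd i f) z| < eps / 2].
  by apply: filterS3 (Vnear Vo Vy) (near_c i j) (near_c j i) => z h1 h2 h3; split.
have [s s0 hs] := square_in_nbhs (delta_mx 0 i) (delta_mx 0 j) n1.
have V1 (a b : R) : 0 <= a <= s -> 0 <= b <= s -> V (y + a *: delta_mx 0 i + b *: delta_mx 0 j).
  by move=> ha hb; have [] := hs a b ha hb.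
have V2 (a b : R) : 0 <= a <= s -> 0 <= b <= s -> V (y + a *: delta_mx 0 j + b *: delta_mx 0 i).
  by move=> ha hb; rewrite addrAC; exact: V1.
have [a [b [ha hb e1]]] := second_difference s0 V1 (fun z => @smooth_derivable _ _ i f z sf)
  (fun z => @smooth_derivable _ _ j _ z (smooth_pd i sf)).
have [b' [a' [hb' ha' e3]]] := second_difference s0 V2 (fun z => @smooth_derivable _ _ j f z sf)
  (fun z => @smooth_derivable _ _ i _ z (smooth_pd j sf)).
have ss : s * s != 0 by rewrite mulf_neq0 // gt_eqF.
(* Both sides are the same second difference quotient. *)
have e4 : pd j (pd i f) (y + a *: delta_mx 0 i + b *: delta_mx 0 j)
   = pd i (pd j f) (y + a' *: delta_mx 0 i + b' *: delta_mx 0 j).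
  rewrite (addrAC y (a' *: _)); apply: (mulfI ss); apply: etrans (esym e1) (etrans _ e3).
  rewrite (addrAC y (s *: delta_mx 0 j)).
  move: (f _) (f _) (f _) (f _) => p q r t; ring.
have [_ _ h1] := hs a b ha hb; have [_ h2 _] := hs a' b' ha' hb'.
rewrite e4 in h1.
exact: dist_le_halves h2 h1.
Qed.

End Schwarz.

(** * Directional derivatives of components *)

Section Derivatives.
Context {R : realType} {U : normedModType R}.
Implicit Types (t v : U).

(** To prove a derivative of the form produced by the calculus rules, and its
    equality with the expected value apart. *)
Lemma is_derive_eq' (W : normedModType R) (f : U -> W) t v d d' :
  is_derive t v f d -> d = d' -> is_derive t v f d'.
Proof. by move=> ? <-. Qed.

Lemma is_derive_mxP m n (A : U -> 'M[R]_(m, n)) t v dA :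
  is_derive t v A dA <-> forall i j, is_derive t v (fun x => A x i j : R) (dA i j).
Proof.
split=> [[d e] i j|h].
  have di := (derivable_mxP A t v).1 d i j.
  by split=> //; rewrite -e (derive_mx d) mxE.
have d : derivable A t v by apply/derivable_mxP => i j; have [] := h i j.
split=> //; rewrite (derive_mx d); apply/matrixP => i j; rewrite mxE.
by have [_ ->] := h i j.
Qed.

Lemma is_deriveMf (f g : U -> R) t v df dg :
  is_derive t v f df -> is_derive t v g dg ->
  is_derive t v (fun x => f x * g x) (f t * dg + df * g t).
Proof.
move=> hf hg; apply: is_derive_eq' (is_deriveM hf hg) _.
by rewrite /GRing.scale /= [df * _]mulrC.
Qed.

Lemma is_derive_sumf (W : normedModType R) (I : Type) (r : seq I) (F : I -> U -> W) t v (dF : I -> W) :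
  (forall i, is_derive t v (F i) (dF i)) ->
  is_derive t v (fun x => \sum_(i <- r) F i x) (\sum_(i <- r) dF i).
Proof.
move=> h; elim: r => [|i r IH].
  rewrite big_nil; have -> : (fun x => \sum_(i <- [::]) F i x) = cst 0.
    by apply/funext => x; rewrite big_nil.
  exact: is_derive_cst.
rewrite big_cons; have -> : (fun x => \sum_(i <- i :: r) F i x)
   = F i + (fun x => \sum_(i <- r) F i x).
  by apply/funext => x; rewrite big_cons.
exact: is_deriveD.
Qed.

Lemma is_derive_mulmx m n p (A : U -> 'M[R]_(m, n)) (B : U -> 'M[R]_(n, p)) t v dA dB :
  is_derive t v A dA -> is_derive t v B dB ->
  is_derive t v (fun x => A x *m B x) (A t *m dB + dA *m B t).
Proof.
move=> /is_derive_mxP hA /is_derive_mxP hB; apply/is_derive_mxP => i j.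
have -> : (fun x => (A x *m B x) i j) = (fun x => \sum_k A x i k * B x k j).
  by apply/funext => x; rewrite mxE.
rewrite !mxE -big_split; apply: is_derive_sumf => k.
exact: is_deriveMf.
Qed.

Lemma is_derive_trmx m n (A : U -> 'M[R]_(m, n)) t v dA :
  is_derive t v A dA -> is_derive t v (fun x => (A x)^T) dA^T.
Proof.
move=> /is_derive_mxP hA; apply/is_derive_mxP => i j; rewrite mxE.
have -> : (fun x => (A x)^T i j) = (fun x => A x j i) by apply/funext => x; rewrite mxE.
exact: hA.
Qed.

Lemma is_derive_scalemx m n (c : U -> R) (A : U -> 'M[R]_(m, n)) t v dc dA :
  is_derive t v c dc -> is_derive t v A dA ->
  is_derive t v (fun x => c x *: A x) (c t *: dA + dc *: A t).
Proof.
move=> hc /is_derive_mxP hA; apply/is_derive_mxP => i j.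
have -> : (fun x => (c x *: A x) i j) = (fun x => c x * A x i j).
  by apply/funext => x; rewrite mxE.
by rewrite !mxE; apply: is_deriveMf.
Qed.

Lemma is_derive_cstf (W : normedModType R) (a : W) t v : is_derive t v (fun=> a) 0.
Proof. exact: is_derive_cst. Qed.

Lemma is_deriveDf (W : normedModType R) (f g : U -> W) t v df dg :
  is_derive t v f df -> is_derive t v g dg -> is_derive t v (fun x => f x + g x) (df + dg).
Proof. by move=> hf hg; exact: is_deriveD. Qed.

Lemma is_deriveBf (W : normedModType R) (f g : U -> W) t v df dg :
  is_derive t v f df -> is_derive t v g dg -> is_derive t v (fun x => f x - g x) (df - dg).
Proof. by move=> hf hg; exact: is_deriveB. Qed.

Lemma is_deriveNf (W : normedModType R) (f : U -> W) t v df :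
  is_derive t v f df -> is_derive t v (fun x => - f x) (- df).
Proof. by move=> hf; exact: is_deriveN. Qed.

Lemma is_derive_cross3 (s u : U -> 'I_3 -> R) t v ds du :
  (forall m, is_derive t v (fun x => s x m) (ds m)) ->
  (forall m, is_derive t v (fun x => u x m) (du m)) ->
  forall m, is_derive t v (fun x => cross3 (s x) (u x) m) (cross3 (s t) du m + cross3 ds (u t) m).
Proof.
move=> hs hu m; rewrite /cross3 -big_split; apply: is_derive_sumf => i.
rewrite -big_split; apply: is_derive_sumf => j.
apply: is_derive_eq' (is_deriveMf (is_deriveMf (hs i) (hu j)) (is_derive_cstf _ _ _)) _.
by rewrite /=; ring.
Qed.

End Derivatives.

Section Partial_derivatives.
Context {R : realType}.

Lemma is_derive_pd (W : normedModType R) (f : 'rV[R]_4 -> W) y i :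
  derivable f y (delta_mx 0 i) -> is_derive y (delta_mx 0 i) f (pd i f y).
Proof. exact: derivableP. Qed.

Lemma pdE (W : normedModType R) (f : 'rV[R]_4 -> W) y i d :
  is_derive y (delta_mx 0 i) f d -> pd i f y = d.
Proof. by case. Qed.

Lemma pd_near (W : normedModType R) (f f' : 'rV[R]_4 -> W) y i :
  (\near y, f y = f' y) -> pd i f y = pd i f' y.
Proof. exact: near_eq_derive. Qed.

End Partial_derivatives.

(** * Connections in a moving coframe *)

Section Cross3.
Context {R : realType}.
Implicit Types (s t u : 'I_3 -> R).

Lemma cross3E s t : [/\ cross3 s t (inord 0) = s (inord 1) * t (inord 2) - s (inord 2) * t (inord 1),
   cross3 s t (inord 1) = s (inord 2) * t (inord 0) - s (inord 0) * t (inord 2) &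
   cross3 s t (inord 2) = s (inord 0) * t (inord 1) - s (inord 1) * t (inord 0)].
Proof. by split; rewrite /cross3 !big3 !epsilon3E !inordK //=; ring. Qed.

Lemma cross3_jacobi s t u m : cross3 s (cross3 t u) m - cross3 t (cross3 s u) m = cross3 (cross3 s t) u m.
Proof.
have [a0 a1 a2] := cross3E s (cross3 t u); have [b0 b1 b2] := cross3E t (cross3 s u).
have [c0 c1 c2] := cross3E (cross3 s t) u; have [d0 d1 d2] := cross3E t u.
have [e0 e1 e2] := cross3E s u; have [f0 f1 f2] := cross3E s t.
by move: m; elim/ord3P; rewrite ?a0 ?a1 ?a2 ?b0 ?b1 ?b2 ?c0 ?c1 ?c2 ?d0 ?d1 ?d2 ?e0 ?e1 ?e2 ?f0 ?f1 ?f2; ring.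
Qed.

Lemma cross3Dl s s' t m : cross3 (fun m => s m + s' m) t m = cross3 s t m + cross3 s' t m.
Proof.
rewrite /cross3 -big_split; apply: eq_bigr => i _; rewrite -big_split; apply: eq_bigr => j _ /=; ring.
Qed.

Lemma cross3Dr s t t' m : cross3 s (fun m => t m + t' m) m = cross3 s t m + cross3 s t' m.
Proof.
rewrite /cross3 -big_split; apply: eq_bigr => i _; rewrite -big_split; apply: eq_bigr => j _ /=; ring.
Qed.

Lemma cross3Bl s s' t m : cross3 (fun m => s m - s' m) t m = cross3 s t m - cross3 s' t m.
Proof.
rewrite /cross3 -sumrB; apply: eq_bigr => i _; rewrite -sumrB; apply: eq_bigr => j _ /=; ring.
Qed.

(** An element of so(3) is determined by its action on vectors. *)
Lemma cross3_inj s s' : (forall t, cross3 s t =1 cross3 s' t) -> s =1 s'.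
Proof.
move=> h; pose d (i : 'I_3) : 'I_3 -> R := fun j => (j == i)%:R.
have [a0 a1 a2] := cross3E s (d (inord 0)); have [b0 b1 b2] := cross3E s' (d (inord 0)).
have [c0 c1 c2] := cross3E s (d (inord 1)); have [e0 e1 e2] := cross3E s' (d (inord 1)).
elim/ord3P.
- have := h (d (inord 1)) (inord 2); rewrite c2 e2 /d !inord_eq3 //= !mulr1 !mulr0 !subr0 //.
- have := h (d (inord 0)) (inord 2); rewrite a2 b2 /d !inord_eq3 //= !mulr1 !mulr0 !sub0r => /oppr_inj //.
- have := h (d (inord 0)) (inord 1); rewrite a1 b1 /d !inord_eq3 //= !mulr1 !mulr0 !subr0 //.
Qed.
End Cross3.

Section Frame_connection.
Context {R : realType} (V : set 'rV[R]_4) (Vo : open V).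
Variables (G th : 'rV[R]_4 -> 'M[R]_4).
Hypotheses (sG : smooth_mx V G) (sth : smooth_mx V th)
  (GE : forall y, V y -> G y = (th y)^T *m th y) (dth : forall y, V y -> 0 < \det (th y)).

Definition christoffel_mx (i : 'I_4) (y : 'rV[R]_4) : 'M[R]_4 := \matrix_(k, m) christoffel G y i k m.

Lemma det_th_neq0 y : V y -> \det (th y) != 0.
Proof. by move=> Vy; rewrite gt_eqF // dth. Qed.

Lemma det_G_neq0 y : V y -> \det (G y) != 0.
Proof. by move=> Vy; rewrite GE // det_mulmx det_tr mulf_neq0 // det_th_neq0. Qed.

Lemma G_sym y : V y -> (G y)^T = G y.
Proof. by move=> Vy; rewrite GE // trmx_mul trmxK. Qed.

Lemma pd_G_sym i y j k : V y -> pd i G y j k = pd i G y k j.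
Proof.
move=> Vy; rewrite !(pd_mxE i _ _ sG Vy); apply: pd_near.
by apply: filterS (Vnear Vo Vy) => z Vz; rewrite -{1}(G_sym Vz) mxE.
Qed.

Lemma christoffel_mx_G i y k j : V y ->
  (christoffel_mx i y *m G y) k j = 2^-1 * (pd i G y k j + pd k G y i j - pd j G y i k).
Proof.
move=> Vy; have gu : G y \in unitmx by rewrite unitmxE unitfE det_G_neq0.
have gs : (invmx (G y))^T = invmx (G y) by rewrite trmx_inv G_sym.
rewrite mxE; under eq_bigr do rewrite mxE /christoffel -mulrA mulr_suml.
rewrite -mulr_sumr exchange_big /=; congr (_ * _).
have [P PE] : exists P, forall l, pd i G y k l + pd k G y i l - pd l G y i k = P l by eexists.
rewrite PE; under eq_bigr do under eq_bigr do rewrite PE.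
transitivity (\sum_l P l * (invmx (G y) *m G y) l j).
  apply: eq_bigr => l _; rewrite mxE mulr_sumr; apply: eq_bigr => m _.
  have -> : invmx (G y) m l = invmx (G y) l m by rewrite -[in LHS]gs mxE.
  by move: (P l) (invmx _ _ _) (G y m j) => a b c; ring.
rewrite (mulVmx gu) (bigD1 j) //= mxE eqxx mulr1 big1 ?addr0 // => l /negPf lj.
by rewrite mxE lj mulr0.
Qed.

(** In the symmetrized Christoffel symbols, all the derivatives of the metric
    cancel except the one along i. *)
Lemma metric_compatible i y : V y -> pd i G y = christoffel_mx i y *m G y + G y *m (christoffel_mx i y)^T.
Proof.
move=> Vy; have -> : G y *m (christoffel_mx i y)^T = (christoffel_mx i y *m G y)^T by rewrite trmx_mul G_sym.
have [D DE] : exists D, forall l, D l = pd l G y by exists (fun l => pd l G y).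
have DT a b : D i a b = D i b a by rewrite DE pd_G_sym.
apply/matrixP => k j; rewrite mxE [X in _ + X]mxE !christoffel_mx_G // -!DE (DT j k).
by move: (D i k j) (D k i j) (D j i k) => a b c; field.
Qed.

Lemma derivable_th i y : V y -> is_derive y (delta_mx 0 i) th (pd i th y).
Proof.
by move=> Vy; apply/is_derive_pd/derivable_mxP => a b; exact: smooth_derivable (sth a b) Vy.
Qed.

(** The connection form of the coframe th: the components in th of the
    covariant derivative of its covectors. *)
Definition conn_mx (i : 'I_4) y : 'M[R]_4 :=
  locked ((pd i th y - th y *m (christoffel_mx i y)^T) *m invmx (th y)).

Lemma conn_mx_th i y : V y -> pd i th y - th y *m (christoffel_mx i y)^T = conn_mx i y *m th y.
Proof.
by move=> Vy; rewrite /conn_mx -lock -mulmxA mulVmx ?mulmx1 // unitmxE unitfE det_th_neq0.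
Qed.

(** The coframe is orthonormal and the connection is metric. *)
Lemma conn_mx_skew i y : V y -> (conn_mx i y)^T = - conn_mx i y.
Proof.
move=> Vy; have tu : th y \in unitmx by rewrite unitmxE unitfE det_th_neq0.
have e : pd i G y = (th y)^T *m pd i th y + (pd i th y)^T *m th y.
  rewrite (@pd_near _ _ G (fun z => (th z)^T *m th z)).
    apply: pdE; apply: is_derive_mulmx; last exact: derivable_th.
    exact/is_derive_trmx/derivable_th.
  by apply: filterS (Vnear Vo Vy) => z; exact: GE.
have h : (th y)^T *m (conn_mx i y)^T *m th y + (th y)^T *m conn_mx i y *m th y = 0.
  rewrite -trmx_mul -mulmxA -conn_mx_th // mulmxBr linearB /= mulmxBl trmx_mul trmxK.
  move: e; rewrite (metric_compatible i Vy) GE // !mulmxA => e.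
  by rewrite addrACA -opprD e [X in X - _]addrC subrr.
apply/eqP; rewrite -addr_eq0; apply/eqP.
have tut : (th y)^T \in unitmx by rewrite unitmx_tr.
apply: (can_inj (mulmxK tu)); apply: (can_inj (mulKmx tut)).
by rewrite mul0mx mulmx0 mulmxDl mulmxDr !mulmxA h.
Qed.

(** The self-dual part of [conn_mx], up to normalization; it is the only part
    that acts on Lambda^+. *)
Definition conn_vec (i : 'I_4) (y : 'rV[R]_4) (k : 'I_3) : R :=
  - (2 * isqrt2 * ip0 (conn_mx i y) (Sig0 k)).

(** Writing a form as th^T W th, the derivatives of th produce the commutator of
    W with [conn_mx], which on self-dual W is the product with [conn_vec]. *)
Lemma levi_civita_comb i y (s : 'rV[R]_4 -> 'I_3 -> R) ds : V y ->
  (forall m, is_derive y (delta_mx 0 i) (fun z => s z m) (ds m)) ->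
  levi_civita_connection G i (fun z => comb (th z) (s z)) y
  = comb (th y) (fun m => ds m + cross3 (conn_vec i y) (s y) m).
Proof.
move=> Vy hs; rewrite /levi_civita_connection -/(christoffel_mx i y).
pose W z : 'M[R]_4 := \sum_m s z m *: Sig0 m.
pose dW : 'M[R]_4 := \sum_m ds m *: Sig0 m.
have hW : is_derive y (delta_mx 0 i) W dW.
  apply: is_derive_sumf => m.
  apply: is_derive_eq' (is_derive_scalemx (hs m) (is_derive_cstf _ _ _)) _.
  by rewrite scaler0 add0r.
have -> : (fun z => comb (th z) (s z)) = (fun z => (th z)^T *m W z *m th z).
  by apply/funext => z; rewrite comb_form_of.
rewrite (pdE (is_derive_mulmx (is_derive_mulmx (is_derive_trmx (derivable_th i Vy)) hW) (derivable_th i Vy))).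
rewrite mulmxDl.
transitivity (form_of (th y) (dW + (W y *m conn_mx i y - conn_mx i y *m W y))).
  have e1 : (th y)^T *m (W y *m conn_mx i y) *m th y
      = (th y)^T *m W y *m pd i th y - (th y)^T *m W y *m th y *m (christoffel_mx i y)^T.
    transitivity ((th y)^T *m W y *m (conn_mx i y *m th y)); first by rewrite !mulmxA.
    by rewrite -conn_mx_th // mulmxBr !mulmxA.
  have e2 : (th y)^T *m (conn_mx i y *m W y) *m th y
      = christoffel_mx i y *m ((th y)^T *m W y *m th y) - (pd i th y)^T *m W y *m th y.
    have -> : (th y)^T *m (conn_mx i y *m W y) = (christoffel_mx i y *m (th y)^T - (pd i th y)^T) *m W y.
      rewrite mulmxA; congr (_ *m _).
      rewrite -[conn_mx i y]opprK -conn_mx_skew // mulmxN -trmx_mul -conn_mx_th // linearB /= trmx_mul trmxK.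
      by rewrite opprB.
    by rewrite !mulmxBl !mulmxA.
  have eW : comb (th y) (s y) = (th y)^T *m W y *m th y by rewrite comb_form_of.
  rewrite eW /form_of mulmxDr mulmxDl mulmxBr mulmxBl e1 e2 !mulmxA {e1 e2 eW}.
  move: ((th y)^T *m W y *m pd i th y) => a; move: ((th y)^T *m dW *m th y) => b.
  move: ((pd i th y)^T *m W y *m th y) => c; move: (christoffel_mx i y *m (th y)^T *m W y *m th y) => d.
  move: ((th y)^T *m W y *m th y *m (christoffel_mx i y)^T) => e.
  by apply/matrixP => k l; rewrite !mxE; ring.
rewrite comb_form_of; congr form_of; rewrite /W mulmx_suml mulmx_sumr -sumrB.
have h m : (s y m *: Sig0 m) *m conn_mx i y - conn_mx i y *m (s y m *: Sig0 m)
   = \sum_n (\sum_k (conn_vec i y k * s y m * epsilon3 k m n)) *: Sig0 n.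
  rewrite -scalemxAl -scalemxAr -scalerBr Sig0_comm_skew ?conn_mx_skew //.
  rewrite scalerA scaler_sumr; under [RHS]eq_bigr do rewrite scaler_suml.
  rewrite [RHS]exchange_big; apply: eq_bigr => k _ /=.
  rewrite !scaler_sumr; apply: eq_bigr => n _.
  rewrite !scalerA; congr (_ *: _); rewrite /conn_vec (epsilon3C k m n).
  by move: (ip0 _ _) (epsilon3 _ _ _) => a b; ring.
under [X in _ + X]eq_bigr do rewrite h.
rewrite exchange_big -big_split /=; apply: eq_bigr => n _.
rewrite -scaler_suml -scalerDl; congr ((_ + _) *: _).
by rewrite exchange_big.
Qed.

Lemma levi_civita_near i y (s s' : 'rV[R]_4 -> 'M[R]_4) :
  (\near y, s y = s' y) ->
  levi_civita_connection G i s y = levi_civita_connection G i s' y.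
Proof.
by move=> e; rewrite /levi_civita_connection (pd_near i e) (nbhs_singleton e).
Qed.

Lemma smooth_conn_mx i : smooth_mx V (conn_mx i).
Proof.
rewrite /conn_mx; under eq_fun do rewrite -lock; apply: smooth_mulmx => //; last first.
  by apply: smooth_invmx => // y; exact: det_th_neq0.
apply: smooth_mxD => //; first exact: smooth_pd_mx.
apply/smooth_mxN => //; apply: smooth_mulmx => //; apply: smooth_trmx => // k m.
apply: (@smooth_eq _ _ Vo (fun y => christoffel G y i k m)).
  by move=> y _; rewrite mxE.
apply: smoothM => //; first exact: smooth_cst.
apply: smooth_sum => // l; apply: smoothM => //.
  by apply: smooth_invmx => // y; exact: det_G_neq0.
apply: smoothD => //; last by apply: smoothN => //; exact: smooth_pd_mx.
by apply: smoothD => //; exact: smooth_pd_mx.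
Qed.

Lemma smooth_ip0 (A : 'rV[R]_4 -> 'M[R]_4) (B : 'rV[R]_4 -> 'M[R]_4) :
  smooth_mx V A -> smooth_mx V B -> smooth V (fun y => ip0 (A y) (B y)).
Proof.
move=> sA sB; apply: smoothM => //; first exact: smooth_cst.
apply: smooth_sum => // i; apply: smooth_mulmx => //; exact: smooth_trmx.
Qed.

Lemma smooth_conn_vec i k : smooth V (fun y => conn_vec i y k).
Proof.
apply: smoothN => //; apply: smoothM => //; first exact: smooth_cst.
by apply: smooth_ip0; [exact: smooth_conn_mx|exact: smooth_mx_cst].
Qed.

Lemma smooth_SigF m : smooth_mx V (fun y => SigF (th y) m).
Proof.
apply: (@smooth_mx_eq _ _ Vo _ _ (fun y => (th y)^T *m Sig0 m *m th y)).
  by move=> y _; rewrite SigF_Sig0.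
apply: smooth_mulmx => //; apply: smooth_mulmx => //; last exact: smooth_mx_cst.
exact: smooth_trmx.
Qed.

Lemma smooth_comp_frame (s : 'rV[R]_4 -> 'M[R]_4) m : smooth_mx V s ->
  smooth V (fun y => ip2 (G y) (s y) (SigF (th y) m)).
Proof.
move=> ss; apply: (@smooth_eq _ _ Vo (fun y => ip0 ((invmx (th y))^T *m s y *m invmx (th y)) (Sig0 m))).
  by move=> y Vy; rewrite (ip2_comps_of (GE Vy) (dth Vy)) SigF_form_of form_ofK // dth.
have si : smooth_mx V (fun y => invmx (th y)) by apply: smooth_invmx => // y; exact: det_th_neq0.
apply: smooth_ip0; last exact: smooth_mx_cst.
apply: smooth_mulmx => //; apply: smooth_mulmx => //; exact: smooth_trmx.
Qed.

Lemma smooth_comb (s : 'rV[R]_4 -> 'I_3 -> R) : (forall m, smooth V (fun y => s y m)) ->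
  smooth_mx V (fun y => comb (th y) (s y)).
Proof.
move=> ss; apply: smooth_mx_sum => // m; apply: smooth_mxZ => //; exact: smooth_SigF.
Qed.

(** The second derivatives of a section cancel by [schwarz], its first
    derivatives by antisymmetry, and the quadratic terms combine by the Jacobi
    identity; the curvature is determined by its action on the sections with
    constant components. *)
Lemma curvature_frame (nabla : connection) (A : 'I_4 -> 'rV[R]_4 -> 'I_3 -> R) y :
  V y ->
  (\forall z \near y, forall i (s : 'rV[R]_4 -> 'M[R]_4) (u : 'rV[R]_4 -> 'I_3 -> R) du,
     (forall m, is_derive z (delta_mx 0 i) (fun w => u w m) (du m)) ->
     (\forall w \near z, s w = comb (th w) (u w)) ->
     nabla i s z = comb (th z) (fun m => du m + cross3 (A i z) (u z) m)) ->
  (forall i j m, derivable (fun z => A j z m) y (delta_mx 0 i)) ->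
  curvature V G nabla y = fun i j => comb (th y) (fun m =>
     pd i (fun z => A j z m) y - pd j (fun z => A i z m) y + cross3 (A i y) (A j y) m).
Proof.
move=> Vy hn dA.
pose F i j m := pd i (fun z => A j z m) y - pd j (fun z => A i z m) y + cross3 (A i y) (A j y) m.
have key (s : 'rV[R]_4 -> 'M[R]_4) (u : 'rV[R]_4 -> 'I_3 -> R) : (forall m, smooth V (fun z => u z m)) ->
   (forall z, V z -> s z = comb (th z) (u z)) ->
   forall i j, dcov1 nabla (dcov0 nabla s) y i j = comb (th y) (cross3 (F i j) (u y)).
  move=> su se.
  have du z i m : V z -> is_derive z (delta_mx 0 i) (fun w => u w m) (pd i (fun w => u w m) z).
    by move=> Vz; apply: is_derive_pd; exact: (smooth_derivable (su m) Vz).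
  have step i j : nabla i (fun z => nabla j s z) y = comb (th y) (fun m =>
     (pd i (pd j (fun w => u w m)) y
       + (cross3 (A j y) (fun m => pd i (fun w => u w m) y) m
          + cross3 (fun m => pd i (fun z => A j z m) y) (u y) m))
     + cross3 (A i y) (fun m => pd j (fun w => u w m) y + cross3 (A j y) (u y) m) m).
    apply: (nbhs_singleton hn i (fun z => nabla j s z)
      (fun z m => pd j (fun w => u w m) z + cross3 (A j z) (u z) m)).
      move=> m; apply: is_deriveDf.
        by apply: is_derive_pd; exact: (smooth_derivable (smooth_pd j (su m)) Vy).
      by apply: is_derive_cross3 => m'; [apply: is_derive_pd; exact: dA|exact: du].
    apply: filterS2 hn (Vnear Vo Vy) => z hz Vz.
    apply: hz => [m|]; first exact: du.
    by apply: filterS (Vnear Vo Vz); exact: se.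
  move=> i j; rewrite /dcov1 /dcov0 !step /comb -sumrB; apply: eq_bigr => m _.
  rewrite -scalerBl; congr (_ *: _).
  rewrite (schwarz Vo i j (su m) Vy) !cross3Dr.
  have -> : cross3 (F i j) (u y) m = cross3 (fun m => pd i (fun z => A j z m) y) (u y) m
     - cross3 (fun m => pd j (fun z => A i z m) y) (u y) m + (cross3 (A i y) (cross3 (A j y) (u y)) m
     - cross3 (A j y) (cross3 (A i y) (u y)) m).
    by rewrite cross3_jacobi -cross3Bl -cross3Dl.
  move: (pd j (pd i _) y) (cross3 _ _ m) (cross3 _ _ m) (cross3 _ _ m) (cross3 _ _ m) (cross3 _ _ m) (cross3 _ _ m) => a1 a2 a3 a4 a5 a6 a7.
  ring.
rewrite /curvature; apply: xget_unique => [|F' [F'L F'E]].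
  split=> [i j|s [ss sL] i j]; first exact: comb_LambdaPlus (GE Vy) (dth Vy) _.
  have se z : V z -> s z = comb (th z) (fun m => ip2 (G z) (s z) (SigF (th z) m)).
    by move=> Vz; apply/(LambdaPlusP (GE Vz) (dth Vz)); exact: sL.
  rewrite (key s _ _ se) => [|m]; last exact/smooth_comp_frame/smooth_mxP.
  by rewrite [in RHS](se _ Vy) (cross_comb (GE Vy) (dth Vy)).
apply/funext => i; apply/funext => j.
have /(LambdaPlusP (GE Vy) (dth Vy)) F'c := F'L i j.
rewrite F'c; apply: eq_bigr => m _; congr (_ *: _); move: m; apply: cross3_inj => t.
have st m : smooth V (fun _ : 'rV[R]_4 => t m) by exact: smooth_cst.
have ls : local_section V G (fun z => comb (th z) t).
  split; first by apply/smooth_mxP => //; exact: (@smooth_comb (fun=> t)).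
  by move=> z Vz; exact: comb_LambdaPlus (GE Vz) (dth Vz) _.
have := F'E _ ls i j; rewrite (key _ (fun=> t) st) // {1}F'c (cross_comb (GE Vy) (dth Vy)).
by move=> /(comb_inj (GE Vy) (dth Vy)) h m; rewrite -h.
Qed.

End Frame_connection.

(** * The connection A(h) and its curvature in a coframe *)

Section Derive_adinv.
Context {R : realType} {U : normedModType R}.
Implicit Types (t v : U).

Lemma derivable_sumf (W : normedModType R) (I : Type) (r : seq I) (F : I -> U -> W) t v :
  (forall i, derivable (F i) t v) -> derivable (fun x => \sum_(i <- r) F i x) t v.
Proof.
move=> h; have [] : is_derive t v (fun x => \sum_(i <- r) F i x) (\sum_(i <- r) 'D_v (F i) t).
  by apply: is_derive_sumf => i; apply: derivableP; exact: h.
by [].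
Qed.

Lemma derivable_scalemx m n (c : U -> R) (A : U -> 'M[R]_(m, n)) t v :
  derivable c t v -> derivable A t v -> derivable (fun x => c x *: A x) t v.
Proof. by move=> hc hA; have [] := is_derive_scalemx (derivableP hc) (derivableP hA). Qed.

Lemma derivable_mulmx m n p (A : U -> 'M[R]_(m, n)) (B : U -> 'M[R]_(n, p)) t v :
  derivable A t v -> derivable B t v -> derivable (fun x => A x *m B x) t v.
Proof. by move=> hA hB; have [] := is_derive_mulmx (derivableP hA) (derivableP hB). Qed.

Lemma derivable_prodf (I : Type) (r : seq I) (F : I -> U -> R) t v :
  (forall i, derivable (F i) t v) -> derivable (fun x => \prod_(i <- r) F i x) t v.
Proof.
move=> h; elim: r => [|i r IH].
  have -> : (fun x => \prod_(i <- [::]) F i x) = cst 1.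
    by apply/funext => x; rewrite big_nil.
  exact: derivable_cst.
have -> : (fun x => \prod_(i <- i :: r) F i x) = F i * (fun x => \prod_(i <- r) F i x).
  by apply/funext => x; rewrite big_cons.
exact: (derivableM (h i) IH).
Qed.

Lemma derivable_det n (A : U -> 'M[R]_n) t v :
  derivable A t v -> derivable (fun x => \det (A x)) t v.
Proof.
move=> /derivable_mxP hA; apply: derivable_sumf => s.
by apply: derivableM; [exact: derivable_cst|apply: derivable_prodf => i; exact: hA].
Qed.

Lemma derivable_coef_mul (A : U -> 'M[R]_3) (c : U -> 'I_3 -> 'cV[R]_4) t v q :
  derivable A t v -> (forall m, derivable (fun x => c x m) t v) ->
  derivable (fun x => coef_mul (A x) (c x) q) t v.
Proof.
move=> /derivable_mxP hA hc; apply: derivable_sumf => m.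
exact: derivable_scalemx.
Qed.

Lemma derivable_ad_mx1 (c : U -> 'I_3 -> 'cV[R]_4) t v q :
  (forall m, derivable (fun x => c x m) t v) -> derivable (fun x => ad_mx1 (c x) q) t v.
Proof.
move=> hc; apply: derivable_sumf => p; apply: derivable_sumf => l.
apply: derivable_scalemx; first exact: derivable_cst.
by apply: derivable_mulmx; first exact: derivable_cst.
Qed.

Lemma derivable_ad_mx_inv (H : U -> 'M[R]_3) (c : U -> 'I_3 -> 'cV[R]_4) t v q :
  \det (H t) != 0 -> derivable H t v -> (forall m, derivable (fun x => c x m) t v) ->
  derivable (fun x => ad_mx_inv (H x) (c x) q) t v.
Proof.
move=> dH hH hc; apply: derivable_coef_mul => [|m].
  apply: derivable_scalemx; first by apply: derivableV => //; exact: derivable_det.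
  by have [] := is_derive_trmx (derivableP hH).
have hw q' : derivable (fun x => coef_mul (H x) (c x) q') t v by exact: derivable_coef_mul.
apply: derivableD; first exact: derivable_ad_mx1.
by apply: derivable_scalemx => //; exact: derivable_cst.
Qed.

Lemma is_derive_ad_mx (H : U -> 'M[R]_3) (a : U -> 'I_3 -> 'cV[R]_4) t v dH da :
  is_derive t v H dH -> (forall m, is_derive t v (fun x => a x m) (da m)) ->
  forall m, is_derive t v (fun x => ad_mx (H x) (a x) m) (ad_mx (H t) da m + ad_mx dH (a t) m).
Proof.
move=> /is_derive_mxP hH ha m; rewrite /ad_mx.
rewrite -big_split; apply: is_derive_sumf => p; rewrite -big_split; apply: is_derive_sumf => l.
rewrite -big_split; apply: is_derive_sumf => n.
apply: is_derive_eq' (is_derive_scalemx (is_deriveMf (is_derive_cstf (epsilon3 p l m) t v) (hH n l))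
  (is_derive_mulmx (is_derive_cstf (Sig0 n) t v) (ha p))) _.
by rewrite mul0r mul0mx !addr0.
Qed.

(** Obtained by differentiating ad_H (a) = c, rather than the formula for the
    inverse. *)
Lemma is_derive_ad_mx_inv (H : U -> 'M[R]_3) (c : U -> 'I_3 -> 'cV[R]_4) t v dH dc :
  (\forall x \near t, \det (H x) != 0) ->
  is_derive t v H dH -> (forall m, is_derive t v (fun x => c x m) (dc m)) ->
  forall m, is_derive t v (fun x => ad_mx_inv (H x) (c x) m)
    (ad_mx_inv (H t) (fun m => dc m - ad_mx dH (ad_mx_inv (H t) (c t)) m) m).
Proof.
move=> ndet hH hc; have dHt := nbhs_singleton ndet.
pose D m := 'D_v (fun x => ad_mx_inv (H x) (c x) m) t.
have hD m : is_derive t v (fun x => ad_mx_inv (H x) (c x) m) (D m).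
  have hH' : derivable H t v by case: hH.
  have hc' m' : derivable (fun x => c x m') t v by case: (hc m').
  by apply: derivableP; exact: (derivable_ad_mx_inv dHt hH' hc').
suff -> : ad_mx_inv (H t) (fun m => dc m - ad_mx dH (ad_mx_inv (H t) (c t)) m) = D by [].
rewrite -[RHS](ad_mxK _ dHt); congr ad_mx_inv; apply/funext => m.
have [_ e1] := is_derive_ad_mx hH hD m; have [_ e2] := hc m.
apply/eqP; rewrite subr_eq -e1 -e2; apply/eqP/near_eq_derive.
by apply: filterS ndet => x dx; rewrite ad_mx_invK.
Qed.

End Derive_adinv.

Section Frame_curvature.
Context {R : realType} (V : set 'rV[R]_4) (Vo : open V).
Variables (G th : 'rV[R]_4 -> 'M[R]_4).
Hypotheses (sG : smooth_mx V G) (sth : smooth_mx V th)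
  (GE : forall y, V y -> G y = (th y)^T *m th y) (dth : forall y, V y -> 0 < \det (th y)).
Implicit Types (H : 'rV[R]_4 -> 'M[R]_3).

(** The covariant derivative of the coefficients of B_h. *)
Definition dBcoef H (y : 'rV[R]_4) (m : 'I_3) (i j k : 'I_4) : R :=
  pd i (fun z => Bcoef (th z) (H z) m j k) y
  + cross3 (conn_vec G th i y) (fun m => Bcoef (th y) (H y) m j k) m.

(** The components of d_Gamma B_h. *)
Definition dBcoef3 H y m i j k : R :=
  dBcoef H y m i j k + dBcoef H y m j k i + dBcoef H y m k i j.

(** d_Gamma B_h, after contraction with the volume form. *)
Definition dBdual H y m : 'cV[R]_4 := frame_dual3 (th y) (dBcoef3 H y m).

Lemma smooth_Bcoef H m j k : smooth_mx V H ->
  smooth V (fun z => Bcoef (th z) (H z) m j k).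
Proof.
move=> sH; apply: (@smooth_eq _ _ Vo (fun z => \sum_n H z n m * SigF (th z) n j k)).
  by move=> z _; rewrite /Bcoef summxE; apply: eq_bigr => n _; rewrite [RHS]mxE.
apply: smooth_sum => // n; apply: smoothM => //; exact: smooth_SigF.
Qed.

Lemma Bcoef_skewE (t : 'M[R]_4) (A : 'M[R]_3) m j k : Bcoef t A m j k = - Bcoef t A m k j.
Proof. by have /matrixP /(_ k j) := Bcoef_skew t A m; rewrite !mxE. Qed.

Lemma dBcoef_skew H y m i j k : smooth_mx V H -> V y -> dBcoef H y m i j k = - dBcoef H y m i k j.
Proof.
move=> sH Vy; rewrite /dBcoef opprD; congr (_ + _).
  apply: pdE; have -> : (fun z => Bcoef (th z) (H z) m j k) = (fun z => - Bcoef (th z) (H z) m k j).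
    by apply/funext => z; rewrite Bcoef_skewE.
  apply/is_deriveNf/is_derive_pd; exact: smooth_derivable (smooth_Bcoef m k j sH) Vy.
rewrite /cross3 -sumrN; apply: eq_bigr => p _; rewrite -sumrN; apply: eq_bigr => q _.
by rewrite Bcoef_skewE mulrN mulNr.
Qed.

Lemma dBcoef3_alt H y m : smooth_mx V H -> V y -> alt3 (dBcoef3 H y m).
Proof.
move=> sH Vy; split=> i j k; rewrite /dBcoef3; last by rewrite addrC addrA.
rewrite (dBcoef_skew m j i k) // (dBcoef_skew m i k j) // (dBcoef_skew m k j i) //.
by move: (dBcoef H y m j k i) (dBcoef H y m i j k) (dBcoef H y m k i j) => a b c; ring.
Qed.

Lemma smooth_dBcoef H m i j k : smooth_mx V H -> smooth V (fun y => dBcoef H y m i j k).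
Proof.
move=> sH; apply: smoothD => //; first exact/smooth_pd/smooth_Bcoef.
apply: smooth_sum => // p; apply: smooth_sum => // q; apply: smoothM => //; last exact: smooth_cst.
by apply: smoothM => //; [exact: smooth_conn_vec|exact: smooth_Bcoef].
Qed.

Lemma smooth_dBdual H m : smooth_mx V H -> smooth_mx V (fun y => dBdual H y m).
Proof.
move=> sH; apply: smooth_mxZ => //.
  by apply: smoothV => //; [move=> y Vy; rewrite gt_eqF // dth|exact: smooth_det].
apply: smooth_mulmx => // l j.
have s3 a b c : smooth V (fun y => dBcoef3 H y m a b c).
  by apply: smoothD => //; [apply: smoothD => //|]; exact: smooth_dBcoef.
move: l; elim/ord4P;
[pose f y := dBcoef3 H y m (inord 1) (inord 2) (inord 3)
|pose f y := - dBcoef3 H y m (inord 0) (inord 2) (inord 3)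
|pose f y := dBcoef3 H y m (inord 0) (inord 1) (inord 3)
|pose f y := - dBcoef3 H y m (inord 0) (inord 1) (inord 2)];
apply: (@smooth_eq _ _ Vo f); try (by move=> y _; rewrite mxE inordK).
all: rewrite /f; try exact: s3.
all: by apply: smoothN => //; exact: s3.
Qed.

Variables (H : 'rV[R]_4 -> 'M[R]_3) (Bf : 'rV[R]_4 -> 'I_4 -> 'I_4 -> 'M[R]_4).
Hypotheses (sH : smooth_mx V H)
  (BfE : forall y j k, V y -> Bf y j k = comb (th y) (fun m => Bcoef (th y) (H y) m j k)).

Notation Gam := (levi_civita_connection G).

Lemma dcov2_frame y i j k : V y ->
  dcov2 Gam Bf y i j k = comb (th y) (fun m => dBcoef3 H y m i j k).
Proof.
move=> Vy; have h a b c : Gam a (fun z => Bf z b c) y = comb (th y) (fun m => dBcoef H y m a b c).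
  rewrite (levi_civita_near _ _ (_ : \near y, Bf y b c = comb (th y) (fun m => Bcoef (th y) (H y) m b c))).
    apply: (levi_civita_comb Vo sG sth GE dth Vy) => m; apply: is_derive_pd.
    exact: smooth_derivable (smooth_Bcoef m b c sH) Vy.
  by apply: filterS (Vnear Vo Vy) => z; exact: BfE.
rewrite /dcov2 !h /comb -!big_split; apply: eq_bigr => m _ /=.
by rewrite -!scalerDl.
Qed.

(** The components of A(h) = Gamma - ad_h^-1 (d_Gamma B_h). *)
Definition conn_A (j : 'I_4) (z : 'rV[R]_4) (m : 'I_3) : R :=
  conn_vec G th j z m - ((ad_mx_inv (H z) (dBdual H z) m)^T *m th z) 0 j.

(** A(h), where Bf is the tensor B_h. *)
Definition nablaA : connection := shift_connection G Gam
  (fun y i => - ad_inv (G y) (Bf y) (dcov2 Gam Bf y) i).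

Lemma nablaA_frame z i (s : 'rV[R]_4 -> 'M[R]_4) (u : 'rV[R]_4 -> 'I_3 -> R) du :
  V z -> \det (H z) != 0 ->
  (forall m, is_derive z (delta_mx 0 i) (fun w => u w m) (du m)) ->
  (\forall w \near z, s w = comb (th w) (u w)) ->
  nablaA i s z = comb (th z) (fun m => du m + cross3 (conn_A i z) (u z) m).
Proof.
move=> Vz dHz hu hs; rewrite /nablaA /shift_connection.
rewrite (levi_civita_near G i hs) (levi_civita_comb Vo sG sth GE dth Vz hu).
have -> : Bf z = fun j k => comb (th z) (fun m => Bcoef (th z) (H z) m j k).
  by apply/funext => j; apply/funext => k; exact: BfE.
have -> : dcov2 Gam Bf z = fun i j k => comb (th z) (fun m => dBcoef3 H z m i j k).
  by do 3! (apply/funext => ?); exact: dcov2_frame.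
rewrite (ad_inv_frame (GE Vz) (dth Vz)) // => [|m]; last exact: dBcoef3_alt.
have -> : - cov_comb (th z) (ad_mx_inv (H z) (fun m => frame_dual3 (th z) (dBcoef3 H z m))) i
   = comb (th z) (fun m => - ((ad_mx_inv (H z) (dBdual H z) m)^T *m th z) 0 i).
  by rewrite /cov_comb /comb -sumrN; apply: eq_bigr => m _; rewrite scaleNr.
rewrite (nbhs_singleton hs) (cross_comb (GE Vz) (dth Vz)) /comb -big_split.
apply: eq_bigr => m _ /=; rewrite -scalerDl -addrA; congr ((_ + _) *: _).
by rewrite -cross3Dl.
Qed.

Lemma det_near y : V y -> \det (H y) != 0 -> \forall z \near y, \det (H z) != 0.
Proof.
move=> Vy dHy; have := smooth_continuous (smooth_det Vo sH) Vy.
by move=> /cvgr_neq0; exact.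
Qed.

(** The partial derivatives of ad_h^-1 (d_Gamma B_h). *)
Definition pd_alpha y i (m : 'I_3) : 'cV[R]_4 :=
  ad_mx_inv (H y) (fun m => pd i (fun z => dBdual H z m) y
     - ad_mx (pd i H y) (ad_mx_inv (H y) (dBdual H y)) m) m.

Lemma is_derive_mx_smooth m n (A : 'rV[R]_4 -> 'M[R]_(m, n)) y i : smooth_mx V A -> V y ->
  is_derive y (delta_mx 0 i) A (pd i A y).
Proof.
by move=> sA Vy; apply: is_derive_pd; apply/derivable_mxP => a b; exact: smooth_derivable (sA a b) Vy.
Qed.

Lemma is_derive_conn_A y i j m : V y -> \det (H y) != 0 ->
  is_derive y (delta_mx 0 i) (fun z => conn_A j z m)
   (pd i (fun z => conn_vec G th j z m) y
    - ((pd_alpha y i m)^T *m th y + (ad_mx_inv (H y) (dBdual H y) m)^T *m pd i th y) 0 j).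
Proof.
move=> Vy dHy; apply: is_deriveBf.
  apply: is_derive_pd; exact: smooth_derivable (smooth_conn_vec Vo sG sth GE dth j m) Vy.
have hal m' : is_derive y (delta_mx 0 i) (fun z => ad_mx_inv (H z) (dBdual H z) m') (pd_alpha y i m').
  apply: is_derive_ad_mx_inv; first exact: det_near.
    exact: is_derive_mx_smooth.
  move=> m''; apply: is_derive_mx_smooth => //; exact: smooth_dBdual.
have := is_derive_mulmx (is_derive_trmx (hal m)) (is_derive_mx_smooth i sth Vy).
by move=> /is_derive_mxP /(_ 0 j); rewrite addrC.
Qed.

Definition curv_A y (i j : 'I_4) (m : 'I_3) : R :=
  pd i (fun z => conn_A j z m) y - pd j (fun z => conn_A i z m) y + cross3 (conn_A i y) (conn_A j y) m.

Lemma curvature_nablaA y : V y -> \det (H y) != 0 ->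
  curvature V G nablaA y = fun i j => comb (th y) (curv_A y i j).
Proof.
move=> Vy dHy; apply: curvature_frame => //.
  apply: filterS2 (Vnear Vo Vy) (det_near Vy dHy) => z Vz dHz i s u du.
  exact: nablaA_frame.
by move=> i j m; have [] := is_derive_conn_A i j m Vy dHy.
Qed.

End Frame_curvature.

(** * From the manifold to a chart *)

Section Chart.
Context {R : realType} {M : topologicalType} (X : oriented_atlas R M).
Variables (g : M -> 'M[R]_4) (gR : riemannian X g) (x : M).

Local Notation c := (chart_at X x).
Notation V := (chart_image c).
Notation G := (in_chart2 X c g).
Notation y0 := (Defs.coord (chart_at X x) x).

Lemma chart_open : open V.
Proof. exact: image_open. Qed.

Lemma chart_base : V y0.
Proof. by exists x => //; exact: chart_at_dom. Qed.

Lemma param_dom y : V y -> dom c (param c y).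
Proof. by move=> [z zc <-]; rewrite coordK. Qed.

Lemma coord_param y : V y -> Defs.coord c (param c y) = y.
Proof. by move=> [z zc <-]; rewrite coordK. Qed.

Lemma param_base : param c y0 = x.
Proof. by rewrite coordK //; exact: chart_at_dom. Qed.

Lemma det_jac_at y : V y -> 0 < \det (jac_at X c y).
Proof.
move=> Vy; have := @transition_oriented _ _ X x (param c y) (param c y) (param_dom Vy) (chart_at_dom X _).
by rewrite coord_param.
Qed.

(** At the base point the preferred chart is the chart itself. *)
Lemma jac_at_base : jac_at X c y0 = 1%:M.
Proof.
apply/matrixP => i j; rewrite /jac_at param_base mxE.
rewrite (@pd_near _ _ _ id); last first.
  by apply: filterS (Vnear chart_open chart_base) => z Vz; rewrite /= coord_param.
rewrite /pd derive_id !mxE /=.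
by rewrite eq_sym.
Qed.

Lemma smooth_G : smooth_mx V G.
Proof. by have [_ _ h] := gR; apply/smooth_mxP; [exact: chart_open|exact: h]. Qed.

Lemma G_base : G y0 = g x.
Proof. by rewrite /in_chart2 jac_at_base param_base trmx1 mulmx1 mul1mx. Qed.

Lemma chart_G_sym y : (G y)^T = G y.
Proof.
by have [h _ _] := gR; rewrite /in_chart2 !trmx_mul trmxK h mulmxA.
Qed.

Lemma chart_G_pos y : V y -> forall v : 'rV[R]_4, v != 0 -> 0 < (v *m G y *m v^T) 0 0.
Proof.
move=> Vy v v0; have [_ h _] := gR; rewrite /in_chart2 !mulmxA -(mulmxA _ _ v^T) -trmx_mul.
apply: h; apply: contra v0 => /eqP e.
have Ju : jac_at X c y \in unitmx by rewrite unitmxE unitfE gt_eqF // det_jac_at.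
by rewrite -(mulmxK Ju v) e mul0mx.
Qed.

Lemma frame_exists : exists2 th : 'rV[R]_4 -> 'M[R]_4, smooth_mx V th &
  forall y, V y -> G y = (th y)^T *m th y /\ 0 < \det (th y).
Proof.
apply: smooth_cholesky; [exact: chart_open|exact: smooth_G|move=> y _; exact: chart_G_sym|].
exact: chart_G_pos.
Qed.

Variable th : 'rV[R]_4 -> 'M[R]_4.
Hypotheses (sth : smooth_mx V th) (GE : forall y, V y -> G y = (th y)^T *m th y)
  (dth : forall y, V y -> 0 < \det (th y)).
Implicit Types (h eta : endo_field g).

(** The coframe th, carried to the preferred chart of each point; the fibres of
    tensor bundles are expressed in these charts. *)
Definition frame_at y := th y *m (invmx (jac_at X c y))^T.

Lemma frame_atJ y : V y -> frame_at y *m (jac_at X c y)^T = th y.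
Proof.
move=> Vy; have Ju : jac_at X c y \in unitmx by rewrite unitmxE unitfE gt_eqF // det_jac_at.
by rewrite /frame_at -mulmxA -trmx_mul mulmxV // trmx1 mulmx1.
Qed.

Lemma frame_atE y : V y -> g (param c y) = (frame_at y)^T *m frame_at y.
Proof.
move=> Vy; have Ju : jac_at X c y \in unitmx by rewrite unitmxE unitfE gt_eqF // det_jac_at.
have Jtu : (jac_at X c y)^T \in unitmx by rewrite unitmx_tr.
have := GE Vy; rewrite /in_chart2 -(frame_atJ Vy) trmx_mul trmxK !mulmxA => h.
have {}h := can_inj (mulmxK Jtu) h.
apply: (can_inj (mulKmx Ju)); rewrite h -/(frame_at y) -!mulmxA.
by [].
Qed.

Lemma det_frame_at y : V y -> 0 < \det (frame_at y).
Proof.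
move=> Vy; rewrite /frame_at det_mulmx det_tr det_inv mulr_gt0 ?invr_gt0 ?dth //.
exact: det_jac_at.
Qed.

Definition endo_mx h y : 'M[R]_3 := mat (frame_at y) (h (param c y)).

Lemma SigF_mulmx (t A : 'M[R]_4) m : SigF (t *m A^T) m = A *m SigF t m *m A^T.
Proof. by rewrite !SigF_Sig0 trmx_mul trmxK !mulmxA. Qed.

Lemma SigF_frame_at y m : V y ->
  jac_at X c y *m SigF (frame_at y) m *m (jac_at X c y)^T = SigF (th y) m.
Proof. by move=> Vy; rewrite -SigF_mulmx frame_atJ. Qed.

Lemma Bchart_frame h y i j : V y ->
  Bchart X c h y i j = comb (th y) (fun m => Bcoef (th y) (endo_mx h y) m i j).
Proof.
move=> Vy; rewrite /Bchart; set J := jac_at X c y.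
have JS m : J *m SigF (frame_at y) m *m J^T = SigF (th y) m by exact: SigF_frame_at.
transitivity (\sum_p \sum_q \sum_m (J i p * J j q * Bcoef (frame_at y) (endo_mx h y) m p q) *: SigF (th y) m).
  apply: eq_bigr => p _; apply: eq_bigr => q _.
  rewrite (Btensor_Bcoef (frame_atE Vy) (det_frame_at Vy)) /comb mulmx_sumr mulmx_suml scaler_sumr.
  by apply: eq_bigr => m _; rewrite -scalemxAr -scalemxAl JS scalerA.
under eq_bigr do rewrite exchange_big /=.
rewrite exchange_big; apply: eq_bigr => m _ /=.
under eq_bigr do rewrite -scaler_suml; rewrite -scaler_suml; congr (_ *: _).
have -> : Bcoef (th y) (endo_mx h y) m = J *m Bcoef (frame_at y) (endo_mx h y) m *m J^T.
  by rewrite /Bcoef mulmx_sumr mulmx_suml; apply: eq_bigr => n _; rewrite -scalemxAr -scalemxAl JS.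
move: (Bcoef (frame_at y) _ m) => W.
rewrite [RHS]mxE exchange_big; apply: eq_bigr => q _ /=.
by rewrite [(J *m W) i q]mxE mulr_suml; apply: eq_bigr => p _; rewrite [J^T q j]mxE mulrAC.
Qed.

(** The coefficients of B_h, read off from the tensor in the chart: this is how
    the smoothness of h passes to its matrix. *)
Definition Bcoef_chart h y m : 'M[R]_4 :=
  \matrix_(i, j) ip2 (G y) (Bchart X c h y i j) (SigF (th y) m).

Lemma Bcoef_chartE h y m : V y -> Bcoef_chart h y m = Bcoef (th y) (endo_mx h y) m.
Proof.
move=> Vy; apply/matrixP => i j.
by rewrite mxE Bchart_frame // (ip2_comb (GE Vy) (dth Vy)).
Qed.

Lemma endo_mxE h y n m : V y -> endo_mx h y n m = ip2 (G y) (Bcoef_chart h y m) (SigF (th y) n).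
Proof. by move=> Vy; rewrite Bcoef_chartE // (ip2_comb (GE Vy) (dth Vy)). Qed.

Lemma smooth_Bcoef_chart h m : sym_section X h -> smooth_mx V (fun y => Bcoef_chart h y m).
Proof.
move=> [sh _] i j.
apply: (@smooth_eq _ _ chart_open (fun y => ip2 (G y) (Bchart X c h y i j) (SigF (th y) m))).
  by move=> y _; rewrite mxE.
apply: (smooth_comp_frame chart_open sth GE dth).
by apply/smooth_mxP; [exact: chart_open|exact: sh].
Qed.

Lemma smooth_endo_mx h : sym_section X h -> smooth_mx V (endo_mx h).
Proof.
move=> sh n m.
apply: (@smooth_eq _ _ chart_open (fun y => ip2 (G y) (Bcoef_chart h y m) (SigF (th y) n))).
  by move=> y Vy; rewrite endo_mxE.
by apply: (smooth_comp_frame chart_open sth GE dth); exact: smooth_Bcoef_chart.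
Qed.

Lemma endo_mx_det h y : pos_sym_section X h -> V y -> \det (endo_mx h y) != 0.
Proof.
by move=> [_ ph] Vy; apply: posdef_det; exact: (posdef_mat (frame_atE Vy) (det_frame_at Vy) (ph _)).
Qed.

Lemma endo_mx_linear h eta t y : endo_mx (fun z => h z + t *: eta z) y = endo_mx h y + t *: endo_mx eta y.
Proof. by rewrite /endo_mx linearD linearZ. Qed.

Lemma metric_base : g x = (th y0)^T *m th y0.
Proof. by rewrite -G_base GE //; exact: chart_base. Qed.

Lemma det_frame_base : 0 < \det (th y0).
Proof. exact: dth chart_base. Qed.

Lemma endo_mx_base h : endo_mx h y0 = mat (th y0) (h x).
Proof.
rewrite /endo_mx /frame_at jac_at_base invmx1 trmx1 mulmx1.
by rewrite param_base.
Qed.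

Definition curv_mx (h : endo_field g) : 'M[R]_3 :=
  \matrix_(n, m) ip2 (g x) (\matrix_(i, j) curv_A G th (endo_mx h) y0 i j m) (SigF (th y0) n).

(** The hypothesis is smoothness of the matrix rather than of the section, so
    that it can be applied along h + t eta, which is positive only for small t. *)
Lemma Phi_mat h : smooth_mx V (endo_mx h) -> \det (endo_mx h y0) != 0 ->
  mat (th y0) (Phi X h x) = curv_mx h *m invmx (endo_mx h y0) - 1%:M.
Proof.
move=> sH dH; rewrite /Phi.
have -> : curvature V G (A_of X c h) y0 = fun i j => comb (th y0) (curv_A G th (endo_mx h) y0 i j).
  apply: (curvature_nablaA chart_open smooth_G sth GE dth sH _ chart_base dH).
  by move=> y j k Vy; exact: Bchart_frame.
have uH : mat (th y0) (h x) \in unitmx by rewrite unitmxE unitfE -endo_mx_base.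
rewrite linearB /= (mat_comp metric_base det_frame_base) (mat_inv metric_base det_frame_base uH) (mat_id metric_base det_frame_base) -endo_mx_base.
congr (_ *m _ - _).
pose W m : 'M[R]_4 := \matrix_(i, j) curv_A G th (endo_mx h) y0 i j m.
have -> : (fun i j => comb (th y0) (curv_A G th (endo_mx h) y0 i j)) = fun i j => \sum_m W m i j *: SigF (th y0) m.
  by apply/funext => i; apply/funext => j; apply: eq_bigr => m _; rewrite mxE.
rewrite (endo_of_mat metric_base det_frame_base) // => m.
apply/matrixP => i j; rewrite !mxE /curv_A opprD opprB; congr (_ + _).
rewrite /cross3 exchange_big -sumrN; apply: eq_bigr => p _ /=; rewrite -sumrN; apply: eq_bigr => q _.
by rewrite epsilon3C; ring.
Qed.

End Chart.

Lemma is_derive_trmul (R : realType) (U : normedModType R) n p (A : U -> 'cV[R]_n) (B : 'M[R]_(n, p)) t v dA :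
  is_derive t v A dA -> is_derive t v (fun x => (A x)^T *m B) (dA^T *m B).
Proof.
move=> h; apply: is_derive_eq' (is_derive_mulmx (is_derive_trmx h) (is_derive_cstf B t v)) _.
by rewrite mulmx0 add0r.
Qed.

(** * Variation of the curvature of A(h) *)

Section Linear_dependence.
Context {R : realType} (V : set 'rV[R]_4) (Vo : open V).
Variables (G th : 'rV[R]_4 -> 'M[R]_4).
Hypotheses (sG : smooth_mx V G) (sth : smooth_mx V th)
  (GE : forall y, V y -> G y = (th y)^T *m th y) (dth : forall y, V y -> 0 < \det (th y)).
Variables (H E : 'rV[R]_4 -> 'M[R]_3).
Hypotheses (sH : smooth_mx V H) (sE : smooth_mx V E).

Lemma smooth_mx_affine (t : R) : smooth_mx V (fun z => H z + t *: E z).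
Proof.
apply: smooth_mxD => //; apply: smooth_mxZ => //; exact: smooth_cst.
Qed.

Lemma Bcoef_linear (u : 'M[R]_4) (A B : 'M[R]_3) (t : R) m i j :
  Bcoef u (A + t *: B) m i j = Bcoef u A m i j + t * Bcoef u B m i j.
Proof.
rewrite /Bcoef !summxE mulr_sumr -big_split; apply: eq_bigr => n _ /=.
by rewrite !mxE mulrDl mulrA.
Qed.

Lemma pdDZ (f f' : 'rV[R]_4 -> R) t i y : smooth V f -> smooth V f' -> V y ->
  pd i (fun z => f z + t * f' z) y = pd i f y + t * pd i f' y.
Proof.
move=> sf sf' Vy; have h : is_derive y (delta_mx 0 i) f (pd i f y) := is_derive_pd (smooth_derivable sf Vy).
have h' : is_derive y (delta_mx 0 i) f' (pd i f' y) := is_derive_pd (smooth_derivable sf' Vy).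
apply: pdE; apply: is_derive_eq' (is_deriveDf h (is_deriveMf (is_derive_cstf t _ _) h')) _;
  by rewrite ?mul0r ?scale0r addr0.
Qed.

Lemma pd_mxDZ m n (A B : 'rV[R]_4 -> 'M[R]_(m, n)) t i y :
  smooth_mx V A -> smooth_mx V B -> V y ->
  pd i (fun z => A z + t *: B z) y = pd i A y + t *: pd i B y.
Proof.
move=> sA sB Vy; have h := is_derive_mx_smooth i sA Vy.
have h' := is_derive_mx_smooth i sB Vy.
apply: pdE; apply: is_derive_eq' (is_deriveDf h (is_derive_scalemx (is_derive_cstf t _ _) h')) _;
  by rewrite ?mul0r ?scale0r addr0.
Qed.

Lemma dBcoef_linear t y m i j k : V y ->
  dBcoef G th (fun z => H z + t *: E z) y m i j k = dBcoef G th H y m i j k + t * dBcoef G th E y m i j k.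
Proof.
move=> Vy; rewrite /dBcoef.
have -> : (fun z => Bcoef (th z) (H z + t *: E z) m j k)
   = (fun z => Bcoef (th z) (H z) m j k + t * Bcoef (th z) (E z) m j k).
  by apply/funext => z; rewrite Bcoef_linear.
rewrite (pdDZ t i (smooth_Bcoef Vo sth m j k sH) (smooth_Bcoef Vo sth m j k sE) Vy).
have -> : cross3 (conn_vec G th i y) (fun m => Bcoef (th y) (H y + t *: E y) m j k) m
   = cross3 (conn_vec G th i y) (fun m => Bcoef (th y) (H y) m j k) m
    + t * cross3 (conn_vec G th i y) (fun m => Bcoef (th y) (E y) m j k) m.
  rewrite /cross3 mulr_sumr -big_split; apply: eq_bigr => p _ /=.
  rewrite mulr_sumr -big_split; apply: eq_bigr => q _ /=.
  by rewrite Bcoef_linear; ring.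
by move: (pd i _ y) (pd i _ y) (cross3 _ _ m) (cross3 _ _ m) => a b c d; ring.
Qed.

Lemma dBdual_linear t y m : V y ->
  dBdual G th (fun z => H z + t *: E z) y m = dBdual G th H y m + t *: dBdual G th E y m.
Proof.
move=> Vy; rewrite /dBdual addrC -frame_dual3_linear; congr frame_dual3.
apply/funext => i; apply/funext => j; apply/funext => k.
rewrite /dBcoef3 !dBcoef_linear //.
by move: (dBcoef _ _ _ _ _ i j k) (dBcoef _ _ _ _ _ i j k) => a b; ring.
Qed.

Lemma pd_dBdual_linear t y i m : V y ->
  pd i (fun z => dBdual G th (fun z => H z + t *: E z) z m) y
  = pd i (fun z => dBdual G th H z m) y + t *: pd i (fun z => dBdual G th E z m) y.
Proof.
move=> Vy; have sd K (sK : smooth_mx V K) := smooth_dBdual Vo sG sth GE dth m sK.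
rewrite -(pd_mxDZ t i (sd _ sH) (sd _ sE) Vy).
by apply: pd_near; apply: filterS (Vnear Vo Vy) => z Vz; exact: dBdual_linear.
Qed.

(** The derivative of ad_h^-1 (d_Gamma B_h) in the direction of the field of
    matrices E. *)
Definition var_alpha y m : 'cV[R]_4 :=
  ad_mx_inv (H y) (fun m => dBdual G th E y m - ad_mx (E y) (ad_mx_inv (H y) (dBdual G th H y)) m) m.

Definition var_pd_alpha y i m : 'cV[R]_4 :=
  ad_mx_inv (H y) (fun m => pd i (fun z => dBdual G th E z m) y
    - (ad_mx (pd i H y) (var_alpha y) m + ad_mx (pd i E y) (ad_mx_inv (H y) (dBdual G th H y)) m)
    - ad_mx (E y) (pd_alpha G th H y i) m) m.

Definition var_A y j m : R := - ((var_alpha y m)^T *m th y) 0 j.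

Definition var_pd_A y i j m : R :=
  - ((var_pd_alpha y i m)^T *m th y + (var_alpha y m)^T *m pd i th y) 0 j.

Definition var_curv y i j m : R :=
  var_pd_A y i j m - var_pd_A y j i m
  + (cross3 (conn_A G th H i y) (var_A y j) m + cross3 (var_A y i) (conn_A G th H j y) m).

Variable y : 'rV[R]_4.
Hypotheses (Vy : V y) (dH : \det (H y) != 0).

Lemma is_derive_affine m n (a b : 'M[R]_(m, n)) :
  is_derive (0 : R) (1 : R) (fun t : R => a + t *: b) b.
Proof.
apply: is_derive_eq' (is_deriveDf (is_derive_cstf a _ _)
  (is_derive_scalemx (is_derive_id (0 : R) (1 : R)) (is_derive_cstf b _ _))) _.
by rewrite scaler0 !add0r scale1r.
Qed.

Lemma det_affine_near : \forall t \near (0 : R), \det (H y + t *: E y) != 0.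
Proof.
have dd : derivable (fun t : R => \det (H y + t *: E y)) 0 1.
  by apply: derivable_det; have [] := is_derive_affine (H y) (E y).
have := differentiable_continuous ((derivable1_diffP _ _).1 dd).
by move=> /cvgr_neq0; apply; rewrite scale0r addr0.
Qed.

Let Ht (t : R) z := H z + t *: E z.

Lemma is_derive_alpha m : is_derive (0 : R) (1 : R)
  (fun t : R => ad_mx_inv (Ht t y) (dBdual G th (Ht t) y) m) (var_alpha y m).
Proof.
have e (t : R) : dBdual G th (Ht t) y = fun m => dBdual G th H y m + t *: dBdual G th E y m.
  by apply/funext => m'; exact: dBdual_linear.
under eq_fun do rewrite e.
have e0 : H y = H y + (0 : R) *: E y by rewrite scale0r addr0.
have e1 : dBdual G th H y = fun m => dBdual G th H y m + (0 : R) *: dBdual G th E y m.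
  by apply/funext => m'; rewrite scale0r addr0.
rewrite /var_alpha [in X in is_derive _ _ _ X]e0 [in X in is_derive _ _ _ X]e1.
apply: is_derive_ad_mx_inv; first exact: det_affine_near.
  exact: is_derive_affine.
move=> m'; exact: is_derive_affine.
Qed.

Lemma is_derive_pd_alpha i m : is_derive (0 : R) (1 : R)
  (fun t : R => pd_alpha G th (Ht t) y i m) (var_pd_alpha y i m).
Proof.
pose c (t : R) m := pd i (fun z => dBdual G th H z m) y + t *: pd i (fun z => dBdual G th E z m) y
   - ad_mx (pd i H y + t *: pd i E y) (ad_mx_inv (Ht t y) (dBdual G th (Ht t) y)) m.
have e (t : R) : pd_alpha G th (Ht t) y i m = ad_mx_inv (H y + t *: E y) (c t) m.
  rewrite /pd_alpha; congr ad_mx_inv; apply/funext => m'; rewrite /c pd_dBdual_linear //.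
  by rewrite /Ht pd_mxDZ.
under eq_fun do rewrite e.
have K0 : H y + (0 : R) *: E y = H y by rewrite scale0r addr0.
have Ht0 : Ht 0 = H by apply/funext => z; rewrite /Ht scale0r addr0.
have e1 : pd_alpha G th H y i = ad_mx_inv (H y) (c 0).
  suff ec : (fun m => pd i (fun z => dBdual G th H z m) y - ad_mx (pd i H y) (ad_mx_inv (H y) (dBdual G th H y)) m) = c 0.
    by rewrite -ec.
  apply/funext => m'; rewrite /c Ht0; move: (pd i _ y) (pd i _ y) (pd i H y) (pd i E y) => a1 a2 a3 a4.
  by rewrite !scale0r !addr0.
pose dc m := pd i (fun z => dBdual G th E z m) y
    - (ad_mx (pd i H y) (var_alpha y) m + ad_mx (pd i E y) (ad_mx_inv (H y) (dBdual G th H y)) m).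
have hc m' : is_derive (0 : R) (1 : R) (fun t => c t m') (dc m').
  apply: is_deriveBf; first exact: is_derive_affine.
  apply: is_derive_eq' (is_derive_ad_mx (is_derive_affine _ _) is_derive_alpha m') _.
  by rewrite scale0r addr0 Ht0.
have := is_derive_ad_mx_inv det_affine_near (is_derive_affine (H y) (E y)) hc m.
by rewrite K0 /var_pd_alpha e1.
Qed.

Lemma is_derive_var_A j m : is_derive (0 : R) (1 : R)
  (fun t : R => conn_A G th (Ht t) j y m) (var_A y j m).
Proof.
have /is_derive_mxP /(_ 0 j) h := is_derive_trmul (th y) (is_derive_alpha m).
apply: is_derive_eq' (is_deriveBf (is_derive_cstf (conn_vec G th j y m) _ _) h) _.
exact: add0r.
Qed.

Lemma is_derive_curv_A i j m : is_derive (0 : R) (1 : R)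
  (fun t : R => curv_A G th (Ht t) y i j m) (var_curv y i j m).
Proof.
pose dA (t : R) i j := pd i (fun z => conn_vec G th j z m) y
    - ((pd_alpha G th (Ht t) y i m)^T *m th y + (ad_mx_inv (Ht t y) (dBdual G th (Ht t) y) m)^T *m pd i th y) 0 j.
have dAE (i' j' : 'I_4) : is_derive (0 : R) (1 : R) (fun t => dA t i' j') (var_pd_A y i' j' m).
  have h1 := is_derive_trmul (th y) (is_derive_pd_alpha i' m).
  have h2 := is_derive_trmul (pd i' th y) (is_derive_alpha m).
  have /is_derive_mxP /(_ 0 j') h := is_deriveDf h1 h2.
  apply: is_derive_eq' (is_deriveBf (is_derive_cstf (pd i' (fun z => conn_vec G th j' z m) y) _ _) h) _.
  exact: add0r.
have Ht0 : Ht 0 = H by apply/funext => z; rewrite /Ht scale0r addr0.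
have h := is_deriveDf (is_deriveBf (dAE i j) (dAE j i))
   (is_derive_cross3 (is_derive_var_A i) (is_derive_var_A j) m).
rewrite Ht0 in h; apply: near_eq_is_derive h => //.
apply: filterS det_affine_near => t dt.
rewrite /curv_A; congr (_ - _ + _).
  by rewrite (pdE (is_derive_conn_A Vo sG sth GE dth (smooth_mx_affine t) i j m Vy dt)).
by rewrite (pdE (is_derive_conn_A Vo sG sth GE dth (smooth_mx_affine t) j i m Vy dt)).
Qed.

End Linear_dependence.

(** * The linearization of Phi *)

Section Derive_invmx.
Context {R : realType} {U : normedModType R}.

(** The inverse is differentiable by Cramer's rule; its derivative is then found
    from A A^-1 = 1. *)
Lemma is_derive_invmx n (A : U -> 'M[R]_n) t v dA :
  (\forall x \near t, \det (A x) != 0) -> is_derive t v A dA ->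
  is_derive t v (fun x => invmx (A x)) (- (invmx (A t) *m dA *m invmx (A t))).
Proof.
move=> ndet hA; have dAt := nbhs_singleton ndet.
have dvA : derivable A t v by case: hA.
have dV : derivable (fun x => invmx (A x)) t v.
  apply: (@near_eq_derivable _ _ _ (fun x => (\det (A x))^-1 *: \adj (A x))).
    by apply: filterS ndet => x dx; rewrite /invmx unitmxE unitfE dx.
  apply: derivable_scalemx; first by apply: derivableV => //; exact: derivable_det.
  apply/derivable_mxP => i j.
  have -> : (fun x => \adj (A x) i j) = (fun x => (-1) ^+ (j + i) * \det (row' j (col' i (A x)))).
    by apply/funext => x; rewrite mxE.
  apply: derivableM; first exact: derivable_cst.
  apply: derivable_det; apply/derivable_mxP => k l.
  have -> : (fun x => (row' j (col' i (A x))) k l) = (fun x => A x (lift j k) (lift i l)).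
    by apply/funext => x; rewrite !mxE.
  by have /derivable_mxP := dvA; exact.
have hV := derivableP dV; set D := 'D_v _ t in hV.
have At : A t \in unitmx by rewrite unitmxE unitfE.
have [_ e] := is_derive_mulmx hA hV.
have z : A t *m D + dA *m invmx (A t) = 0.
  rewrite -e -(derive_cst (1%:M : 'M[R]_n) t v); apply: near_eq_derive.
  by apply: filterS ndet => x dx; rewrite mulmxV // unitmxE unitfE.
suff -> : - (invmx (A t) *m dA *m invmx (A t)) = D by [].
move/eqP: z; rewrite addr_eq0 => /eqP z.
by rewrite -(mulKmx At D) z mulmxN mulmxA.
Qed.

Lemma is_derive_ip2l (g w : 'M[R]_4) (A : U -> 'M[R]_4) t v dA :
  is_derive t v A dA -> is_derive t v (fun x => ip2 g (A x) w) (ip2 g dA w).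
Proof.
move=> /is_derive_mxP hA; rewrite /ip2.
apply: is_derive_eq' (is_deriveMf (is_derive_cstf _ _ _) _) _; last first.
  by rewrite mul0r addr0.
apply: is_derive_sumf => i; apply: is_derive_sumf => j.
apply: is_derive_sumf => k; apply: is_derive_sumf => l.
apply: is_derive_eq' (is_deriveMf (is_deriveMf (is_derive_cstf _ _ _) (hA i j)) (is_derive_cstf _ _ _)) _.
by rewrite mulr0 mul0r add0r addr0.
Qed.

End Derive_invmx.

Section Linearization.
Context {R : realType} {M : topologicalType} (X : oriented_atlas R M).
Variables (g : M -> 'M[R]_4) (gR : riemannian X g) (x : M).

Local Notation c := (chart_at X x).
Local Notation V := (chart_image c).
Local Notation G := (in_chart2 X c g).
Local Notation y0 := (Defs.coord (chart_at X x) x).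

Variable th : 'rV[R]_4 -> 'M[R]_4.
Hypotheses (sth : smooth_mx V th) (GE : forall y, V y -> G y = (th y)^T *m th y)
  (dth : forall y, V y -> 0 < \det (th y)).
Implicit Types (h eta : endo_field g).

Local Notation endo_mx := (endo_mx X x th).
Local Notation curv_mx := (curv_mx X x th).

Definition var_curv_mx h eta : 'M[R]_3 :=
  \matrix_(n, m) ip2 (g x) (\matrix_(i, j) var_curv G th (endo_mx h) (endo_mx eta) y0 i j m) (SigF (th y0) n).

(** The derivative of F^+ h^-1 is that of F^+, followed by h^-1, minus
    F^+ h^-1 eta h^-1. *)
Definition var_Phi h eta : End_plus (g x) :=
  mkEnd (g x) (th y0) (var_curv_mx h eta *m invmx (endo_mx h y0)
    - curv_mx h *m (invmx (endo_mx h y0) *m endo_mx eta y0 *m invmx (endo_mx h y0))).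

(** The matrix of h + t eta stays invertible for small t, so that [Phi_mat]
    applies to it. *)
Lemma linearization h eta : pos_sym_section X h -> sym_section X eta ->
  is_linearization_at X h eta x (var_Phi h eta).
Proof.
move=> ph seta v; have [sh _] := ph.
have Vo : open V by exact: chart_open.
have Vy : V y0 by exact: chart_base.
have gE : g x = (th y0)^T *m th y0 by exact: metric_base.
have dt : 0 < \det (th y0) by exact: det_frame_base.
have sH : smooth_mx V (endo_mx h) by exact: smooth_endo_mx.
have sE : smooth_mx V (endo_mx eta) by exact: smooth_endo_mx.
have dH : \det (endo_mx h y0) != 0 by exact: endo_mx_det.
have sG : smooth_mx V G by exact: smooth_G.
pose ht (t : R) : endo_field g := fun z => h z + t *: eta z.
have HtE (t : R) : endo_mx (ht t) = fun z => endo_mx h z + t *: endo_mx eta z.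
  by apply/funext => z; rewrite endo_mx_linear.
pose Mt (t : R) := curv_mx (ht t) *m invmx (endo_mx h y0 + t *: endo_mx eta y0) - 1%:M.
have ndet := det_affine_near (endo_mx eta) dH.
have hM : is_derive (0 : R) (1 : R) Mt (var_curv_mx h eta *m invmx (endo_mx h y0)
    - curv_mx h *m (invmx (endo_mx h y0) *m endo_mx eta y0 *m invmx (endo_mx h y0))).
  have hT : is_derive (0 : R) (1 : R) (fun t => curv_mx (ht t)) (var_curv_mx h eta).
    apply/is_derive_mxP => n m.
    have -> : (fun t => curv_mx (ht t) n m) = fun t => ip2 (g x) (\matrix_(i, j) curv_A G th (fun z => endo_mx h z + t *: endo_mx eta z) y0 i j m) (SigF (th y0) n).
      by apply/funext => t; rewrite mxE HtE.
    rewrite mxE; apply: is_derive_ip2l; apply/is_derive_mxP => i j.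
    have -> : (fun t => (\matrix_(i, j) curv_A G th (fun z => endo_mx h z + t *: endo_mx eta z) y0 i j m) i j) = fun t => curv_A G th (fun z => endo_mx h z + t *: endo_mx eta z) y0 i j m.
      by apply/funext => t; rewrite mxE.
    apply: is_derive_eq' (is_derive_curv_A Vo sG sth GE dth sH sE Vy dH i j m) _.
    by symmetry; rewrite [LHS]mxE.
  have hI := is_derive_invmx ndet (is_derive_affine (endo_mx h y0) (endo_mx eta y0)).
  have h0 : ht 0 = h by apply: functional_extensionality_dep => z; rewrite /ht scale0r addr0.
  have K0 : endo_mx h y0 + (0 : R) *: endo_mx eta y0 = endo_mx h y0 by rewrite scale0r addr0.
  apply: is_derive_eq' (is_deriveBf (is_derive_mulmx hT hI) (is_derive_cstf 1%:M (0 : R) (1 : R))) _.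
  rewrite h0 K0; move: (invmx _) (endo_mx eta y0) (curv_mx h) (var_curv_mx h eta) => a1 a2 a3 a4.
  by rewrite subr0 mulmxN addrC.
have mkE A : vsval (mkEnd (g x) (th y0) A v)
   = \sum_n (\sum_m A n m * ip2 (g x) (vsval v) (SigF (th y0) m)) *: SigF (th y0) n.
  by rewrite mkEndE (vsval_comb gE dt).
have hv : is_derive (0 : R) (1 : R) (fun t => vsval (mkEnd (g x) (th y0) (Mt t) v)) (vsval (var_Phi h eta v)).
  under eq_fun do rewrite mkE; rewrite /var_Phi mkE.
  apply: is_derive_sumf => n.
  apply: is_derive_eq' (is_derive_scalemx _ (is_derive_cstf _ _ _)) _; last first.
    by rewrite scaler0 add0r.
  apply: is_derive_sumf => m; move/is_derive_mxP: hM => /(_ n m) hM.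
  apply: is_derive_eq' (is_deriveMf hM (is_derive_cstf _ _ _)) _.
  by rewrite mulr0 add0r.
apply: near_eq_is_derive hv; apply: filterS ndet => t dt'.
suff -> : Mt t = mat (th y0) (Phi X (ht t) x) by rewrite (matK gE dt).
rewrite /Mt (Phi_mat gR sth GE dth) ?HtE //.
by apply: smooth_mx_affine.
Qed.

Lemma DPhiE h eta : pos_sym_section X h -> sym_section X eta ->
  DPhi X h eta x = var_Phi h eta.
Proof.
move=> ph se; have hl := linearization ph se.
rewrite /DPhi; apply: xget_unique => // L hL.
apply/lfunP => v; apply: val_inj.
by have [_ e1] := hL v; have [_ e2] := hl v; rewrite [LHS](esym e1) e2.
Qed.

End Linearization.

(** * Second order operators and their symbols *)

Section Coeff4.
Context {R : realType}.
Implicit Types (t : 'I_4 -> 'I_4 -> 'M[R]_4).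

Lemma coeff4D (W : lmodType R) (a a' : 'I_4 -> 'I_4 -> 'I_4 -> 'I_4 -> W) t :
  coeff4 (fun p q r s => a p q r s + a' p q r s) t = coeff4 a t + coeff4 a' t.
Proof.
rewrite /coeff4; do 4! (rewrite -big_split; apply: eq_bigr => ? _ /=).
exact: scalerDr.
Qed.

Lemma coeff4_0 (W : lmodType R) t : coeff4 (fun _ _ _ _ => 0 : W) t = 0.
Proof. by rewrite /coeff4; do 4! (apply: big1 => ? _); rewrite scaler0. Qed.

Lemma coeff4_delta (k : R) p q r s t :
  coeff4 (fun p' q' r' s' => k * ((p', q', r', s') == (p, q, r, s))%:R : R^o) t = k * t p q r s.
Proof.
rewrite /coeff4 (bigD1 p) //= (bigD1 q) //= (bigD1 r) //= (bigD1 s) //= eqxx.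
rewrite !big1 ?addr0 /=; first by rewrite mulr1; exact: mulrC.
- move=> p' /negPf pp; do 3! (apply: big1 => ? _).
  by rewrite !xpair_eqE pp /= mulr0 scaler0.
- move=> q' /negPf qq; do 2! (apply: big1 => ? _).
  by rewrite !xpair_eqE qq /= andbF /= mulr0 scaler0.
- move=> r' /negPf rr; apply: big1 => ? _.
  by rewrite !xpair_eqE rr /= andbF /= mulr0 scaler0.
- by move=> s' /negPf ss; rewrite !xpair_eqE ss /= andbF /= mulr0 scaler0.
Qed.

Section Linear_map.
Context {W W' : lmodType R} (phi : W -> W') (lphi : linear phi).

Lemma linear_map0 : phi 0 = 0.
Proof. by have := lphi (-1) 0 0; rewrite scaler0 addr0 scaleN1r addNr. Qed.

Lemma linear_mapD u v : phi (u + v) = phi u + phi v.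
Proof. by have := lphi 1 u v; rewrite !scale1r. Qed.

Lemma linear_mapZ k u : phi (k *: u) = k *: phi u.
Proof. by have := lphi k u 0; rewrite linear_map0 !addr0. Qed.

Lemma linear_map_sum I (r : seq I) (F : I -> W) :
  phi (\sum_(i <- r) F i) = \sum_(i <- r) phi (F i).
Proof. exact: (big_morph phi linear_mapD linear_map0). Qed.

Lemma linear_map_coeff4 (a : 'I_4 -> 'I_4 -> 'I_4 -> 'I_4 -> W) t :
  phi (coeff4 a t) = coeff4 (fun p q r s => phi (a p q r s)) t.
Proof.
rewrite /coeff4; do 4! (rewrite linear_map_sum; apply: eq_bigr => ? _).
exact: linear_mapZ.
Qed.
End Linear_map.
End Coeff4.

Section Second_order.
Context {R : realType} {M : topologicalType} (X : oriented_atlas R M).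
Variables (g : M -> 'M[R]_4) (x : M) (xi : 'rV[R]_4).

Local Notation c := (chart_at X x).
Local Notation V := (chart_image c).
Local Notation y0 := (Defs.coord (chart_at X x) x).
Local Notation array := ('I_4 -> 'I_4 -> 'M[R]_4).

Let Vo : open V. Proof. exact: chart_open. Qed.
Let Vy : V y0. Proof. exact: chart_base. Qed.

(** The value at x of a second order operator with symbol sigma, with values in
    any space, as in [has_principal_symbol]; these are stable under linear
    maps. *)
Definition order2 (W : lmodType R) (P : endo_field g -> W) (sigma : array -> W) : Prop :=
  exists (a : 'I_4 -> 'I_4 -> 'I_4 -> 'I_4 -> 'I_4 -> 'I_4 -> W)
         (b : 'I_4 -> 'I_4 -> 'I_4 -> 'I_4 -> 'I_4 -> W)
         (e : 'I_4 -> 'I_4 -> 'I_4 -> 'I_4 -> W),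
    (forall eta, sym_section X eta ->
       P eta =
         \sum_j \sum_k coeff4 (a j k)
           (fun p q => pd j (pd k (fun z => Bchart X c eta z p q)) y0)
         + \sum_j coeff4 (b j) (fun p q => pd j (fun z => Bchart X c eta z p q) y0)
         + coeff4 e (Bchart X c eta y0)) /\
    (forall t, sigma t = \sum_j \sum_k (- (xi 0 j * xi 0 k)) *: coeff4 (a j k) t).

Lemma order2_eq (W : lmodType R) (P P' : endo_field g -> W) (s s' : array -> W) :
  (forall eta, sym_section X eta -> P eta = P' eta) -> (forall t, s t = s' t) ->
  order2 P s -> order2 P' s'.
Proof.
move=> PP ss [a [b [e [h1 h2]]]]; exists a, b, e; split=> [eta he|t].
  by rewrite -PP // h1.
by rewrite -ss h2.
Qed.

Lemma order2D (W : lmodType R) (P P' : endo_field g -> W) (s s' : array -> W) :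
  order2 P s -> order2 P' s' -> order2 (fun eta => P eta + P' eta) (fun t => s t + s' t).
Proof.
move=> [a [b [e [h1 h2]]]] [a' [b' [e' [h1' h2']]]].
exists (fun j k p q r s => a j k p q r s + a' j k p q r s),
  (fun j p q r s => b j p q r s + b' j p q r s), (fun p q r s => e p q r s + e' p q r s).
split=> [eta he|t].
  rewrite h1 // h1' // coeff4D.
  under [in RHS]eq_bigr do (under eq_bigr do rewrite coeff4D; rewrite big_split /=).
  under [X in _ = _ + X + _]eq_bigr do rewrite coeff4D.
  by rewrite !big_split /= [LHS]addrACA; congr (_ + _); exact: addrACA.
rewrite h2 h2' -big_split; apply: eq_bigr => j _; rewrite -big_split; apply: eq_bigr => k _ /=.
by rewrite coeff4D scalerDr.
Qed.

Lemma order2_lin (W W' : lmodType R) (phi : W -> W') (P : endo_field g -> W) (s : array -> W) :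
  linear phi -> order2 P s -> order2 (fun eta => phi (P eta)) (fun t => phi (s t)).
Proof.
move=> lphi [a [b [e [h1 h2]]]].
exists (fun j k p q r s => phi (a j k p q r s)),
  (fun j p q r s => phi (b j p q r s)), (fun p q r s => phi (e p q r s)).
split=> [eta he|t].
  rewrite h1 // !(linear_mapD lphi) (linear_map_coeff4 lphi); congr (_ + _ + _).
    rewrite (linear_map_sum lphi); apply: eq_bigr => j _.
    by rewrite (linear_map_sum lphi); apply: eq_bigr => k _; exact: linear_map_coeff4.
  by rewrite (linear_map_sum lphi); apply: eq_bigr => j _; exact: linear_map_coeff4.
rewrite h2 (linear_map_sum lphi); apply: eq_bigr => j _.
rewrite (linear_map_sum lphi); apply: eq_bigr => k _.
by rewrite (linear_mapZ lphi) (linear_map_coeff4 lphi).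
Qed.

Lemma order2_0 (W : lmodType R) : order2 (fun=> 0 : W) (fun=> 0 : W).
Proof.
exists (fun _ _ _ _ _ _ => 0), (fun _ _ _ _ _ => 0), (fun _ _ _ _ => 0).
split=> [eta _|t].
  rewrite coeff4_0 addr0 !big1 ?addr0 // => j _; rewrite ?coeff4_0 //.
  by apply: big1 => k _; rewrite coeff4_0.
by rewrite big1 // => j _; apply: big1 => k _; rewrite coeff4_0 scaler0.
Qed.

Lemma order2_sum (W : lmodType R) I (r : seq I) (P : I -> endo_field g -> W) (s : I -> array -> W) :
  (forall i, order2 (P i) (s i)) ->
  order2 (fun eta => \sum_(i <- r) P i eta) (fun t => \sum_(i <- r) s i t).
Proof.
move=> h; elim: r => [|i r IH].
  by apply: order2_eq (order2_0 W) => [eta _|t]; rewrite big_nil.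
by apply: order2_eq (order2D (h i) IH) => [eta _|t]; rewrite big_cons.
Qed.

Lemma order2Z (W : lmodType R) k (P : endo_field g -> W) (s : array -> W) :
  order2 P s -> order2 (fun eta => k *: P eta) (fun t => k *: s t).
Proof.
by apply: order2_lin => a u v; rewrite scalerDr !scalerA mulrC.
Qed.

Lemma order2N (W : lmodType R) (P : endo_field g -> W) (s : array -> W) :
  order2 P s -> order2 (fun eta => - P eta) (fun t => - s t).
Proof.
by move=> /(order2Z (-1)); apply: order2_eq => [eta _|t]; rewrite scaleN1r.
Qed.

Lemma order2B (W : lmodType R) (P P' : endo_field g -> W) (s s' : array -> W) :
  order2 P s -> order2 P' s' -> order2 (fun eta => P eta - P' eta) (fun t => s t - s' t).
Proof. by move=> h h'; exact/order2D/order2N. Qed.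

Lemma order2_mx m n (P : endo_field g -> 'M[R]_(m, n)) (s : array -> 'M[R]_(m, n)) :
  (forall i j, @order2 R^o (fun eta => P eta i j) (fun t => s t i j)) -> order2 P s.
Proof.
move=> h; have h' i j : order2 (fun eta => P eta i j *: (delta_mx i j : 'M[R]_(m, n))) (fun t => s t i j *: delta_mx i j).
  by apply: (@order2_lin R^o _ (fun u : R^o => u *: delta_mx i j) _ _ _ (h i j)) => a u v; rewrite scalerDl scalerA.
by apply: order2_eq (order2_sum (index_enum _) (fun i => order2_sum (index_enum _) (h' i))) => [eta _|t];
  rewrite [RHS]matrix_sum_delta.
Qed.

Lemma order2_entry m n (P : endo_field g -> 'M[R]_(m, n)) (s : array -> 'M[R]_(m, n)) i j :
  order2 P s -> @order2 R^o (fun eta => P eta i j) (fun t => s t i j).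
Proof. by apply: (@order2_lin _ R^o (fun A : 'M[R]_(m, n) => A i j)) => a u v; rewrite !mxE. Qed.

Lemma order2_mulmxl m n p (A : 'M[R]_(m, n)) (P : endo_field g -> 'M[R]_(n, p)) s :
  order2 P s -> order2 (fun eta => A *m P eta) (fun t => A *m s t).
Proof. by apply: order2_lin => a u v; rewrite mulmxDr scalemxAr. Qed.

Lemma order2_mulmxr m n p (A : 'M[R]_(n, p)) (P : endo_field g -> 'M[R]_(m, n)) s :
  order2 P s -> order2 (fun eta => P eta *m A) (fun t => s t *m A).
Proof. by apply: (@order2_lin _ _ (mulmxr A)) => a u v; rewrite /= mulmxDl scalemxAl. Qed.

Lemma order2_trmx m n (P : endo_field g -> 'M[R]_(m, n)) s :
  order2 P s -> order2 (fun eta => (P eta)^T) (fun t => (s t)^T).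
Proof. by apply: order2_lin => a u v; rewrite linearP. Qed.

Lemma smooth_entry (eta : endo_field g) p q r s : sym_section X eta -> smooth V (fun z => Bchart X c eta z p q r s).
Proof.
by move=> [h _]; apply: ((smooth_mxP Vo (fun z => Bchart X c eta z p q)).1 (h _ _ _)).
Qed.

Lemma order2_jet0 p q r s : @order2 R^o (fun eta => Bchart X c eta y0 p q r s) (fun=> 0).
Proof.
exists (fun _ _ _ _ _ _ => 0), (fun _ _ _ _ _ => 0), (fun p' q' r' s' => 1 * ((p', q', r', s') == (p, q, r, s))%:R).
split=> [eta _|t].
  rewrite coeff4_delta mul1r !big1 ?add0r // => j _; rewrite ?coeff4_0 //.
  by apply: big1 => k _; rewrite coeff4_0.
by rewrite big1 // => j _; apply: big1 => k _; rewrite coeff4_0 scaler0.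
Qed.

Lemma order2_jet1 i p q r s : @order2 R^o (fun eta => pd i (fun z => Bchart X c eta z p q r s) y0) (fun=> 0).
Proof.
exists (fun _ _ _ _ _ _ => 0), (fun j p' q' r' s' => (j == i)%:R * ((p', q', r', s') == (p, q, r, s))%:R), (fun _ _ _ _ => 0).
split=> [eta he|t].
  have sB : smooth_mx V (fun z => Bchart X c eta z p q) by move=> k l; exact: smooth_entry.
  rewrite coeff4_0 addr0 big1 ?add0r => [|j _]; last by apply: big1 => k _; rewrite coeff4_0.
  rewrite (bigD1 i) //= coeff4_delta eqxx mul1r big1 ?addr0 => [|j /negPf ji].
    by rewrite (pd_mxE i r s sB Vy).
  by rewrite coeff4_delta ji mul0r.
by rewrite big1 // => j _; apply: big1 => k _; rewrite coeff4_0 scaler0.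
Qed.

Lemma order2_jet2 i j p q r s :
  @order2 R^o (fun eta => pd i (pd j (fun z => Bchart X c eta z p q r s)) y0)
    (fun t => - (xi 0 i * xi 0 j) * t p q r s).
Proof.
exists (fun i' j' p' q' r' s' => ((i', j') == (i, j))%:R * ((p', q', r', s') == (p, q, r, s))%:R), (fun _ _ _ _ _ => 0), (fun _ _ _ _ => 0).
have col (F : 'I_4 -> 'I_4 -> R) : \sum_i' \sum_j' F i' j' * ((i', j') == (i, j))%:R = F i j.
  rewrite (bigD1 i) //= (bigD1 j) //= eqxx mulr1 !big1 ?addr0 // => k /negPf h.
    by apply: big1 => l _; rewrite xpair_eqE h mulr0.
  by rewrite xpair_eqE h andbF mulr0.
split=> [eta he|t].
  have sB : smooth_mx V (fun z => Bchart X c eta z p q) by move=> k l; exact: smooth_entry.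
  rewrite coeff4_0 addr0 [X in _ + X]big1 ?addr0 => [|k _]; last by rewrite coeff4_0.
  under [RHS]eq_bigr do (under eq_bigr do rewrite coeff4_delta mulrC).
  rewrite (col (fun i j => pd i (pd j (fun z => Bchart X c eta z p q)) y0 r s)).
  rewrite (pd_mxE i r s (smooth_pd_mx Vo j sB) Vy).
  apply: pd_near; apply: filterS (Vnear Vo Vy) => z Vz.
  by rewrite (pd_mxE j r s sB Vz).
under [RHS]eq_bigr do (under eq_bigr do rewrite coeff4_delta).
rewrite -(col (fun i j => - (xi 0 i * xi 0 j) * t p q r s)).
apply: eq_bigr => i' _; apply: eq_bigr => j' _.
by rewrite /GRing.scale /= mulrAC mulrA mulrAC.
Qed.

Definition smooth_op (f : endo_field g -> 'rV[R]_4 -> R) : Prop :=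
  forall eta, sym_section X eta -> smooth V (f eta).

(** [order0] and [order1] say of a scalar function f on the chart, depending on
    a section, that it involves at most that many derivatives of the section,
    and has symbol s; they do so through the jets of f at the base point.  The
    symbol of an operator of lower order is zero, and each partial derivative
    multiplies by a component of xi (two of them by minus the product, the sign
    coming from the square of sqrt (-1)). *)
Definition order0 (f : endo_field g -> 'rV[R]_4 -> R) (s : array -> R) : Prop :=
  [/\ smooth_op f, @order2 R^o (fun eta => f eta y0) (fun=> 0),
      forall i, @order2 R^o (fun eta => pd i (f eta) y0) (fun=> 0) &
      forall i j, @order2 R^o (fun eta => pd i (pd j (f eta)) y0)
        (fun t => - (xi 0 i * xi 0 j) * s t)].

Definition order1 (f : endo_field g -> 'rV[R]_4 -> R) (s : array -> R) : Prop :=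
  [/\ smooth_op f, @order2 R^o (fun eta => f eta y0) (fun=> 0) &
      forall i, @order2 R^o (fun eta => pd i (f eta) y0) (fun t => - xi 0 i * s t)].

Lemma order2_ext (P P' : endo_field g -> R) (s s' : array -> R) :
  @order2 R^o P s -> (forall eta, sym_section X eta -> P eta = P' eta) ->
  (forall t, s t = s' t) -> @order2 R^o P' s'.
Proof. by move=> h e1 e2; apply: order2_eq h. Qed.

Lemma order0_entry p q r s : order0 (fun eta z => Bchart X c eta z p q r s) (fun t => t p q r s).
Proof.
split=> [eta he||i|i j]; [exact: smooth_entry|exact: order2_jet0|exact: order2_jet1|exact: order2_jet2].
Qed.

Lemma pd_on f f' i z : (forall w, V w -> f w = f' w :> R) -> V z -> pd i f z = pd i f' z.
Proof. by move=> e Vz; apply: pd_near; apply: filterS (Vnear Vo Vz). Qed.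

Lemma order0_ext f f' s s' : order0 f s ->
  (forall eta z, sym_section X eta -> V z -> f eta z = f' eta z) ->
  (forall t, s t = s' t) -> order0 f' s'.
Proof.
move=> [h1 h2 h3 h4] e1 e2; split=> [eta he||i|i j].
- by apply: (smooth_eq Vo) (h1 _ he) => z; exact: e1.
- by apply: order2_ext h2 _ _ => // eta he; exact: e1.
- by apply: order2_ext (h3 i) _ _ => // eta he; apply: pd_on => // z; exact: e1.
- apply: order2_ext (h4 i j) _ _ => [eta he|t]; last by rewrite e2.
  apply: pd_on => // z Vz; apply: pd_on => // w; exact: e1.
Qed.

Lemma order1_ext f f' s s' : order1 f s ->
  (forall eta z, sym_section X eta -> V z -> f eta z = f' eta z) ->
  (forall t, s t = s' t) -> order1 f' s'.
Proof.
move=> [h1 h2 h3] e1 e2; split=> [eta he||i].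
- by apply: (smooth_eq Vo) (h1 _ he) => z; exact: e1.
- by apply: order2_ext h2 _ _ => // eta he; exact: e1.
- apply: order2_ext (h3 i) _ _ => [eta he|t]; last by rewrite e2.
  by apply: pd_on => // z; exact: e1.
Qed.

Lemma order1_order0 f s : order0 f s -> order1 f (fun=> 0).
Proof.
move=> [h1 h2 h3 h4]; split=> // i.
by apply: order2_ext (h3 i) _ _ => // t; rewrite mulr0.
Qed.

Lemma order1_pd i f s : order0 f s -> order1 (fun eta => pd i (f eta)) (fun t => xi 0 i * s t).
Proof.
move=> [h1 h2 h3 h4]; split=> [eta he|//|j].
  by apply: smooth_pd; exact: h1.
by apply: order2_ext (h4 j i) _ _ => // t; ring.
Qed.

Lemma pdD f f' i z : smooth V f -> smooth V f' -> V z ->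
  pd i (fun w => f w + f' w) z = pd i f z + pd i f' z.
Proof.
move=> sf sf' Vz; apply: pdE; apply: is_deriveDf; apply: is_derive_pd.
  exact: smooth_derivable sf Vz.
exact: smooth_derivable sf' Vz.
Qed.

Lemma pdM f f' i z : smooth V f -> smooth V f' -> V z ->
  pd i (fun w => f w * f' w) z = f z * pd i f' z + pd i f z * f' z.
Proof.
move=> sf sf' Vz; apply: pdE; apply: is_deriveMf; apply: is_derive_pd.
  exact: smooth_derivable sf Vz.
exact: smooth_derivable sf' Vz.
Qed.

Lemma order2_addr (P P' : endo_field g -> R) (s s' : array -> R) :
  @order2 R^o P s -> @order2 R^o P' s' -> @order2 R^o (fun eta => P eta + P' eta) (fun t => s t + s' t).
Proof. exact: order2D. Qed.

Lemma order2_mulr (k : R) (P : endo_field g -> R) (s : array -> R) :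
  @order2 R^o P s -> @order2 R^o (fun eta => k * P eta) (fun t => k * s t).
Proof. exact: order2Z. Qed.

Lemma order0_0 : order0 (fun _ _ => 0) (fun=> 0).
Proof.
have z i z : pd i (fun _ : 'rV[R]_4 => 0 : R) z = 0 by rewrite /pd derive_cst.
split=> [eta he||i|i j]; first exact: smooth_cst.
- exact: order2_0.
- by apply: order2_ext (order2_0 _) _ _ => // eta he; rewrite z.
- apply: order2_ext (order2_0 _) _ _ => [eta he|t]; last by rewrite mulr0.
  by rewrite (@pd_on _ (fun=> 0)) // => w _; rewrite z.
Qed.

Lemma order0D f f' s s' : order0 f s -> order0 f' s' ->
  order0 (fun eta z => f eta z + f' eta z) (fun t => s t + s' t).
Proof.
move=> [h1 h2 h3 h4] [h1' h2' h3' h4']; split=> [eta he||i|i j].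
- exact: smoothD (h1 _ he) (h1' _ he).
- by apply: order2_ext (order2_addr h2 h2') _ _ => // t; rewrite addr0.
- apply: order2_ext (order2_addr (h3 i) (h3' i)) _ _ => [eta he|t]; last by rewrite addr0.
  by rewrite pdD //; [exact: h1|exact: h1'].
- apply: order2_ext (order2_addr (h4 i j) (h4' i j)) _ _ => [eta he|t]; last by rewrite mulrDr.
  rewrite -pdD //; [|exact/smooth_pd/h1|exact/smooth_pd/h1'].
  by apply: pd_on => // w Vw; rewrite pdD //; [exact: h1|exact: h1'].
Qed.

Lemma order1D f f' s s' : order1 f s -> order1 f' s' ->
  order1 (fun eta z => f eta z + f' eta z) (fun t => s t + s' t).
Proof.
move=> [h1 h2 h3] [h1' h2' h3']; split=> [eta he||i].
- exact: smoothD (h1 _ he) (h1' _ he).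
- by apply: order2_ext (order2_addr h2 h2') _ _ => // t; rewrite addr0.
- apply: order2_ext (order2_addr (h3 i) (h3' i)) _ _ => [eta he|t]; last by rewrite mulrDr.
  by rewrite pdD //; [exact: h1|exact: h1'].
Qed.

Lemma order0_sum I (r : seq I) (f : I -> _) (s : I -> _) : (forall i, order0 (f i) (s i)) ->
  order0 (fun eta z => \sum_(i <- r) f i eta z) (fun t => \sum_(i <- r) s i t).
Proof.
move=> h; elim: r => [|i r IH].
  by apply: order0_ext order0_0 _ _ => [eta z _ _|t]; rewrite big_nil.
by apply: order0_ext (order0D (h i) IH) _ _ => [eta z _ _|t]; rewrite big_cons.
Qed.

Lemma order1_sum I (r : seq I) (f : I -> _) (s : I -> _) : (forall i, order1 (f i) (s i)) ->
  order1 (fun eta z => \sum_(i <- r) f i eta z) (fun t => \sum_(i <- r) s i t).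
Proof.
move=> h; elim: r => [|i r IH].
  by apply: order1_ext (order1_order0 order0_0) _ _ => [eta z _ _|t]; rewrite big_nil.
by apply: order1_ext (order1D (h i) IH) _ _ => [eta z _ _|t]; rewrite big_cons.
Qed.

(** In the second derivatives of a product, only the term that differentiates
    the section twice has a symbol. *)
Lemma order0M C f s : smooth V C -> order0 f s ->
  order0 (fun eta z => C z * f eta z) (fun t => C y0 * s t).
Proof.
move=> sC [h1 h2 h3 h4]; split=> [eta he||i|i j].
- exact: smoothM (h1 _ he).
- by apply: order2_ext (order2_mulr (C y0) h2) _ _ => // t; rewrite mulr0.
- apply: order2_ext (order2_addr (order2_mulr (C y0) (h3 i)) (order2_mulr (pd i C y0) h2)) _ _ => [eta he|t].
    by rewrite pdM //; exact: h1.
  by rewrite !mulr0 addr0.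
- apply: order2_ext (order2_addr (order2_addr (order2_mulr (C y0) (h4 i j)) (order2_mulr (pd i C y0) (h3 j)))
     (order2_addr (order2_mulr (pd j C y0) (h3 i)) (order2_mulr (pd i (pd j C) y0) h2))) _ _ => [eta he|t].
    have sf := h1 _ he.
    rewrite (@pd_on (pd j (fun z => C z * f eta z)) (fun w => C w * pd j (f eta) w + pd j C w * f eta w)) //.
      rewrite pdD //; [|apply: smoothM => //; exact: smooth_pd..].
      rewrite !pdM //; try exact: smooth_pd.
    by move=> w Vw; rewrite pdM.
  by rewrite !mulr0 !addr0; ring.
Qed.

Lemma order1M C f s : smooth V C -> order1 f s ->
  order1 (fun eta z => C z * f eta z) (fun t => C y0 * s t).
Proof.
move=> sC [h1 h2 h3]; split=> [eta he||i].
- exact: smoothM (h1 _ he).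
- by apply: order2_ext (order2_mulr (C y0) h2) _ _ => // t; rewrite mulr0.
- apply: order2_ext (order2_addr (order2_mulr (C y0) (h3 i)) (order2_mulr (pd i C y0) h2)) _ _ => [eta he|t].
    by rewrite pdM //; exact: h1.
  by rewrite mulr0 addr0; ring.
Qed.

Lemma order2_coef_mul (A : 'M[R]_3) (P : 'I_3 -> endo_field g -> 'cV[R]_4) s q :
  (forall m, order2 (P m) (fun t => s t m)) ->
  order2 (fun eta => coef_mul A (fun m => P m eta) q) (fun t => coef_mul A (s t) q).
Proof. by move=> h; apply: order2_sum => m; exact: order2Z. Qed.

Lemma order2_ad_mx_inv (A : 'M[R]_3) (P : 'I_3 -> endo_field g -> 'cV[R]_4) s q :
  (forall m, order2 (P m) (fun t => s t m)) ->
  order2 (fun eta => ad_mx_inv A (fun m => P m eta) q) (fun t => ad_mx_inv A (s t) q).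
Proof.
move=> h; have hc q' := order2_coef_mul A q' h.
apply: (@order2_coef_mul _ (fun q' eta => ad_mx1 (coef_mul A (fun m => P m eta)) q' + isqrt2 *: coef_mul A (fun m => P m eta) q')
  (fun t q' => ad_mx1 (coef_mul A (s t)) q' + isqrt2 *: coef_mul A (s t) q')) => q'.
apply: order2D; last exact: order2Z.
by apply: order2_sum => p; apply: order2_sum => l; apply: order2Z; exact: order2_mulmxl.
Qed.

Lemma order2_ad_mx (A : 'M[R]_3) (P : 'I_3 -> endo_field g -> 'cV[R]_4) s q :
  (forall m, order2 (P m) (fun t => s t m)) ->
  order2 (fun eta => ad_mx A (fun m => P m eta) q) (fun t => ad_mx A (s t) q).
Proof.
move=> h; apply: order2_sum => p; apply: order2_sum => l; apply: order2_sum => n.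
by apply: order2Z; exact: order2_mulmxl.
Qed.

Lemma order2_ad_mxl (a : 'I_3 -> 'cV[R]_4) (P : endo_field g -> 'M[R]_3) s q :
  order2 P s -> order2 (fun eta => ad_mx (P eta) a q) (fun t => ad_mx (s t) a q).
Proof.
move=> h; apply: order2_sum => p; apply: order2_sum => l; apply: order2_sum => n.
apply: (@order2_lin _ _ (fun A : 'M[R]_3 => (epsilon3 p l q * A n l) *: (Sig0 n *m a p))) => // k u v.
by rewrite !mxE mulrDr scalerDl scalerA mulrCA.
Qed.

End Second_order.

(** * The principal symbol of the linearization *)

Section Principal_symbol.
Context {R : realType} {M : topologicalType} (X : oriented_atlas R M).
Variables (g : M -> 'M[R]_4) (gR : riemannian X g) (x : M) (xi : 'rV[R]_4).

Local Notation c := (chart_at X x).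
Local Notation V := (chart_image c).
Local Notation G := (in_chart2 X c g).
Local Notation y0 := (Defs.coord (chart_at X x) x).
Local Notation array := ('I_4 -> 'I_4 -> 'M[R]_4).

Variable th : 'rV[R]_4 -> 'M[R]_4.
Hypotheses (sth : smooth_mx V th) (GE : forall y, V y -> G y = (th y)^T *m th y)
  (dth : forall y, V y -> 0 < \det (th y)).
Implicit Types (h eta : endo_field g) (t : array).

Local Notation endo_mx := (endo_mx X x th).
Local Notation curv_mx := (curv_mx X x th).
Local Notation order0 := (@order0 _ _ X g x xi).
Local Notation order1 := (@order1 _ _ X g x xi).
Local Notation order2 := (@order2 _ _ X g x xi).

Let Vo : open V. Proof. exact: chart_open. Qed.
Let Vy : V y0. Proof. exact: chart_base. Qed.
Let gE : g x = (th y0)^T *m th y0. Proof. exact: metric_base. Qed.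
Let dt : 0 < \det (th y0). Proof. exact: det_frame_base. Qed.
Let sG : smooth_mx V G. Proof. exact: smooth_G. Qed.

Lemma order0_ip2 (w : endo_field g -> 'rV[R]_4 -> 'M[R]_4) (s : array -> 'M[R]_4) n :
  (forall i j, order0 (fun eta z => w eta z i j) (fun t => s t i j)) ->
  order0 (fun eta z => ip2 (G z) (w eta z) (SigF (th z) n))
     (fun t => ip2 (g x) (s t) (SigF (th y0) n)).
Proof.
move=> hw; have sI : smooth_mx V (fun z => invmx (G z)).
  by apply: smooth_invmx => // z Vz; exact: (det_G_neq0 GE dth Vz).
pose C i j k l z := 2^-1 * (invmx (G z) i k * invmx (G z) j l * SigF (th z) n k l).
have sC i j k l : smooth V (C i j k l).
  apply: smoothM => //; first exact: smooth_cst.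
  by apply: smoothM => //; [exact: smoothM|exact: smooth_SigF].
have G0 : G y0 = g x by exact: G_base.
have hs := order0_sum (index_enum _) (fun i => order0_sum (index_enum _) (fun j =>
  order0_sum (index_enum _) (fun k => order0_sum (index_enum _) (fun l => order0M (sC i j k l) (hw i j))))).
apply: order0_ext hs _ _ => [eta z _ _|t]; rewrite /ip2 mulr_sumr; apply: eq_bigr => i _;
  rewrite mulr_sumr; apply: eq_bigr => j _; rewrite mulr_sumr; apply: eq_bigr => k _;
  rewrite mulr_sumr; apply: eq_bigr => l _; rewrite /C ?G0; ring.
Qed.

(** The matrix of the endomorphism whose tensor B is t, by the same formulas as
    for sections ([endo_mxE]). *)
Definition array_mx t : 'M[R]_3 := \matrix_(n, m)
  ip2 (g x) (\matrix_(p, q) ip2 (g x) (t p q) (SigF (th y0) m)) (SigF (th y0) n).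

Lemma array_mx_Btensor (f : End_plus (g x)) : array_mx (Btensor f) = mat (th y0) f.
Proof.
apply/matrixP => n m; rewrite mxE.
have -> : \matrix_(p, q) ip2 (g x) (Btensor f p q) (SigF (th y0) m) = Bcoef (th y0) (mat (th y0) f) m.
  by apply/matrixP => p q; rewrite mxE (Btensor_Bcoef gE dt) (ip2_comb gE dt).
by rewrite (ip2_comb gE dt).
Qed.

Lemma order0_endo_mx n m : order0 (fun eta z => endo_mx eta z n m) (fun t => array_mx t n m).
Proof.
have h1 i j := order0_ip2 m (w := fun eta z => Bchart X c eta z i j) (s := fun t => t i j) (fun p q => order0_entry X g x xi i j p q).
have h2 : order0 (fun eta z => ip2 (G z) (Bcoef_chart X x th eta z m) (SigF (th z) n))
     (fun t => ip2 (g x) (\matrix_(p, q) ip2 (g x) (t p q) (SigF (th y0) m)) (SigF (th y0) n)).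
  apply: order0_ip2 => i j.
  by apply: order0_ext (h1 i j) _ _ => [eta z _ _|t]; rewrite mxE.
apply: order0_ext h2 _ _ => [eta z _ Vz|t]; last by rewrite mxE.
by rewrite (endo_mxE GE dth).
Qed.

Lemma order0_Bcoef m j k : order0 (fun eta z => Bcoef (th z) (endo_mx eta z) m j k)
  (fun t => Bcoef (th y0) (array_mx t) m j k).
Proof.
have sS n : smooth V (fun z => SigF (th z) n j k) by exact: smooth_SigF.
apply: order0_ext (order0_sum (index_enum _) (fun n => order0M (sS n) (order0_endo_mx n m))) _ _ => [eta z _ _|t];
  rewrite /Bcoef summxE; apply: eq_bigr => n _; rewrite [RHS]mxE mulrC //.
Qed.

Lemma order1_dBcoef m i j k : order1 (fun eta z => dBcoef G th (endo_mx eta) z m i j k)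
  (fun t => xi 0 i * Bcoef (th y0) (array_mx t) m j k).
Proof.
have so p : smooth V (fun z => conn_vec G th i z p) by exact: smooth_conn_vec.
have sC p q : smooth V (fun z => conn_vec G th i z p * epsilon3 p q m).
  by apply: smoothM => //; exact: smooth_cst.
have h := order1D (order1_pd i (order0_Bcoef m j k)) (order1_sum (index_enum _) (fun p =>
   order1_sum (index_enum _) (fun q => order1M (sC p q) (order1_order0 (order0_Bcoef q j k))))).
apply: order1_ext h _ _ => [eta z _ _|t].
  rewrite /dBcoef; congr (_ + _); apply: eq_bigr => p _; apply: eq_bigr => q _.
  by rewrite mulrAC.
rewrite big1 ?addr0 // => p _; rewrite big1 // => q _; exact: mulr0.
Qed.

Lemma order1_dBcoef3 m i j k : order1 (fun eta z => dBcoef3 G th (endo_mx eta) z m i j k)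
  (fun t => wedge12 xi (Bcoef (th y0) (array_mx t) m) i j k).
Proof. exact: order1D (order1D (order1_dBcoef m i j k) (order1_dBcoef m j k i)) (order1_dBcoef m k i j). Qed.

Lemma order1N f s : order1 f s -> order1 (fun eta z => - f eta z) (fun t => - s t).
Proof.
move=> h; apply: order1_ext (order1M (smooth_cst Vo (-1)) h) _ _ => [eta z _ _|t]; exact: mulN1r.
Qed.

(** The Christoffel terms of d_Gamma do not differentiate eta, and have no
    symbol. *)
Lemma order1_dBdual m l : order1 (fun eta z => dBdual G th (endo_mx eta) z m l 0)
  (fun t => frame_dual3 (th y0) (wedge12 xi (Bcoef (th y0) (array_mx t) m)) l 0).
Proof.
have sd : smooth V (fun z => (\det (th z))^-1).
  by apply: smoothV => // [z Vz|]; [rewrite gt_eqF // dth|exact: smooth_det].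
have hd a : order1 (fun eta z => dual3 (dBcoef3 G th (endo_mx eta) z m) a 0)
   (fun t => dual3 (wedge12 xi (Bcoef (th y0) (array_mx t) m)) a 0).
  move: a; elim/ord4P;
  [have h := order1_dBcoef3 m (inord 1) (inord 2) (inord 3)
  |have h := order1N (order1_dBcoef3 m (inord 0) (inord 2) (inord 3))
  |have h := order1_dBcoef3 m (inord 0) (inord 1) (inord 3)
  |have h := order1N (order1_dBcoef3 m (inord 0) (inord 1) (inord 2))];
  by apply: order1_ext h _ _ => [eta z _ _|t]; rewrite mxE inordK.
have h := order1M sd (order1_sum (index_enum _) (fun a => order1M (sth l a) (hd a))).
by apply: order1_ext h _ _ => [eta z _ _|t]; rewrite [RHS]mxE [X in _ = _ * X]mxE.
Qed.

Local Notation k := (covec (th y0) xi).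

Lemma frame_dual3_array_mx t m : frame_dual3 (th y0) (wedge12 xi (Bcoef (th y0) (array_mx t) m)) = symbol_dual (array_mx t) k m.
Proof. by rewrite -[in LHS](covecK dt xi) (frame_dual3_Bcoef dt). Qed.

Lemma order2_dBdual m : order2 (fun eta => dBdual G th (endo_mx eta) y0 m) (fun=> 0).
Proof.
apply: order2_mx => l j; rewrite ord1; have [_ h _] := order1_dBdual m l.
by apply: order2_eq h => // t; rewrite mxE.
Qed.

Lemma order2_pd_dBdual i m : order2 (fun eta => pd i (fun z => dBdual G th (endo_mx eta) z m) y0)
  (fun t => - xi 0 i *: symbol_dual (array_mx t) k m).
Proof.
apply: order2_mx => l j; rewrite ord1; have [_ _ h] := order1_dBdual m l.
apply: order2_eq (h i) => [eta he|t].
  have sE : smooth_mx V (endo_mx eta) by exact: smooth_endo_mx.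
  by rewrite (pd_mxE i l 0 (smooth_dBdual Vo sG sth GE dth m sE) Vy).
by rewrite frame_dual3_array_mx mxE.
Qed.

Lemma order2_endo_mx : order2 (fun eta => endo_mx eta y0) (fun=> 0).
Proof.
apply: order2_mx => n m; have [_ h _ _] := order0_endo_mx n m.
by apply: order2_eq h => // t; rewrite mxE.
Qed.

Lemma order2_pd_endo_mx i : order2 (fun eta => pd i (endo_mx eta) y0) (fun=> 0).
Proof.
apply: order2_mx => n m; have [_ _ h _] := order0_endo_mx n m.
apply: order2_eq (h i) => [eta he|t]; last by rewrite mxE.
have sE : smooth_mx V (endo_mx eta) by exact: smooth_endo_mx.
by rewrite (pd_mxE i n m sE Vy).
Qed.

Variable h : endo_field g.
Hypothesis ph : pos_sym_section X h.
Local Notation H0 := (endo_mx h y0).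

Lemma coef_mul0 (A : 'M[R]_3) q : coef_mul A (fun=> 0) q = 0.
Proof. by rewrite /coef_mul big1 // => m _; rewrite scaler0. Qed.

Lemma ad_mx_inv0 (A : 'M[R]_3) q : ad_mx_inv A (fun=> 0) q = 0.
Proof.
rewrite /ad_mx_inv [coef_mul A _](_ : _ = fun=> 0); last by apply/funext => m; rewrite coef_mul0.
rewrite [coef_mul _ _](_ : _ = coef_mul ((\det A)^-1 *: A^T) (fun=> 0)) ?coef_mul0 //.
congr coef_mul; apply/funext => m; rewrite scaler0 addr0 /ad_mx1 big1 // => p _.
by rewrite big1 // => l _; rewrite mulmx0 scaler0.
Qed.

Lemma ad_mx0 (A : 'M[R]_3) q : ad_mx A (fun=> 0) q = 0.
Proof.
by rewrite /ad_mx; do 3! (apply: big1 => ? _); rewrite mulmx0 scaler0.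
Qed.

Lemma ad_mx0l a q : ad_mx (0 : 'M[R]_3) a q = 0.
Proof.
by rewrite /ad_mx; do 3! (apply: big1 => ? _); rewrite mxE mulr0 scale0r.
Qed.

(** Of first order in eta, so without second order symbol. *)
Lemma order2_var_alpha m : order2 (fun eta => var_alpha G th (endo_mx h) (endo_mx eta) y0 m) (fun=> 0).
Proof.
apply: order2_eq (@order2_ad_mx_inv _ _ X g x xi H0 _ (fun _ _ => 0) m _) => [//|t|m'].
  exact: ad_mx_inv0.
apply: order2_eq (order2B (order2_dBdual m') (order2_ad_mxl _ m' order2_endo_mx)) => [//|t].
by rewrite ad_mx0l subr0.
Qed.

(** Among the terms of [var_pd_alpha] only the derivative of d_Gamma B_eta is of
    second order. *)
Lemma order2_var_pd_alpha i m : order2 (fun eta => var_pd_alpha G th (endo_mx h) (endo_mx eta) y0 i m)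
  (fun t => - xi 0 i *: ad_mx_inv H0 (symbol_dual (array_mx t) k) m).
Proof.
apply: order2_eq (@order2_ad_mx_inv _ _ X g x xi H0 _ (fun t m => - xi 0 i *: symbol_dual (array_mx t) k m) m _) => [//|t|m'].
  exact: ad_mx_invZ.
apply: order2_eq (order2B (order2B (order2_pd_dBdual i m')
   (order2D (order2_ad_mx (pd i (endo_mx h) y0) m' order2_var_alpha) (order2_ad_mxl _ m' (order2_pd_endo_mx i))))
   (order2_ad_mxl _ m' order2_endo_mx)) => [//|t].
by rewrite ad_mx0 !ad_mx0l addr0 !subr0.
Qed.

Lemma order2_var_A j m : @order2 R^o (fun eta => var_A G th (endo_mx h) (endo_mx eta) y0 j m) (fun=> 0).
Proof.
apply: order2_eq (order2N (order2_entry 0 j (order2_mulmxr (th y0) (order2_trmx (order2_var_alpha m))))) => [//|t].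
by rewrite trmx0 mul0mx mxE oppr0.
Qed.

Lemma order2_var_pd_A i j m : @order2 R^o (fun eta => var_pd_A G th (endo_mx h) (endo_mx eta) y0 i j m)
  (fun t => xi 0 i * ((ad_mx_inv H0 (symbol_dual (array_mx t) k) m)^T *m th y0) 0 j).
Proof.
apply: order2_eq (order2N (order2_entry 0 j (order2D (order2_mulmxr (th y0) (order2_trmx (order2_var_pd_alpha i m)))
  (order2_mulmxr (pd i th y0) (order2_trmx (order2_var_alpha m)))))) => [//|t].
by rewrite trmx0 mul0mx addr0 linearZ /= -scalemxAl mxE mulNr opprK.
Qed.

Lemma order2_cross3 (s : 'I_3 -> R) (P : 'I_3 -> endo_field g -> R) m :
  (forall q, @order2 R^o (P q) (fun=> 0)) ->
  @order2 R^o (fun eta => cross3 s (fun q => P q eta) m) (fun=> 0).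
Proof.
move=> hP; apply: order2_eq (order2_sum (index_enum _) (fun p => order2_sum (index_enum _) (fun q =>
  order2Z (s p * epsilon3 p q m) (hP q)))) => [eta _|t].
  by apply: eq_bigr => p _; apply: eq_bigr => q _; exact: mulrAC.
by rewrite big1 // => p _; rewrite big1 // => q _; rewrite scaler0.
Qed.

(** The variation of A(h) enters that of the curvature through its derivatives, of
    second order in eta, and through brackets with A(h), of first order. *)
Lemma order2_var_curv i j m : @order2 R^o (fun eta => var_curv G th (endo_mx h) (endo_mx eta) y0 i j m)
  (fun t => xi 0 i * ((ad_mx_inv H0 (symbol_dual (array_mx t) k) m)^T *m th y0) 0 j
          - xi 0 j * ((ad_mx_inv H0 (symbol_dual (array_mx t) k) m)^T *m th y0) 0 i).
Proof.
have h1 := order2_cross3 (conn_A G th (endo_mx h) i y0) m (order2_var_A j).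
have h2 := order2N (order2_cross3 (conn_A G th (endo_mx h) j y0) m (order2_var_A i)).
apply: order2_eq (order2D (order2B (order2_var_pd_A i j m) (order2_var_pd_A j i m)) (order2D h1 h2)) => [eta _|t].
  rewrite /var_curv; congr (_ + (_ + _)).
  rewrite /cross3 exchange_big -sumrN; apply: eq_bigr => p _ /=; rewrite -sumrN; apply: eq_bigr => q _.
  by rewrite epsilon3C; move: (var_A _ _ _ _ _ _ _) (conn_A _ _ _ _ _ _) => a b; ring.
by rewrite oppr0 !addr0.
Qed.

Lemma ip2_is_linear (u w : 'M[R]_4) : linear (fun A : 'M[R]_4 => ip2 u A w : R^o).
Proof. exact: ip2_linear. Qed.

Lemma order2_var_curv_mx : order2 (fun eta => var_curv_mx X x th h eta)
  (fun t => wedge_plus k (ad_mx_inv H0 (symbol_dual (array_mx t) k))).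
Proof.
apply: order2_mx => n m.
have hW : order2 (fun eta => \matrix_(i, j) var_curv G th (endo_mx h) (endo_mx eta) y0 i j m : 'M[R]_4)
   (fun t => \matrix_(i, j) (xi 0 i * ((ad_mx_inv H0 (symbol_dual (array_mx t) k) m)^T *m th y0) 0 j
          - xi 0 j * ((ad_mx_inv H0 (symbol_dual (array_mx t) k) m)^T *m th y0) 0 i)).
  by apply: order2_mx => i j; apply: order2_eq (order2_var_curv i j m) => [eta _|t]; rewrite [RHS]mxE.
apply: order2_eq (order2_lin (ip2_is_linear (g x) (SigF (th y0) n)) hW) => [eta _|t].
  by rewrite mxE.
exact: wedge_plus_ip2.
Qed.

(** The term F^+ h^-1 eta h^-1 of [var_Phi] is of order zero. *)
Lemma var_Phi_principal_symbol :
  order2 (fun eta => var_Phi X x th h eta)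
    (fun t => mkEnd (g x) (th y0)
       (wedge_plus k (ad_mx_inv H0 (symbol_dual (array_mx t) k)) *m invmx H0)).
Proof.
have lmk : linear (mkEnd (g x) (th y0)).
  move=> a u v; apply: (mat_inj gE dt).
  by rewrite mat_linear !(mkEndK gE dt).
have hh := order2B (order2_mulmxr (invmx H0) order2_var_curv_mx)
  (order2_mulmxl (curv_mx h) (order2_mulmxr (invmx H0) (order2_mulmxl (invmx H0) order2_endo_mx))).
apply: order2_eq (order2_lin lmk hh) => [//|t].
by rewrite mulmx0 mul0mx mulmx0 subr0.
Qed.

(** The endomorphism found for the array B_eta is the frame expression of
    the symbol ([symbol_mat_wedge]). *)
Lemma DPhi_principal_symbol : has_principal_symbol X (DPhi X h) x xi (symbol_formula (h x) xi).
Proof.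
have [a [b [e [h1 h2]]]] := var_Phi_principal_symbol.
exists a, b, e; split=> [eta he|eta he].
  by rewrite (DPhiE gR sth GE dth ph he); exact: h1.
have hE : endo_mx h y0 = mat (th y0) (h x) by exact: endo_mx_base.
have dH : \det (mat (th y0) (h x)) != 0 by rewrite -hE; exact: (endo_mx_det GE dth ph).
rewrite -h2; apply: (mat_inj gE dt); rewrite (mkEndK gE dt) array_mx_Btensor hE.
exact: (symbol_mat_wedge gE dt).
Qed.

End Principal_symbol.

Section Conclusion.
Context {R : realType} {M : topologicalType} (X : oriented_atlas R M).
Variables (g : M -> 'M[R]_4) (gR : riemannian X g).

Lemma frame_exists_at (p : M) : exists th : 'M[R]_4, g p = th^T *m th /\ 0 < \det th.
Proof.
have [th sth hth] := frame_exists gR p.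
have GE y (Vy : chart_image (chart_at X p) y) := (hth y Vy).1.
have dth y (Vy : chart_image (chart_at X p) y) := (hth y Vy).2.
exists (th (Defs.coord (chart_at X p) p)); split; first exact: metric_base.
exact: det_frame_base.
Qed.

Lemma ip2_gt0 (p : M) (v : subvs_of (LambdaPlus (g p))) : v != 0 -> 0 < ip_plus v v.
Proof.
have [th [gE dth]] := frame_exists_at p; move=> v0.
rewrite (ip_plusE gE dth); have [m vm] : exists m, ip2 (g p) (vsval v) (SigF th m) != 0.
  apply/existsP; apply: contraR v0; rewrite negb_exists => /forallP h.
  rewrite (vsvalE gE dth v) big1 // => m _.
  by have := h m; rewrite negbK => /eqP ->; rewrite scale0r.
rewrite (bigD1 m) //= ltr_pwDl ?sumr_ge0 // => [|j _]; rewrite -expr2 ?sqr_ge0 //.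
by rewrite lt_neqAle eq_sym sqrf_eq0 vm sqr_ge0.
Qed.

(** In the frame, the identity has a constant matrix, so that its tensor is a
    combination of the smooth forms [SigF th m]. *)
Lemma id_pos_sym_section : pos_sym_section X (id_field g).
Proof.
split; last by move=> p v v0; rewrite /id_field id_lfunE; exact: ip2_gt0.
split=> [p i j|p]; last exact: selfadjoint_id.
have [th sth hth] := frame_exists gR p.
have Vo : open (chart_image (chart_at X p)) by exact: chart_open.
have GE y (Vy : chart_image (chart_at X p) y) := (hth y Vy).1.
have dth y (Vy : chart_image (chart_at X p) y) := (hth y Vy).2.
have s1 : smooth_mx (chart_image (chart_at X p)) (fun _ : 'rV[R]_4 => 1%:M : 'M[R]_3).
  exact: smooth_mx_cst.
apply/(smooth_mxP Vo).
have sc : smooth_mx (chart_image (chart_at X p))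
    (fun y => comb (th y) (fun m => Bcoef (th y) (1%:M : 'M[R]_3) m i j)).
  apply: (smooth_comb Vo sth) => m.
  exact: (smooth_Bcoef Vo sth m i j s1).
apply: (smooth_mx_eq Vo) sc => y Vy.
rewrite (Bchart_frame GE dth) //; congr comb; apply/funext => m; congr (Bcoef _ _ m i j).
by rewrite /endo_mx /id_field (mat_id (frame_atE GE Vy) (det_frame_at dth Vy)).
Qed.

End Conclusion.

Theorem proposition2p15 (R : realType) (M : topologicalType)
  (X : oriented_atlas R M) (g : M -> 'M[R]_4)
  (M_hausdorff : hausdorff_space M) (M_compact : compact [set: M])
  (M_connected : connected [set: M]) (g_riemannian : riemannian X g) :
  (forall h : endo_field g, pos_sym_section X h ->
     (forall eta : endo_field g, sym_section X eta ->
        forall x, is_linearization_at X h eta x (DPhi X h eta x)) /\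
     forall (x : M) (xi : 'rV[R]_4), xi != 0 ->
       let sigma := symbol_formula (h x) xi in
       [/\ linear sigma,
           has_principal_symbol X (DPhi X h) x xi sigma &
           set_bij (@selfadjoint R (g x)) (@selfadjoint R (g x)) sigma]) /\
  (forall (x : M) (xi : 'rV[R]_4), xi != 0 ->
     let sigma := symbol_formula (endo_id (g x)) xi in
     has_principal_symbol X (DPhi X (id_field g)) x xi sigma /\
     forall eta eta0 eta1 : End_plus (g x), selfadjoint eta ->
       eta = eta0 + eta1 -> trace_plus eta0 = 0 ->
       3%:R *: eta1 = trace_plus eta *: endo_id (g x) ->
       sigma eta = (norm2_cov (g x) xi / (2 * Num.sqrt 2)) *: (eta1 - 2 *: eta0)).
Proof.
have main (h : endo_field g) : pos_sym_section X h -> forall x xi,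
    (forall eta, sym_section X eta -> is_linearization_at X h eta x (DPhi X h eta x)) /\
    has_principal_symbol X (DPhi X h) x xi (symbol_formula (h x) xi).
  move=> ph x xi; have [th sth hth] := frame_exists g_riemannian x.
  have GE y (Vy : chart_image (chart_at X x) y) := (hth y Vy).1.
  have dth y (Vy : chart_image (chart_at X x) y) := (hth y Vy).2.
  split=> [eta he|]; last exact: (DPhi_principal_symbol g_riemannian xi sth GE dth ph).
  rewrite (DPhiE g_riemannian sth GE dth ph he).
  exact: (linearization g_riemannian sth GE dth ph he).
split=> [h ph|x xi _ sigma].
  split=> [eta he x|x xi xi0 sigma]; first exact: (main h ph x 0).1.
  have [th [gE dth]] := frame_exists_at g_riemannian x.
  have [[_ sh] hp] := ph.
  split; last exact: (symbol_bij gE dth xi0 (sh x) (hp x)).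
    exact: (symbol_linear gE dth xi (posdef_det (posdef_mat gE dth (hp x)))).
  exact: (main h ph x xi).2.
have [th [gE dth]] := frame_exists_at g_riemannian x.
split=> [|eta eta0 eta1 es e t0 e1].
  exact: (main _ (id_pos_sym_section g_riemannian) x xi).2.
exact: (symbol_id gE dth xi es e t0 e1).
Qed.
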